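(* Let $f:\mathbb{D}\to\mathbb{G}_2$ be a complex geodesic in the symmetrized bidisc of one of the following two forms. (1) If $f(\lambda)=\pi\big(B(\sqrt{\lambda}),B(-\sqrt{\lambda})\big)$, $\lambda\in\mathbb{D}$, where $B(\lambda)=\lambda\frac{\lambda-\alpha}{1-\bar\alpha\lambda}$ for some $\alpha\in\mathbb{D}\cup\{1\}$, then $f$ has a unique left inverse if and only if $\alpha\in\mathbb{D}\setminus\{0\}$. (2) If $f(\lambda)=\pi(\lambda,a(\lambda))$, $\lambda\in\mathbb{D}$, where $a$ is a holomorphic automorphism of $\mathbb{D}$ such that $a(\lambda)\neq\lambda$ for all $\lambda\in\mathbb{D}$, then $f$ has a unique left inverse if and only if the function $\lambda\mapsto a(\lambda)-\lambda$ has a double root on the unit circle $\partial\mathbb{D}$. Moreover, both cases (uniqueness and non-uniqueness of the left inverse) do occur.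
   Context: $\mathbb{D}$ denotes the open unit disc in $\mathbb{C}$. Let $\pi(\lambda_1,\lambda_2):=(\lambda_1+\lambda_2,\lambda_1\lambda_2)$. The symmetrized bidisc is $\mathbb{G}_2:=\pi(\mathbb{D}^2)\subset\mathbb{C}^2$. In (1), when $\alpha=1$ the formula for $B$ reads $B(\lambda)=-\lambda$; the value of $f(\lambda)$ does not depend on the choice of the square root of $\lambda$. A holomorphic map $f:\mathbb{D}\to\mathbb{G}_2$ is a complex geodesic if there is a holomorphic function $F:\mathbb{G}_2\to\mathbb{D}$ with $F\circ f=\operatorname{id}_{\mathbb{D}}$; any such $F$ is called a left inverse of $f$. *)

(* Defs.v *)
From Stdlib Require Import Reals.
From Coquelicot Require Import Coquelicot.

Open Scope C_scope.

(* The normed module of pairs is given by canonical structures on [C * C];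
   naming it fixes complex scalars and hence complex differentiability. *)
Definition C2 : NormedModule C_AbsRing :=
  prod_NormedModule C_AbsRing C_NormedModule C_NormedModule.

(* Functions are total and only their restriction to [D] matters; the
   definitions are used for open [D], where complex (Frechet) differentiability
   at every point of [D] is holomorphy. *)
Definition holomorphic1 {V : NormedModule C_AbsRing}
    (D : C -> Prop) (f : C -> V) : Prop :=
  forall z : C, D z -> ex_derive (K := C_AbsRing) (V := V) f z.

Definition holomorphic2 (D : C * C -> Prop) (F : C * C -> C) : Prop :=
  forall p : C * C, D p ->
    ex_filterdiff (K := C_AbsRing) (U := C2) (V := C_NormedModule)
      F (locally (p : C2)).

Definition unit_disc (z : C) : Prop := (Cmod z < 1)%R.

Definition sympi (l : C * C) : C * C := (fst l + snd l, fst l * snd l).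

Definition G2 (p : C * C) : Prop :=
  exists l : C * C, unit_disc (fst l) /\ unit_disc (snd l) /\ p = sympi l.

Definition is_left_inverse (f : C -> C * C) (F : C * C -> C) : Prop :=
  holomorphic2 G2 F /\
  (forall p, G2 p -> unit_disc (F p)) /\
  (forall z, unit_disc z -> F (f z) = z).

Definition complex_geodesic (f : C -> C * C) : Prop :=
  holomorphic1 (V := C2) unit_disc f /\
  (forall z, unit_disc z -> G2 (f z)) /\
  exists F, is_left_inverse f F.

Definition has_unique_left_inverse (f : C -> C * C) : Prop :=
  (exists F, is_left_inverse f F) /\
  (forall F1 F2, is_left_inverse f F1 -> is_left_inverse f F2 ->
     forall p, G2 p -> F1 p = F2 p).

(* For [alpha = 1] the formula gives [- z] at every point [z <> 1]. *)
Definition Blaschke (alpha z : C) : C := z * ((z - alpha) / (1 - Cconj alpha * z)).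

(* [w] ranges over all square roots of [z]: the value does not depend on the
   choice, since [w] and [- w] enter symmetrically. *)
Definition root_form (alpha : C) (f : C -> C * C) : Prop :=
  (unit_disc alpha \/ alpha = 1) /\
  forall z, unit_disc z -> forall w : C, w ^ 2 = z ->
    f z = sympi (Blaschke alpha w, Blaschke alpha (- w)).

Definition disc_automorphism (a : C -> C) : Prop :=
  holomorphic1 (V := C_NormedModule) unit_disc a /\
  (forall z, unit_disc z -> unit_disc (a z)) /\
  exists b : C -> C,
    holomorphic1 (V := C_NormedModule) unit_disc b /\
    (forall z, unit_disc z -> unit_disc (b z)) /\
    (forall z, unit_disc z -> b (a z) = z) /\
    (forall z, unit_disc z -> a (b z) = z).

Definition graph_form (a : C -> C) (f : C -> C * C) : Prop :=
  disc_automorphism a /\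
  (forall z, unit_disc z -> a z <> z) /\
  forall z, unit_disc z -> f z = sympi (z, a z).

Definition zero_of_order (n : nat) (g : C -> C) (zeta : C) : Prop :=
  exists h : C -> C,
    h zeta <> 0 /\
    locally zeta (fun z =>
      ex_derive (K := C_AbsRing) (V := C_NormedModule) h z /\
      g z = (z - zeta) ^ n * h z).

(* A function given on the open disc has no values on the circle: its roots
   there are those of its holomorphic extension [g] to a neighbourhood of the
   closed disc. Automorphisms of the disc have such an extension, and the values
   of [g] on the closed disc and near it are determined by [phi]. *)
Definition has_double_root_on_circle (phi : C -> C) : Prop :=
  exists (U : C -> Prop) (g : C -> C),
    open U /\ (forall z, (Cmod z <= 1)%R -> U z) /\
    holomorphic1 (V := C_NormedModule) U g /\
    (forall z, unit_disc z -> g z = phi z) /\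
    exists zeta : C, Cmod zeta = 1%R /\ zero_of_order 2 g zeta.

(* Main.v *)
(* A left inverse [F] of a geodesic is studied in half-plane coordinates: a Cayley transform
   at a point of the circle identifies the symmetrized bidisc with the pairs [(u, v)] such that
   [u + sqrt v] and [u - sqrt v] lie in the upper half-plane, and [F] becomes a function [K]
   with values in the upper half-plane.

   Case (1) with [alpha] in the punctured disc: the geodesic is [v = c (u^2 + 1)] with
   [c = |alpha|^2], and [K = u] on it. The discs [v = t (u^2 + 1)], [0 <= t <= 1], all pass through
   [(i, 0)], where the derivatives for [t = 0] and [t = 1] have modulus at most [1] by Schwarz,
   while their convex combination for [t = c] equals [1]. Hence all derivatives are [1], [K = u]
   on every such disc, and the identity theorem in [v] gives [K = u] everywhere.

   Case (2): at a boundary fixed point the automorphism is an affine map [Z |-> k Z + tau], and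
   the double root means [k = 1]. If [k <> 1], an arithmetic and a harmonic mean of the
   coordinates give two left inverses. If [k = 1], the geodesic is [v = v0 = tau^2 / 4], and
   one may assume [K (u, v0) = u]. Along [u = i y] with [y] large, Schwarz lemmas of orders one
   and two bound [K (i y, v) - i y] near [v0], so Julia's lemma yields [Im K (u, v) >= Im u] for real
   [v], and [Im K (i y, v) - y = O(y^-3)]; this forces [K (u, v) = u] for [v] in [[0, 2 v0]], and
   again the identity theorem applies.

   The complex analysis rests on a Goursat argument for the homotopy shrinking a circle to an
   interior point, which gives Cauchy's formula and Taylor remainders. *)

Require Import Defs.
From Stdlib Require Import Reals Lra Lia Psatz.
From Coquelicot Require Import Coquelicot.

Open Scope C_scope.

(** * Complex differentiability with explicit estimates *)

(** In case (1) the number [c = |alpha|^2] lies strictly between 0 and 1 exactly when [alpha] lies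
    in the punctured disc, and then the geodesic is a proper convex combination of the discs [v = 0]
    and [v = u^2 + 1]. These two extremes correspond to [alpha = 0] and [alpha = 1], where two left
    inverses are written down. The derivative argument works because all those discs meet at an
    interior point. In case (2) with [k = 1] the discs of constant [v >= 0] are disjoint and share
    only the boundary point infinity, so the Schwarz lemma is replaced by its boundary version
    there. It becomes quantitative because over [u = i y] the admissible [v] contain a disc of
    radius [y^2] about [v0]: moving [v0] by a bounded [h] costs [O(1/y)], and only [O(1/y^3)] after
    averaging over [h] and [- h], which removes the odd part. Julia's lemma bounds each imaginary
    part from below, the average bounds their sum from above. For [k <> 1] the automorphism has two
    distinct boundary fixed points; they merge into the double root when [k = 1]. *)

Ltac change_C := match goal with |- @eq _ ?x ?y => change (@eq C x y) end.

(** Division-free form of the complex derivative, with [Cmod] in place of the abstract norms;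
    [cdiff_is_derive] ties it to [is_derive]. *)
Definition cdiff (f : C -> C) (z l : C) : Prop :=
  forall eps : R, (0 < eps)%R -> exists del : R, (0 < del)%R /\
    forall w, (Cmod (w - z) < del)%R ->
      (Cmod (f w - f z - l * (w - z)) <= eps * Cmod (w - z))%R.

Lemma Cmod_le_eps_eq_0 (z : C) :
  (forall eps : R, (0 < eps)%R -> (Cmod z <= eps)%R) -> z = 0.
Proof.
intros H. apply Cmod_eq_0.
destruct (Rle_lt_or_eq_dec 0 (Cmod z) (Cmod_ge_0 z)) as [h | h]; auto.
specialize (H (Cmod z / 2)%R). lra.
Qed.

Lemma Cmod_sub_comm (z w : C) : Cmod (z - w) = Cmod (w - z).
Proof. replace (z - w) with (- (w - z)) by ring. apply Cmod_opp. Qed.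

Lemma Cmod_sub_triangle (z w : C) : (Cmod (z - w) <= Cmod z + Cmod w)%R.
Proof.
unfold Cminus. rewrite <- (Cmod_opp w). apply Cmod_triangle.
Qed.

Lemma Cmod_triangle_inv (z w : C) : (Cmod z - Cmod w <= Cmod (z - w))%R.
Proof.
generalize (Cmod_triangle (z - w) w). replace (z - w + w) with z by ring. lra.
Qed.

Lemma cdiff_is_derive f z l :
  is_derive (K := C_AbsRing) (V := C_NormedModule) f z l <-> cdiff f z l.
Proof.
split.
- intros [_ H] eps Heps.
  destruct (H z (fun P HP => HP) (mkposreal eps Heps)) as [d Hd].
  exists d; split; [apply cond_pos|]. intros w Hw.
  generalize (Hd w Hw). simpl. unfold norm, minus, plus, opp, scal; simpl.
  unfold mult; simpl. intros E. rewrite (Cmult_comm l). exact E.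
- intros H. split.
  + apply is_linear_scal_l.
  + intros x Hx eps.
    assert (x = z) as -> by (symmetry; apply (is_filter_lim_locally_unique z x Hx)).
    destruct (H eps (cond_pos eps)) as [d [Hd Hd']].
    exists (mkposreal d Hd). intros w Hw. generalize (Hd' w Hw).
    rewrite (Cmult_comm l). intros E; exact E.
Qed.

Lemma cdiff_ext_loc f g z l (d : R) :
  (0 < d)%R -> (forall w, (Cmod (w - z) < d)%R -> f w = g w) ->
  cdiff f z l -> cdiff g z l.
Proof.
intros Hd E H eps He. destruct (H eps He) as [d' [Hd' H']].
exists (Rmin d d'); split; [now apply Rmin_pos|].
intros w Hw. rewrite <- E, <- E.
- apply H'. eapply Rlt_le_trans; [exact Hw | apply Rmin_r].
- replace (z - z) with (RtoC 0) by ring. now rewrite Cmod_0.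
- eapply Rlt_le_trans; [exact Hw | apply Rmin_l].
Qed.

Lemma cdiff_cont f z l : cdiff f z l ->
  forall eps : R, (0 < eps)%R -> exists del : R, (0 < del)%R /\
    forall w, (Cmod (w - z) < del)%R -> (Cmod (f w - f z) <= eps)%R.
Proof.
intros H eps He. destruct (H 1%R Rlt_0_1) as [d [Hd H']].
assert (P : (0 < Cmod l + 1)%R) by (generalize (Cmod_ge_0 l); lra).
exists (Rmin d (eps / (Cmod l + 1))); split.
- apply Rmin_pos; auto. now apply Rdiv_lt_0_compat.
- intros w Hw.
  assert (H1 := H' w (Rlt_le_trans _ _ _ Hw (Rmin_l _ _))).
  assert (H2 : (Cmod (w - z) < eps / (Cmod l + 1))%R)
    by (eapply Rlt_le_trans; [exact Hw | apply Rmin_r]).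
  replace (f w - f z) with ((f w - f z - l * (w - z)) + l * (w - z)) by ring.
  eapply Rle_trans; [apply Cmod_triangle|]. rewrite Cmod_mult.
  apply Rlt_div_r in H2; [|exact P]. nra.
Qed.

Lemma cdiff_lipschitz f z l : cdiff f z l ->
  exists del : R, (0 < del)%R /\
    forall w, (Cmod (w - z) < del)%R ->
      (Cmod (f w - f z) <= (Cmod l + 1) * Cmod (w - z))%R.
Proof.
intros H. destruct (H 1%R Rlt_0_1) as [d [Hd H']].
exists d; split; auto. intros w Hw. specialize (H' w Hw).
replace (f w - f z) with ((f w - f z - l * (w - z)) + l * (w - z)) by ring.
eapply Rle_trans; [apply Cmod_triangle|]. rewrite Cmod_mult. lra.
Qed.

Lemma cdiff_const c z : cdiff (fun _ => c) z 0.
Proof.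
intros eps He; exists 1%R; split; [lra|]. intros w _.
replace (c - c - 0 * (w - z)) with (RtoC 0) by ring. rewrite Cmod_0.
generalize (Cmod_ge_0 (w - z)); nra.
Qed.

Lemma cdiff_id z : cdiff (fun w => w) z 1.
Proof.
intros eps He; exists 1%R; split; [lra|]. intros w _.
replace (w - z - 1 * (w - z)) with (RtoC 0) by ring. rewrite Cmod_0.
generalize (Cmod_ge_0 (w - z)); nra.
Qed.

Lemma cdiff_eq f z l l' : cdiff f z l -> l = l' -> cdiff f z l'.
Proof. now intros H <-. Qed.

Lemma cdiff_comp f g z l m :
  cdiff f z l -> cdiff g (f z) m -> cdiff (fun w => g (f w)) z (m * l).
Proof.
intros Hf Hg eps He.
destruct (cdiff_lipschitz _ _ _ Hf) as [d1 [Hd1 H1]].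
set (L := (Cmod l + 1)%R) in *.
assert (PL : (0 < L)%R) by (unfold L; generalize (Cmod_ge_0 l); lra).
set (M := (Cmod m + 1)%R).
assert (PM : (0 < M)%R) by (unfold M; generalize (Cmod_ge_0 m); lra).
destruct (Hg (eps / 2 / L)%R) as [d2 [Hd2 H2]].
{ apply Rdiv_lt_0_compat; lra. }
destruct (Hf (eps / 2 / M)%R) as [d3 [Hd3 H3]].
{ apply Rdiv_lt_0_compat; lra. }
exists (Rmin (Rmin d1 d3) (d2 / L)); split.
{ repeat apply Rmin_pos; auto. now apply Rdiv_lt_0_compat. }
intros w Hw.
assert (Hw1 : (Cmod (w - z) < d1)%R).
{ eapply Rlt_le_trans; [exact Hw|]. eapply Rle_trans; [apply Rmin_l|apply Rmin_l]. }
assert (Hw3 : (Cmod (w - z) < d3)%R).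
{ eapply Rlt_le_trans; [exact Hw|]. eapply Rle_trans; [apply Rmin_l|apply Rmin_r]. }
assert (Hw2 : (Cmod (w - z) < d2 / L)%R).
{ eapply Rlt_le_trans; [exact Hw|]. apply Rmin_r. }
apply Rlt_div_r in Hw2; [|exact PL].
specialize (H1 w Hw1). specialize (H3 w Hw3).
assert (H2' : (Cmod (f w - f z) < d2)%R) by nra.
specialize (H2 _ H2').
replace (g (f w) - g (f z) - m * l * (w - z)) with
  ((g (f w) - g (f z) - m * (f w - f z)) + m * (f w - f z - l * (w - z))) by ring.
eapply Rle_trans; [apply Cmod_triangle|]. rewrite Cmod_mult.
assert (E1 : (eps / 2 / L * Cmod (f w - f z) <= eps / 2 * Cmod (w - z))%R).
{ replace (eps / 2 * Cmod (w - z))%R with (eps / 2 / L * (L * Cmod (w - z)))%R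
    by (field; lra).
  apply Rmult_le_compat_l; auto. left; apply Rdiv_lt_0_compat; lra. }
assert (E2 : (Cmod m * Cmod (f w - f z - l * (w - z)) <= eps / 2 * Cmod (w - z))%R).
{ replace (eps / 2 * Cmod (w - z))%R with (M * (eps / 2 / M * Cmod (w - z)))%R
    by (field; lra).
  apply Rmult_le_compat; auto using Cmod_ge_0. unfold M; lra. }
lra.
Qed.

(** The increment is measured by the sum of the moduli of its coordinates, which the norm of [C2]
    matches up to a factor 2 ([C2_norm_le], [C2_norm_ge]). *)
Definition cdiff2 (F : C * C -> C) (p : C * C) (a b : C) : Prop :=
  forall eps : R, (0 < eps)%R -> exists del : R, (0 < del)%R /\
    forall q : C * C,
      (Cmod (fst q - fst p) < del)%R -> (Cmod (snd q - snd p) < del)%R ->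
      (Cmod (F q - F p - (a * (fst q - fst p) + b * (snd q - snd p)))
        <= eps * (Cmod (fst q - fst p) + Cmod (snd q - snd p)))%R.

Lemma sqrt_2_lt_2 : (sqrt 2 < 2)%R.
Proof. rewrite <- (sqrt_pow2 2) at 2 by lra. apply sqrt_lt_1_alt. lra. Qed.

Lemma sqrt_sum_sqr_le (a b : R) : (0 <= a -> 0 <= b -> sqrt (a ^ 2 + b ^ 2) <= a + b)%R.
Proof.
intros A B. rewrite <- (sqrt_pow2 (a + b)) by lra. apply sqrt_le_1_alt. nra.
Qed.

Lemma sqrt_sum_sqr_ge (a b : R) : (0 <= a -> 0 <= b -> a + b <= 2 * sqrt (a ^ 2 + b ^ 2))%R.
Proof.
intros A B.
assert (a <= sqrt (a ^ 2 + b ^ 2))%R.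
{ rewrite <- (sqrt_pow2 a) at 1 by lra. apply sqrt_le_1_alt. nra. }
assert (b <= sqrt (a ^ 2 + b ^ 2))%R.
{ rewrite <- (sqrt_pow2 b) at 1 by lra. apply sqrt_le_1_alt. nra. }
lra.
Qed.

Lemma C2_norm_le (x : C2) : (norm x <= Cmod (fst x) + Cmod (snd x))%R.
Proof. apply sqrt_sum_sqr_le; apply Cmod_ge_0. Qed.

Lemma C2_norm_ge (x : C2) : (Cmod (fst x) + Cmod (snd x) <= 2 * norm x)%R.
Proof. apply sqrt_sum_sqr_ge; apply Cmod_ge_0. Qed.

Lemma linear_bound (a b s t n : R) :
  (0 <= a -> 0 <= b -> 0 <= s -> 0 <= t -> s + t <= 2 * n ->
   a * s + b * t <= (2 * (a + b) + 1) * n)%R.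
Proof.
intros A B S T N.
assert (H0 : (s <= 2 * n)%R) by lra. assert (H1 : (t <= 2 * n)%R) by lra.
generalize (Rmult_le_compat_l _ _ _ A H0) (Rmult_le_compat_l _ _ _ B H1). lra.
Qed.

Lemma ex_filterdiff_cdiff2 F (p : C * C) :
  ex_filterdiff (K := C_AbsRing) (U := C2) (V := C_NormedModule) F (locally (p : C2))
  <-> exists a b, cdiff2 F p a b.
Proof.
split.
- intros [l [[L1 L2 _] H]]. exists (l (RtoC 1, RtoC 0)), (l (RtoC 0, RtoC 1)).
  intros eps He.
  destruct (H p (fun P HP => HP) (mkposreal eps He)) as [d Hd].
  exists d; split; [apply cond_pos|]. intros q Hq1 Hq2.
  assert (B : ball (p : C2) d q).
  { split; apply C_NormedModule_mixin_compat1; assumption. }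
  specialize (Hd q B). simpl in Hd.
  (* A complex-linear map is determined by its values on the two basis vectors; these are the
     partial derivatives. *)
  assert (El : forall h : C2, l h = l (RtoC 1, RtoC 0) * fst h + l (RtoC 0, RtoC 1) * snd h).
  { intros [h1 h2]. change C in h1, h2.
    transitivity (l (plus (scal h1 ((RtoC 1, RtoC 0) : C2)) (scal h2 ((RtoC 0, RtoC 1) : C2)))).
    - f_equal. unfold plus, scal; simpl. unfold prod_plus, prod_scal; simpl.
      unfold plus, scal; simpl. unfold mult; simpl. f_equal; change_C; ring.
    - rewrite L1, !L2. unfold plus, scal; simpl. unfold mult; simpl. change_C; ring. }
  rewrite El in Hd. eapply Rle_trans; [exact Hd|].
  apply Rmult_le_compat_l; [lra|]. apply (C2_norm_le (minus q p)).
- intros [a [b H]]. exists (fun h : C2 => a * fst h + b * snd h). split.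
  + split.
    * intros [x1 x2] [y1 y2]. change C in x1, x2, y1, y2. unfold plus; simpl. unfold plus; simpl. change_C; ring.
    * intros k [x1 x2]. change C in k, x1, x2. unfold scal; simpl. unfold scal; simpl. unfold mult; simpl. change_C; ring.
    * exists (2 * (Cmod a + Cmod b) + 1)%R.
      assert (A := Cmod_ge_0 a). assert (B := Cmod_ge_0 b). split; [lra|].
      intros x. unfold norm at 1; simpl.
      eapply Rle_trans; [apply Cmod_triangle|]. rewrite !Cmod_mult.
      apply linear_bound; try apply Cmod_ge_0. apply C2_norm_ge.
  + intros x Hx eps.
    assert (x = p) as -> by (symmetry; apply (is_filter_lim_locally_unique (V := C2) p x Hx)).
    destruct (H (eps / 2)%R) as [d [Hd Hd']].
    { generalize (cond_pos eps); lra. }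
    (* Balls of [C_NormedModule] control the modulus only up to a factor [sqrt 2], whence half the
       radius. *)
    assert (Hd2 : (0 < d / 2)%R) by lra.
    exists (mkposreal _ Hd2). intros q [B1 B2].
    apply C_NormedModule_mixin_compat2 in B1. apply C_NormedModule_mixin_compat2 in B2.
    assert (S2 := sqrt_2_lt_2).
    simpl in B1, B2.
    assert (sqrt 2 * (d / 2) < d)%R by nra.
    assert (P := Hd' q (Rlt_trans _ _ _ B1 H0) (Rlt_trans _ _ _ B2 H0)).
    eapply Rle_trans; [exact P|].
    generalize (C2_norm_ge (minus q p)). simpl. intros N.
    generalize (cond_pos eps); intros Pe.
    set (n := norm _) in *.
    unfold minus, plus, opp in N; simpl in N. unfold plus, opp in N; simpl in N.
    unfold Cminus. nra.
Qed.

Lemma cdiff2_comp G (f : C -> C) p a b m :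
  cdiff2 G p a b -> cdiff f (G p) m -> cdiff2 (fun q => f (G q)) p (m * a) (m * b).
Proof.
intros HG Hf eps He.
assert (A := Cmod_ge_0 a). assert (B := Cmod_ge_0 b). assert (Gm := Cmod_ge_0 m).
set (L := (Cmod a + Cmod b + 1)%R) in *.
assert (PL : (0 < L)%R) by (unfold L; lra).
set (M := (Cmod m + 1)%R).
assert (PM : (0 < M)%R) by (unfold M; lra).
destruct (HG 1%R Rlt_0_1) as [d1 [Hd1 Q1]].
destruct (HG (eps / 2 / M)%R) as [d2 [Hd2 Q2]]; [apply Rdiv_lt_0_compat; lra|].
destruct (Hf (eps / 2 / L)%R) as [d3 [Hd3 Q3]]; [apply Rdiv_lt_0_compat; lra|].
assert (PdL : (0 < d3 / (2 * L))%R) by (apply Rdiv_lt_0_compat; lra).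
exists (Rmin (d3 / (2 * L)) (Rmin d1 d2)); split.
{ repeat apply Rmin_pos; auto. }
intros q H1 H2.
apply Rmin_Rgt_l in H1. destruct H1 as [X1 X2]. apply Rmin_Rgt_l in X2. destruct X2 as [X2 X3].
apply Rmin_Rgt_l in H2. destruct H2 as [Y1 Y2]. apply Rmin_Rgt_l in Y2. destruct Y2 as [Y2 Y3].
specialize (Q1 q X2 Y2). specialize (Q2 q X3 Y3).
apply Rgt_lt in X1. apply Rlt_div_r in X1; [|lra].
apply Rgt_lt in Y1. apply Rlt_div_r in Y1; [|lra].
set (x := fst q - fst p) in *. set (y := snd q - snd p) in *.
assert (Hx := Cmod_ge_0 x). assert (Hy := Cmod_ge_0 y).
assert (E : (Cmod (G q - G p) <= L * (Cmod x + Cmod y))%R).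
{ replace (G q - G p) with ((G q - G p - (a * x + b * y)) + (a * x + b * y)) by ring.
  eapply Rle_trans; [apply Cmod_triangle|].
  generalize (Cmod_triangle (a * x) (b * y)). rewrite !Cmod_mult. unfold L. nra. }
assert (E3 : (Cmod (G q - G p) < d3)%R) by nra.
specialize (Q3 _ E3).
replace (f (G q) - f (G p) - (m * a * x + m * b * y)) with
  ((f (G q) - f (G p) - m * (G q - G p)) + m * (G q - G p - (a * x + b * y))) by ring.
eapply Rle_trans; [apply Cmod_triangle|]. rewrite Cmod_mult.
assert (T1 : (eps / 2 / L * Cmod (G q - G p) <= eps / 2 * (Cmod x + Cmod y))%R).
{ replace (eps / 2 * (Cmod x + Cmod y))%R with (eps / 2 / L * (L * (Cmod x + Cmod y)))%R
    by (field; lra).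
  apply Rmult_le_compat_l; auto. left; apply Rdiv_lt_0_compat; lra. }
assert (T2 : (Cmod m * Cmod (G q - G p - (a * x + b * y)) <= eps / 2 * (Cmod x + Cmod y))%R).
{ replace (eps / 2 * (Cmod x + Cmod y))%R with (M * (eps / 2 / M * (Cmod x + Cmod y)))%R
    by (field; lra).
  apply Rmult_le_compat; auto using Cmod_ge_0. unfold M; lra. }
lra.
Qed.

Lemma cdiff2_comp2 F G1 G2 p a b a1 b1 a2 b2 :
  cdiff2 F (G1 p, G2 p) a b -> cdiff2 G1 p a1 b1 -> cdiff2 G2 p a2 b2 ->
  cdiff2 (fun q => F (G1 q, G2 q)) p (a * a1 + b * a2) (a * b1 + b * b2).
Proof.
intros HF H1 H2 eps He.
set (N := (Cmod a1 + Cmod b1 + Cmod a2 + Cmod b2 + 2)%R).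
assert (A1 := Cmod_ge_0 a1). assert (B1 := Cmod_ge_0 b1).
assert (A2 := Cmod_ge_0 a2). assert (B2 := Cmod_ge_0 b2).
assert (A := Cmod_ge_0 a). assert (B := Cmod_ge_0 b).
assert (PN : (0 < N)%R) by (unfold N; lra).
set (M := (Cmod a + Cmod b + 1)%R). assert (PM : (0 < M)%R) by (unfold M; lra).
destruct (HF (eps / 2 / N)%R) as [d [Pd Q]]; [apply Rdiv_lt_0_compat; lra|].
destruct (H1 1%R Rlt_0_1) as [d1 [Pd1 Q1]]. destruct (H2 1%R Rlt_0_1) as [d2 [Pd2 Q2]].
destruct (H1 (eps / 2 / M)%R) as [d3 [Pd3 Q3]]; [apply Rdiv_lt_0_compat; lra|].
destruct (H2 (eps / 2 / M)%R) as [d4 [Pd4 Q4]]; [apply Rdiv_lt_0_compat; lra|].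
assert (PdN : (0 < d / (2 * N))%R) by (apply Rdiv_lt_0_compat; lra).
exists (Rmin (d / (2 * N)) (Rmin (Rmin d1 d2) (Rmin d3 d4))); split; [repeat apply Rmin_pos; auto|].
intros q X Y.
apply Rmin_Rgt_l in X. destruct X as [X0 X]. apply Rmin_Rgt_l in X. destruct X as [X X'].
apply Rmin_Rgt_l in X. destruct X as [X1 X2]. apply Rmin_Rgt_l in X'. destruct X' as [X3 X4].
apply Rmin_Rgt_l in Y. destruct Y as [Y0 Y]. apply Rmin_Rgt_l in Y. destruct Y as [Y Y'].
apply Rmin_Rgt_l in Y. destruct Y as [Y1 Y2]. apply Rmin_Rgt_l in Y'. destruct Y' as [Y3 Y4].
specialize (Q1 q X1 Y1). specialize (Q2 q X2 Y2). specialize (Q3 q X3 Y3). specialize (Q4 q X4 Y4).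
apply Rgt_lt in X0. apply (proj2 (Rlt_div_r _ _ _ (Rmult_lt_0_compat _ _ Rlt_0_2 PN))) in X0.
apply Rgt_lt in Y0. apply (proj2 (Rlt_div_r _ _ _ (Rmult_lt_0_compat _ _ Rlt_0_2 PN))) in Y0.
set (x := fst q - fst p) in *. set (y := snd q - snd p) in *.
assert (Gx := Cmod_ge_0 x). assert (Gy := Cmod_ge_0 y).
assert (E : forall G a' b', (Cmod (G q - G p - (a' * x + b' * y)) <= 1 * (Cmod x + Cmod y))%R ->
  (Cmod (G q - G p) <= (Cmod a' + Cmod b' + 1) * (Cmod x + Cmod y))%R).
{ intros G a' b' T.
  replace (G q - G p) with ((G q - G p - (a' * x + b' * y)) + (a' * x + b' * y)) by ring.
  eapply Rle_trans; [apply Cmod_triangle|].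
  generalize (Cmod_triangle (a' * x) (b' * y)) (Cmod_ge_0 a') (Cmod_ge_0 b'). rewrite !Cmod_mult. nra. }
assert (E1 := E _ _ _ Q1). assert (E2 := E _ _ _ Q2).
set (h := (Cmod x + Cmod y)%R) in *. assert (Ph : (0 <= h)%R) by (unfold h; lra).
assert (Hh : (h * N < d)%R) by (unfold h; nra).
assert (S1 : (Cmod (G1 q - G1 p) + Cmod (G2 q - G2 p) <= N * h)%R) by (unfold N; lra).
specialize (Q (G1 q, G2 q)). simpl fst in Q. simpl snd in Q.
generalize (Cmod_ge_0 (G1 q - G1 p)) (Cmod_ge_0 (G2 q - G2 p)). intros g1 g2.
specialize (Q ltac:(lra) ltac:(lra)).
replace (F (G1 q, G2 q) - F (G1 p, G2 p) - ((a * a1 + b * a2) * x + (a * b1 + b * b2) * y)) with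
  ((F (G1 q, G2 q) - F (G1 p, G2 p) - (a * (G1 q - G1 p) + b * (G2 q - G2 p))) +
   (a * (G1 q - G1 p - (a1 * x + b1 * y)) + b * (G2 q - G2 p - (a2 * x + b2 * y)))) by ring.
eapply Rle_trans; [apply Cmod_triangle|].
assert (T1 : (eps / 2 / N * (Cmod (G1 q - G1 p) + Cmod (G2 q - G2 p)) <= eps / 2 * h)%R).
{ replace (eps / 2 * h)%R with (eps / 2 / N * (N * h))%R by (field; lra).
  apply Rmult_le_compat_l; auto. left; apply Rdiv_lt_0_compat; lra. }
assert (T2 : (Cmod (a * (G1 q - G1 p - (a1 * x + b1 * y)) + b * (G2 q - G2 p - (a2 * x + b2 * y)))
   <= eps / 2 * h)%R).
{ eapply Rle_trans; [apply Cmod_triangle|]. rewrite !Cmod_mult.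
  replace (eps / 2 * h)%R with (M * (eps / 2 / M * h))%R by (field; lra).
  assert (0 <= eps / 2 / M * h)%R.
  { apply Rmult_le_pos; auto. left; apply Rdiv_lt_0_compat; lra. }
  unfold M at 1. set (k := (eps / 2 / M * h)%R) in *.
  apply Rle_trans with (Cmod a * k + Cmod b * k)%R; [|nra].
  apply Rplus_le_compat; apply Rmult_le_compat_l; auto. }
lra.
Qed.

Lemma cdiff2_fst p : cdiff2 fst p 1 0.
Proof.
intros eps He; exists 1%R; split; [lra|]. intros q _ _.
replace (fst q - fst p - (1 * (fst q - fst p) + 0 * (snd q - snd p))) with (RtoC 0) by ring.
rewrite Cmod_0. generalize (Cmod_ge_0 (fst q - fst p)) (Cmod_ge_0 (snd q - snd p)); nra.
Qed.

(** A curve is a pair of functions of two variables that ignore the second one, so [cdiff2_comp2]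
    applies at [(z, 0)]. The sum and product rules in one variable are read off from this. *)
Lemma cdiff2_comp_curve F (g1 g2 : C -> C) z a b l1 l2 :
  cdiff2 F (g1 z, g2 z) a b -> cdiff g1 z l1 -> cdiff g2 z l2 ->
  cdiff (fun w => F (g1 w, g2 w)) z (a * l1 + b * l2).
Proof.
intros HF H1 H2 eps He.
assert (L : forall g l, cdiff g z l -> cdiff2 (fun q => g (fst q)) (z, RtoC 0) (l * 1) (l * 0))
  by (intros g l Hg; exact (cdiff2_comp fst g (z, RtoC 0) 1 0 l (cdiff2_fst _) Hg)).
destruct (cdiff2_comp2 F (fun q => g1 (fst q)) (fun q => g2 (fst q)) (z, RtoC 0) a b _ _ _ _
  HF (L _ _ H1) (L _ _ H2) eps He) as [d [Pd Hd]].
exists d; split; auto. intros w Hw. specialize (Hd (w, RtoC 0)). simpl fst in Hd; simpl snd in Hd.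
replace (RtoC 0 - 0) with (RtoC 0) in Hd by ring. rewrite Cmod_0, Rplus_0_r in Hd.
replace ((a * l1 + b * l2) * (w - z)) with
  ((a * (l1 * 1) + b * (l2 * 1)) * (w - z) + (a * (l1 * 0) + b * (l2 * 0)) * 0) by ring.
auto.
Qed.

Lemma cdiff2_plus (p : C * C) : cdiff2 (fun q => fst q + snd q) p 1 1.
Proof.
intros eps He; exists 1%R; split; [lra|]. intros q _ _.
cbv beta.
replace (fst q + snd q - (fst p + snd p) - (1 * (fst q - fst p) + 1 * (snd q - snd p)))
  with (RtoC 0) by ring. rewrite Cmod_0.
generalize (Cmod_ge_0 (fst q - fst p)) (Cmod_ge_0 (snd q - snd p)); nra.
Qed.

Lemma cdiff2_mult (p : C * C) : cdiff2 (fun q => fst q * snd q) p (snd p) (fst p).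
Proof.
intros eps He; exists eps; split; [lra|]. intros q H _. cbv beta.
replace (fst q * snd q - fst p * snd p - (snd p * (fst q - fst p) + fst p * (snd q - snd p)))
  with ((fst q - fst p) * (snd q - snd p)) by ring.
rewrite Cmod_mult.
generalize (Cmod_ge_0 (fst q - fst p)) (Cmod_ge_0 (snd q - snd p)); nra.
Qed.

Lemma cdiff_plus f g z l m : cdiff f z l -> cdiff g z m ->
  cdiff (fun w => f w + g w) z (l + m).
Proof.
intros Hf Hg. eapply cdiff_eq; [apply (cdiff2_comp_curve _ f g z _ _ _ _ (cdiff2_plus _) Hf Hg)|].
ring.
Qed.

Lemma cdiff_mult f g z l m : cdiff f z l -> cdiff g z m ->
  cdiff (fun w => f w * g w) z (l * g z + f z * m).
Proof.
intros Hf Hg. eapply cdiff_eq; [apply (cdiff2_comp_curve _ f g z _ _ _ _ (cdiff2_mult _) Hf Hg)|].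
simpl; ring.
Qed.

Lemma cdiff_opp f z l : cdiff f z l -> cdiff (fun w => - f w) z (- l).
Proof.
intros H. apply (cdiff_ext_loc (fun w => (-(1)) * f w) _ _ _ 1); [lra | intros; ring |].
eapply cdiff_eq; [apply cdiff_mult; [apply cdiff_const | exact H]|]. cbv beta. ring.
Qed.

Lemma cdiff_minus f g z l m : cdiff f z l -> cdiff g z m ->
  cdiff (fun w => f w - g w) z (l - m).
Proof. intros Hf Hg. apply cdiff_plus; auto using cdiff_opp. Qed.

Lemma cdiff_Cinv (z : C) : z <> 0 -> cdiff Cinv z (- / (z * z)).
Proof.
intros Hz eps He.
assert (P : (0 < Cmod z)%R) by now apply Cmod_gt_0.
set (c := Cmod z) in *.
assert (Pc : (0 < c ^ 3)%R) by now apply pow_lt.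
exists (Rmin (c / 2) (eps * c ^ 3 / 2)); split.
{ apply Rmin_pos; [lra|]. nra. }
intros w Hw. apply Rmin_Rgt_l in Hw. destruct Hw as [Hw1 Hw2].
assert (W : (c / 2 <= Cmod w)%R).
{ generalize (Cmod_triangle_inv z w). rewrite Cmod_sub_comm. fold c. lra. }
assert (W0 : w <> 0) by (apply Cmod_gt_0; lra).
replace (/ w - / z - - / (z * z) * (w - z)) with
  ((w - z) * (w - z) / (w * (z * z))) by (field; auto).
rewrite Cmod_div by (repeat apply Cmult_neq_0; auto).
rewrite !Cmod_mult. fold c. set (h := Cmod (w - z)) in *.
assert (Hh : (0 <= h)%R) by apply Cmod_ge_0.
apply Rle_div_l; [nra|].
assert (X : (c ^ 3 / 2 <= Cmod w * (c * c))%R) by nra.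
assert (Y : (h * h <= eps * h * (c ^ 3 / 2))%R) by nra.
eapply Rle_trans; [exact Y|]. apply Rmult_le_compat_l; auto. nra.
Qed.

Lemma cdiff_inv (f : C -> C) (z l : C) : f z <> 0 -> cdiff f z l ->
  cdiff (fun w => / f w) z (- / (f z * f z) * l).
Proof. intros H0 H. apply (cdiff_comp f Cinv); [exact H | now apply cdiff_Cinv]. Qed.

Lemma cdiff_div (f g : C -> C) (z l m : C) : g z <> 0 -> cdiff f z l -> cdiff g z m ->
  cdiff (fun w => f w / g w) z (l / g z - f z * m / (g z * g z)).
Proof.
intros H0 Hf Hg. eapply cdiff_eq.
- apply cdiff_mult; [exact Hf | apply (cdiff_inv g z m H0 Hg)].
- cbv beta. field; auto.
Qed.

Lemma cdiff_pow f z l n : cdiff f z l -> exists m, cdiff (fun w => f w ^ n) z m.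
Proof.
intros H. induction n as [|n [m IH]].
- exists 0. exact (cdiff_const 1 z).
- eexists. exact (cdiff_mult f (fun w => f w ^ n) z l m H IH).
Qed.

(** * Integrals of complex-valued functions of a real variable *)

Definition ccont (g : R -> C) (t : R) : Prop :=
  forall eps : R, (0 < eps)%R -> exists del : R, (0 < del)%R /\
    forall s : R, (Rabs (s - t) < del)%R -> (Cmod (g s - g t) <= eps)%R.

Definition cder (g : R -> C) (t : R) (d : C) : Prop :=
  forall eps : R, (0 < eps)%R -> exists del : R, (0 < del)%R /\
    forall s : R, (Rabs (s - t) < del)%R ->
      (Cmod (g s - g t - RtoC (s - t) * d) <= eps * Rabs (s - t))%R.

Definition CI (g : R -> C) (a b : R) : C := RInt (V := C_R_CompleteNormedModule) g a b.

Lemma C_R_norm (z : C) : norm (z : C_R_NormedModule) = Cmod z.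
Proof.
unfold norm; simpl. unfold prod_norm, norm; simpl. unfold abs; simpl. unfold Cmod.
f_equal. rewrite !Rmult_1_r. rewrite <- !Rabs_mult. rewrite !Rabs_right; nra.
Qed.

Lemma ccont_continuous (g : R -> C) t :
  ccont g t -> continuous (U := C_R_CompleteNormedModule) g t.
Proof.
intros H. apply (proj2 (filterlim_locally (U := C_R_CompleteNormedModule) (F := locally t) g (g t))).
intros eps. destruct (H (eps / 2)%R) as [d [Hd Hd']]; [generalize (cond_pos eps); lra|].
exists (mkposreal d Hd). intros s Hs. apply C_NormedModule_mixin_compat1.
eapply Rle_lt_trans; [apply (Hd' s Hs)|]. generalize (cond_pos eps); lra.
Qed.

Lemma cder_is_derive (g : R -> C) t d :
  cder g t d -> is_derive (K := R_AbsRing) (V := C_R_CompleteNormedModule) g t d.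
Proof.
intros H. split.
- apply is_linear_scal_l.
- intros x Hx eps.
  assert (x = t) as -> by (symmetry; apply (is_filter_lim_locally_unique t x Hx)).
  destruct (H eps (cond_pos eps)) as [e [He He']].
  exists (mkposreal e He). intros s Hs. generalize (He' s Hs).
  intros E. eapply Rle_trans; [|exact E]. right.
  etransitivity; [apply C_R_norm|]. f_equal. rewrite scal_R_Cmult. reflexivity.
Qed.

Lemma CI_correct g a b : (a <= b)%R -> (forall t, (a <= t <= b)%R -> ccont g t) ->
  is_RInt (V := C_R_CompleteNormedModule) g a b (CI g a b).
Proof.
intros Hab H. apply RInt_correct. apply (ex_RInt_continuous (V := C_R_CompleteNormedModule)).
intros t Ht. rewrite Rmin_left, Rmax_right in Ht by auto. apply ccont_continuous. auto.
Qed.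

Lemma CI_Chasles g a b c : (a <= b)%R -> (b <= c)%R ->
  (forall t, (a <= t <= c)%R -> ccont g t) -> CI g a c = CI g a b + CI g b c.
Proof.
intros Hab Hbc H. symmetry. apply (RInt_Chasles (V := C_R_CompleteNormedModule)).
- eexists; apply CI_correct; auto. intros; apply H; lra.
- eexists; apply CI_correct; auto. intros; apply H; lra.
Qed.

Lemma CI_FTC (P p : R -> C) a b : (a <= b)%R ->
  (forall t, (a <= t <= b)%R -> cder P t (p t)) ->
  (forall t, (a <= t <= b)%R -> ccont p t) -> CI p a b = P b - P a.
Proof.
intros Hab H1 H2. apply (is_RInt_unique (V := C_R_CompleteNormedModule)).
apply (is_RInt_derive (V := C_R_CompleteNormedModule) P p); rewrite Rmin_left, Rmax_right by auto.
- intros; now apply cder_is_derive, H1.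
- intros; now apply ccont_continuous, H2.
Qed.

Lemma CI_bound g a b M : (a <= b)%R ->
  (forall t, (a <= t <= b)%R -> ccont g t) ->
  (forall t, (a <= t <= b)%R -> (Cmod (g t) <= M)%R) ->
  (Cmod (CI g a b) <= (b - a) * M)%R.
Proof.
intros Hab H1 H2. rewrite <- C_R_norm.
apply (norm_RInt_le_const (V := C_R_NormedModule) g a b); auto.
- intros; rewrite C_R_norm; auto.
- now apply CI_correct.
Qed.

Lemma CI_plus f g a b : (a <= b)%R ->
  (forall t, (a <= t <= b)%R -> ccont f t) -> (forall t, (a <= t <= b)%R -> ccont g t) ->
  CI (fun t => f t + g t) a b = CI f a b + CI g a b.
Proof.
intros Hab H1 H2. apply (is_RInt_unique (V := C_R_CompleteNormedModule)).
apply (is_RInt_plus (V := C_R_NormedModule)); now apply CI_correct.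
Qed.

Lemma CI_minus f g a b : (a <= b)%R ->
  (forall t, (a <= t <= b)%R -> ccont f t) -> (forall t, (a <= t <= b)%R -> ccont g t) ->
  CI (fun t => f t - g t) a b = CI f a b - CI g a b.
Proof.
intros Hab H1 H2. apply (is_RInt_unique (V := C_R_CompleteNormedModule)).
apply (is_RInt_minus (V := C_R_NormedModule)); now apply CI_correct.
Qed.

Lemma CI_ext f g a b : (a <= b)%R ->
  (forall t, (a <= t <= b)%R -> f t = g t) -> CI f a b = CI g a b.
Proof.
intros Hab H. apply (RInt_ext (V := C_R_CompleteNormedModule)).
intros t Ht. rewrite Rmin_left, Rmax_right in Ht by auto. apply H; lra.
Qed.

Lemma ccont_const c t : ccont (fun _ => c) t.
Proof.
intros eps He; exists 1%R; split; [lra|]. intros s _.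
replace (c - c) with (RtoC 0) by ring. rewrite Cmod_0; lra.
Qed.

Lemma ccont_cdiff (P : C -> C) g t l : ccont g t -> cdiff P (g t) l -> ccont (fun s => P (g s)) t.
Proof.
intros Hg HP eps He. destruct (cdiff_cont _ _ _ HP eps He) as [d [Hd H]].
destruct (Hg (d / 2)%R) as [d' [Hd' H']]; [lra|].
exists d'; split; auto. intros s Hs. apply H. specialize (H' s Hs). lra.
Qed.

Lemma ccont_plus f g t : ccont f t -> ccont g t -> ccont (fun s => f s + g s) t.
Proof.
intros Hf Hg eps He.
destruct (Hf (eps / 2)%R) as [d [Hd H]]; [lra|].
destruct (Hg (eps / 2)%R) as [d' [Hd' H']]; [lra|].
exists (Rmin d d'); split; [now apply Rmin_pos|]. intros s Hs.
apply Rmin_Rgt_l in Hs. destruct Hs as [Hs1 Hs2]. specialize (H s Hs1). specialize (H' s Hs2).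
replace (f s + g s - (f t + g t)) with ((f s - f t) + (g s - g t)) by ring.
eapply Rle_trans; [apply Cmod_triangle|]. lra.
Qed.

Lemma ccont_mult f g t : ccont f t -> ccont g t -> ccont (fun s => f s * g s) t.
Proof.
intros Hf Hg eps He.
assert (A := Cmod_ge_0 (f t)). assert (B := Cmod_ge_0 (g t)).
set (M := (Cmod (f t) + Cmod (g t) + 1)%R).
assert (PM : (0 < M)%R) by (unfold M; lra).
assert (Pe : (0 < eps / (2 * M))%R) by (apply Rdiv_lt_0_compat; lra).
destruct (Hf (Rmin 1 (eps / (2 * M)))%R) as [d [Hd H]]; [apply Rmin_pos; lra|].
destruct (Hg (eps / (2 * M))%R) as [d' [Hd' H']]; [lra|].
exists (Rmin d d'); split; [now apply Rmin_pos|]. intros s Hs.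
apply Rmin_Rgt_l in Hs. destruct Hs as [Hs1 Hs2]. specialize (H s Hs1). specialize (H' s Hs2).
assert (H1 := Rle_trans _ _ _ H (Rmin_l _ _)). assert (H2 := Rle_trans _ _ _ H (Rmin_r _ _)).
replace (f s * g s - (f t * g t)) with
  ((f s - f t) * g t + ((f s - f t) + f t) * (g s - g t)) by ring.
eapply Rle_trans; [apply Cmod_triangle|]. rewrite !Cmod_mult.
assert (T := Cmod_triangle (f s - f t) (f t)).
assert (E : (eps / (2 * M) * M = eps / 2)%R) by (field; lra).
set (k := (eps / (2 * M))%R) in *.
assert (X := Cmod_ge_0 (f s - f t)). assert (Y := Cmod_ge_0 (g s - g t)).
assert (Z := Cmod_ge_0 (f s - f t + f t)).
assert (T1 : (Cmod (f s - f t) * Cmod (g t) <= k * Cmod (g t))%R) by (apply Rmult_le_compat_r; lra).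
assert (T2 : (Cmod (f s - f t + f t) * Cmod (g s - g t) <= (Cmod (f t) + 1) * k)%R)
  by (apply Rmult_le_compat; lra).
replace eps with (k * M + k * M)%R by lra. unfold M. nra.
Qed.

Lemma ccont_scal c f t : ccont f t -> ccont (fun s => c * f s) t.
Proof. intros H. apply ccont_mult; auto using ccont_const. Qed.

Lemma ccont_minus f g t : ccont f t -> ccont g t -> ccont (fun s => f s - g s) t.
Proof.
intros Hf Hg. apply ccont_plus; auto.
intros eps He. destruct (Hg eps He) as [d [Hd H]]. exists d; split; auto. intros s Hs.
replace (- g s - - g t) with (- (g s - g t)) by ring. rewrite Cmod_opp. auto.
Qed.

(** The integral is one of a real normed module, hence linear over the reals; a complex factor is
    handled through real and imaginary parts. *)
Lemma CI_scal c f a b : (a <= b)%R ->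
  (forall t, (a <= t <= b)%R -> ccont f t) -> CI (fun t => c * f t) a b = c * CI f a b.
Proof.
intros Hab H.
assert (I := CI_correct _ _ _ Hab H).
apply (is_RInt_unique (V := C_R_CompleteNormedModule)).
assert (I1 := is_RInt_fct_extend_fst (U := R_NormedModule) (V := R_NormedModule) _ _ _ _ I).
assert (I2 := is_RInt_fct_extend_snd (U := R_NormedModule) (V := R_NormedModule) _ _ _ _ I).
destruct c as [c1 c2]. set (J := CI f a b) in *.
apply (is_RInt_fct_extend_pair (U := R_NormedModule) (V := R_NormedModule)
  (fun t => (c1, c2) * f t) a b (c1 * fst J - c2 * snd J)%R (c1 * snd J + c2 * fst J)%R).
- apply (is_RInt_minus (V := R_NormedModule)); now apply (is_RInt_scal (V := R_NormedModule)).
- apply (is_RInt_plus (V := R_NormedModule)); now apply (is_RInt_scal (V := R_NormedModule)).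
Qed.

Lemma cder_ccont g t d : cder g t d -> ccont g t.
Proof.
intros H eps He. destruct (H 1%R Rlt_0_1) as [e [Pe E]].
assert (A := Cmod_ge_0 d).
assert (P : (0 < Cmod d + 1)%R) by lra.
exists (Rmin e (eps / (Cmod d + 1))); split.
{ apply Rmin_pos; auto. now apply Rdiv_lt_0_compat. }
intros s Hs. apply Rmin_Rgt_l in Hs. destruct Hs as [Hs1 Hs2]. specialize (E s Hs1).
apply Rgt_lt in Hs2. apply Rlt_div_r in Hs2; [|exact P].
replace (g s - g t) with ((g s - g t - RtoC (s - t) * d) + RtoC (s - t) * d) by ring.
eapply Rle_trans; [apply Cmod_triangle|]. rewrite Cmod_mult, Cmod_R.
generalize (Rabs_pos (s - t)). nra.
Qed.

Lemma cder_comp (P : C -> C) g t l d : cder g t d -> cdiff P (g t) l ->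
  cder (fun s => P (g s)) t (d * l).
Proof.
intros Hg HP eps He.
assert (A := Cmod_ge_0 d). assert (B := Cmod_ge_0 l).
set (L := (Cmod d + 1)%R). assert (PL : (0 < L)%R) by (unfold L; lra).
set (M := (Cmod l + 1)%R). assert (PM : (0 < M)%R) by (unfold M; lra).
destruct (HP (eps / 2 / L)%R) as [d1 [Pd1 H1]]; [apply Rdiv_lt_0_compat; lra|].
destruct (Hg (eps / 2 / M)%R) as [d2 [Pd2 H2]]; [apply Rdiv_lt_0_compat; lra|].
destruct (Hg 1%R Rlt_0_1) as [d3 [Pd3 H3]].
assert (PdL : (0 < d1 / L)%R) by now apply Rdiv_lt_0_compat.
exists (Rmin (d1 / L) (Rmin d2 d3)); split; [repeat apply Rmin_pos; auto|].
intros s Hs. apply Rmin_Rgt_l in Hs. destruct Hs as [S1 S2].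
apply Rmin_Rgt_l in S2. destruct S2 as [S2 S3].
apply Rgt_lt in S1. apply Rlt_div_r in S1; [|exact PL].
specialize (H2 s S2). specialize (H3 s S3).
set (h := Rabs (s - t)) in *. assert (Ph : (0 <= h)%R) by apply Rabs_pos.
assert (G : (Cmod (g s - g t) <= L * h)%R).
{ replace (g s - g t) with ((g s - g t - RtoC (s - t) * d) + RtoC (s - t) * d) by ring.
  eapply Rle_trans; [apply Cmod_triangle|]. rewrite Cmod_mult, Cmod_R. fold h. unfold L. lra. }
assert (G1 : (Cmod (g s - g t) < d1)%R) by lra.
specialize (H1 _ G1).
replace (P (g s) - P (g t) - RtoC (s - t) * (d * l)) with
  ((P (g s) - P (g t) - l * (g s - g t)) + l * (g s - g t - RtoC (s - t) * d)) by ring.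
eapply Rle_trans; [apply Cmod_triangle|]. rewrite Cmod_mult.
assert (T1 : (eps / 2 / L * Cmod (g s - g t) <= eps / 2 * h)%R).
{ replace (eps / 2 * h)%R with (eps / 2 / L * (L * h))%R by (field; lra).
  apply Rmult_le_compat_l; auto. left; apply Rdiv_lt_0_compat; lra. }
assert (T2 : (Cmod l * Cmod (g s - g t - RtoC (s - t) * d) <= eps / 2 * h)%R).
{ replace (eps / 2 * h)%R with (M * (eps / 2 / M * h))%R by (field; lra).
  apply Rmult_le_compat; auto using Cmod_ge_0. unfold M; lra. }
lra.
Qed.

(** [p] is an approximation of [g] that has a primitive [P]. The edge integral of [g] is the
    increment of [P] up to [kap] times the length, and around a closed path the increments
    cancel. *)
Lemma edge_estimate (g P p : C -> C) (gam dgam : R -> C) a b L kap : (a <= b)%R ->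
  (forall t, (a <= t <= b)%R -> cder gam t (dgam t)) ->
  (forall t, (a <= t <= b)%R -> ccont dgam t) ->
  (forall t, (a <= t <= b)%R -> (Cmod (dgam t) <= L)%R) ->
  (forall t, (a <= t <= b)%R -> exists l, cdiff g (gam t) l) ->
  (forall w, cdiff P w (p w)) -> (forall w, exists l, cdiff p w l) ->
  (forall t, (a <= t <= b)%R -> (Cmod (g (gam t) - p (gam t)) <= kap)%R) ->
  (Cmod (CI (fun t => (g (gam t) * dgam t)%C) a b - (P (gam b) - P (gam a)))
    <= kap * L * (b - a))%R.
Proof.
intros Hab H1 H2 H3 H4 H5 H6 H7.
assert (Cg : forall t, (a <= t <= b)%R -> ccont (fun t => g (gam t)) t).
{ intros t Ht. destruct (H4 t Ht) as [l Hl]. eapply ccont_cdiff; eauto.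
  eapply cder_ccont; eauto. }
assert (Cp : forall t, (a <= t <= b)%R -> ccont (fun t => p (gam t)) t).
{ intros t Ht. destruct (H6 (gam t)) as [l Hl]. eapply ccont_cdiff; eauto.
  eapply cder_ccont; eauto. }
assert (E : CI (fun t => dgam t * p (gam t)) a b = P (gam b) - P (gam a)).
{ apply (CI_FTC (fun t => P (gam t))); auto.
  - intros t Ht. apply (cder_comp P gam t); auto.
  - intros t Ht. apply ccont_mult; auto. }
rewrite <- E. rewrite <- CI_minus; auto.
2,3: intros; apply ccont_mult; auto.
replace (kap * L * (b - a))%R with ((b - a) * (kap * L))%R by ring.
apply CI_bound; auto.
- intros; apply ccont_minus; apply ccont_mult; auto.
- intros t Ht. replace (g (gam t) * dgam t - dgam t * p (gam t)) with
    ((g (gam t) - p (gam t)) * dgam t) by ring.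
  rewrite Cmod_mult. apply Rmult_le_compat; auto using Cmod_ge_0.
Qed.

(** * Goursat's theorem for a homotopy, and Cauchy's formula *)

Section Quartering.

Local Open Scope R_scope.

(** [J x y h] stands for the modulus of the boundary integral over the square with lower left corner
    [(x, y)] and side [h]. *)
Variable J : R -> R -> R -> R.

Hypothesis J_sub : forall x y h, 0 < h -> 0 <= x -> x + 2 * h <= 1 -> 0 <= y -> y + 2 * h <= 1 ->
  J x y (2 * h) <= J x y h + J (x + h) y h + J x (y + h) h + J (x + h) (y + h) h.

Hypothesis J_loc : forall x0 y0 eps, 0 <= x0 <= 1 -> 0 <= y0 <= 1 -> 0 < eps ->
  exists del, 0 < del /\ forall x y h, 0 < h -> h < del ->
    0 <= x -> x + h <= 1 -> 0 <= y -> y + h <= 1 ->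
    x <= x0 <= x + h -> y <= y0 <= y + h -> J x y h <= eps * h ^ 2.

Variable c : R.

(** The last quarter needs no test: if the other three fall short of [c * h ^ 2], [J_sub] leaves at
    least that much for it. *)
Let quarter (q : R * R) (h : R) : R * R :=
  let (x, y) := q in
  if Rle_dec (c * h ^ 2) (J x y h) then (x, y) else
  if Rle_dec (c * h ^ 2) (J (x + h) y h) then (x + h, y) else
  if Rle_dec (c * h ^ 2) (J x (y + h) h) then (x, y + h) else (x + h, y + h).

Let sq (n : nat) : R * R :=
  nat_rect (fun _ => (R * R)%type) (0, 0) (fun n q => quarter q (/ 2 ^ S n)) n.

Lemma quarter_spec q h : 0 < h ->
  0 <= fst q -> fst q + 2 * h <= 1 -> 0 <= snd q -> snd q + 2 * h <= 1 ->
  c * (2 * h) ^ 2 <= J (fst q) (snd q) (2 * h) ->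
  c * h ^ 2 <= J (fst (quarter q h)) (snd (quarter q h)) h /\
  fst q <= fst (quarter q h) <= fst q + h /\ snd q <= snd (quarter q h) <= snd q + h.
Proof.
destruct q as [x y]; simpl fst; simpl snd. intros Hh H1 H2 H3 H4 H5.
generalize (J_sub x y h Hh H1 H2 H3 H4). intros S.
unfold quarter.
destruct Rle_dec as [K1|K1]; simpl; [repeat split; lra|].
destruct Rle_dec as [K2|K2]; simpl; [repeat split; lra|].
destruct Rle_dec as [K3|K3]; simpl; [repeat split; lra|].
simpl in *. repeat split; lra.
Qed.

Lemma sq_spec : c <= J 0 0 1 -> forall n,
  0 <= fst (sq n) /\ fst (sq n) + / 2 ^ n <= 1 /\ 0 <= snd (sq n) /\ snd (sq n) + / 2 ^ n <= 1 /\
  c * (/ 2 ^ n) ^ 2 <= J (fst (sq n)) (snd (sq n)) (/ 2 ^ n) /\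
  fst (sq n) <= fst (sq (S n)) <= fst (sq n) + / 2 ^ S n /\
  snd (sq n) <= snd (sq (S n)) <= snd (sq n) + / 2 ^ S n.
Proof.
intros Hc.
assert (P : forall n, 0 < / 2 ^ n) by (intros; apply Rinv_0_lt_compat, pow_lt; lra).
assert (D : forall n, / 2 ^ n = 2 * / 2 ^ S n) by (intros; simpl; field; apply pow_nonzero; lra).
assert (Q : forall n, 0 <= fst (sq n) /\ fst (sq n) + / 2 ^ n <= 1 /\
  0 <= snd (sq n) /\ snd (sq n) + / 2 ^ n <= 1 /\
  c * (/ 2 ^ n) ^ 2 <= J (fst (sq n)) (snd (sq n)) (/ 2 ^ n)).
{ induction n as [|n (I1 & I2 & I3 & I4 & I5)].
  - simpl. rewrite Rinv_1. repeat split; lra.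
  - rewrite D in I2, I4, I5.
    destruct (quarter_spec (sq n) (/ 2 ^ S n) (P _)) as (K1 & K2 & K3); auto.
    change (sq (S n)) with (quarter (sq n) (/ 2 ^ S n)).
    repeat split; auto; lra. }
intros n. destruct (Q n) as (I1 & I2 & I3 & I4 & I5). repeat (split; [assumption|]).
rewrite D in I2, I4, I5.
destruct (quarter_spec (sq n) (/ 2 ^ S n) (P _)) as (K1 & K2 & K3); auto.
Qed.

Lemma nested_intervals (x : nat -> R) :
  (forall n, 0 <= x n /\ x n + / 2 ^ n <= 1) ->
  (forall n, x n <= x (S n) <= x n + / 2 ^ S n) ->
  exists x0, 0 <= x0 <= 1 /\ forall n, x n <= x0 <= x n + / 2 ^ n.
Proof.
intros H1 H2.
assert (D : forall n, / 2 ^ n = 2 * / 2 ^ S n) by (intros; simpl; field; apply pow_nonzero; lra).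
assert (Inc : forall n m, x n <= x (n + m)%nat /\ x (n + m)%nat + / 2 ^ (n + m) <= x n + / 2 ^ n).
{ intros n m; induction m as [|m [IH1 IH2]].
  - rewrite Nat.add_0_r; lra.
  - rewrite Nat.add_succ_r. generalize (H2 (n + m)%nat). intros K.
    rewrite (D (n + m)%nat) in IH2. lra. }
assert (P : forall n, 0 < / 2 ^ n) by (intros; apply Rinv_0_lt_compat, pow_lt; lra).
assert (Up : forall n m, x m <= x n + / 2 ^ n).
{ intros n m. destruct (Nat.le_ge_cases n m) as [L|L].
  - destruct (Inc n (m - n)%nat) as [_ K]. replace (n + (m - n))%nat with m in K by lia.
    generalize (P m). lra.
  - destruct (Inc m (n - m)%nat) as [K _]. replace (m + (n - m))%nat with n in K by lia.
    generalize (P n). lra. }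
destruct (completeness (fun r => exists n, r = x n)) as [x0 [U1 U2]].
- exists 1. intros r [n ->]. generalize (H1 n) (P n). lra.
- exists (x O), O; reflexivity.
- exists x0.
  assert (K : forall n, x n <= x0 <= x n + / 2 ^ n).
  { intros n; split; [apply U1; now exists n|]. apply U2. intros r [m ->]. apply Up. }
  split; auto. generalize (K O) (H1 O). lra.
Qed.

(** If [c > 0], every square of the nested sequence carries at least [c * h ^ 2], while [J_loc] with
    [eps = c / 2] at the common point allows only half of that for small [h]. *)
Lemma quartering : c <= J 0 0 1 -> c <= 0.
Proof.
intros Hc. destruct (Rle_lt_dec c 0) as [|Pc]; auto. exfalso.
assert (S := sq_spec Hc).
destruct (nested_intervals (fun n => fst (sq n))) as [x0 [X1 X2]].
{ intros n; destruct (S n) as (? & ? & _); auto. }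
{ intros n; apply (S n). }
destruct (nested_intervals (fun n => snd (sq n))) as [y0 [Y1 Y2]].
{ intros n; destruct (S n) as (_ & _ & ? & ? & _); auto. }
{ intros n; apply (S n). }
destruct (J_loc x0 y0 (c / 2) X1 Y1) as [d [Pd Hd]]; [lra|].
destruct (pow_lt_1_zero (/ 2) (ltac:(rewrite Rabs_pos_eq; lra)) d Pd) as [n Hn].
specialize (Hn n (le_n n)). rewrite pow_inv in Hn.
assert (P : 0 < / 2 ^ n) by (apply Rinv_0_lt_compat, pow_lt; lra).
rewrite Rabs_pos_eq in Hn by lra.
destruct (S n) as (I1 & I2 & I3 & I4 & I5 & _ & _).
generalize (Hd (fst (sq n)) (snd (sq n)) (/ 2 ^ n) P Hn I1 I2 I3 I4 (X2 n) (Y2 n)).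
assert (0 < (/ 2 ^ n) ^ 2) by now apply pow_lt. nra.
Qed.

End Quartering.

(** * Cauchy's theorem on the image of a parameter square *)

Section Goursat.

(** The form [g(w) dw] is pulled back along [H] and integrated over edges of the parameter square,
    so the region swept out in the plane never has to be described. *)
Variables (g : C -> C) (H Hx Hy : R -> R -> C) (L : R).

Definition unit_square (x y : R) : Prop := (0 <= x <= 1 /\ 0 <= y <= 1)%R.

Hypothesis L_ge_1 : (1 <= L)%R.
Hypothesis H_derx : forall x y, unit_square x y -> cder (fun t => H t y) x (Hx x y).
Hypothesis H_dery : forall x y, unit_square x y -> cder (fun t => H x t) y (Hy x y).
Hypothesis Hx_cont : forall x y, unit_square x y -> ccont (fun t => Hx t y) x.
Hypothesis Hy_cont : forall x y, unit_square x y -> ccont (fun t => Hy x t) y.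
Hypothesis Hx_bound : forall x y, unit_square x y -> (Cmod (Hx x y) <= L)%R.
Hypothesis Hy_bound : forall x y, unit_square x y -> (Cmod (Hy x y) <= L)%R.
Hypothesis H_lip : forall x y x' y', unit_square x y -> unit_square x' y' ->
  (Cmod (H x y - H x' y') <= L * (Rabs (x - x') + Rabs (y - y')))%R.
Hypothesis g_diff : forall x y, unit_square x y -> exists l, cdiff g (H x y) l.

Let EX (y a b : R) : C := CI (fun t => g (H t y) * Hx t y) a b.
Let EY (x a b : R) : C := CI (fun t => g (H x t) * Hy x t) a b.
(** Counterclockwise boundary integral of [g(w) dw] over the image of the square with lower left
    corner [(x, y)] and side [h]. *)
Let E (x y h : R) : C :=
  EX y x (x + h) + EY (x + h) y (y + h) - EX (y + h) x (x + h) - EY x y (y + h).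

Lemma x_edge_cont x y : unit_square x y -> ccont (fun t => g (H t y) * Hx t y) x.
Proof.
intros Q. destruct (g_diff x y Q) as [l Hl].
apply ccont_mult; auto. apply (ccont_cdiff g (fun t => H t y) x l); auto.
eapply cder_ccont; eauto.
Qed.

Lemma y_edge_cont x y : unit_square x y -> ccont (fun t => g (H x t) * Hy x t) y.
Proof.
intros Q. destruct (g_diff x y Q) as [l Hl].
apply ccont_mult; auto. apply (ccont_cdiff g (fun t => H x t) y l); auto.
eapply cder_ccont; eauto.
Qed.

Lemma boundary_quarter x y h : (0 < h)%R -> (0 <= x)%R -> (x + 2 * h <= 1)%R -> (0 <= y)%R ->
  (y + 2 * h <= 1)%R ->
  E x y (2 * h) = E x y h + E (x + h) y h + E x (y + h) h + E (x + h) (y + h) h.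
Proof.
intros P X0 X1 Y0 Y1. unfold E.
replace (x + 2 * h)%R with (x + h + h)%R by ring.
replace (y + 2 * h)%R with (y + h + h)%R by ring.
assert (KX : forall t, (0 <= t <= 1)%R -> EX t x (x + h + h) = EX t x (x + h) + EX t (x + h) (x + h + h)).
{ intros t Ht. apply CI_Chasles; try lra. intros; apply x_edge_cont; unfold unit_square; lra. }
assert (KY : forall t, (0 <= t <= 1)%R -> EY t y (y + h + h) = EY t y (y + h) + EY t (y + h) (y + h + h)).
{ intros t Ht. apply CI_Chasles; try lra. intros; apply y_edge_cont; unfold unit_square; lra. }
rewrite !KX, !KY by lra. ring.
Qed.

Lemma boundary_local x0 y0 eps : (0 <= x0 <= 1 -> 0 <= y0 <= 1 -> 0 < eps ->
  exists del, 0 < del /\ forall x y h, 0 < h -> h < del ->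
    0 <= x -> x + h <= 1 -> 0 <= y -> y + h <= 1 ->
    x <= x0 <= x + h -> y <= y0 <= y + h -> Cmod (E x y h) <= eps * h ^ 2)%R.
Proof.
intros X0 Y0 Pe. destruct (g_diff x0 y0 (conj X0 Y0)) as [l Hl].
assert (PL : (0 < 8 * L ^ 2)%R) by nra.
(* Each of the four edges will cost [kap * L * h] with [kap = e * (2 * L * h)], in total
   [8 * L ^ 2 * e * h ^ 2]. *)
set (e := (eps / (8 * L ^ 2))%R). assert (Pe' : (0 < e)%R) by now apply Rdiv_lt_0_compat.
destruct (Hl e Pe') as [d [Pd Hd]].
exists (d / (2 * L))%R; split; [apply Rdiv_lt_0_compat; lra|].
intros x y h Ph Hh x1 x2 y1 y2 I1 I2. apply Rlt_div_r in Hh; [|lra].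
set (w := H x0 y0) in *.
(* The first-order Taylor polynomial of [g] at [w], followed by a primitive of it. *)
set (p := fun v => g w + l * (v - w)).
set (P := fun v => g w * v + l * ((v - w) * (v - w)) * / 2).
assert (two : RtoC 2 <> 0) by (intros K; apply RtoC_inj in K; lra).
assert (HP : forall v, cdiff P v (p v)).
{ intros v. unfold P, p. eapply cdiff_eq.
  - apply cdiff_plus; apply cdiff_mult; [apply cdiff_const|apply cdiff_id| |apply cdiff_const].
    apply cdiff_mult; [apply cdiff_const|].
    apply cdiff_mult; apply cdiff_minus; (apply cdiff_id || apply cdiff_const).
  - cbv beta. field; auto. }
assert (Hp : forall v, exists l, cdiff p v l).
{ intros v; eexists. apply cdiff_plus; [apply cdiff_const|]. apply cdiff_mult; [apply cdiff_const|].
  apply cdiff_minus; [apply cdiff_id | apply cdiff_const]. }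
assert (Near : forall s t, (x <= s <= x + h)%R -> (y <= t <= y + h)%R ->
  (Cmod (g (H s t) - p (H s t)) <= e * (2 * L * h))%R).
{ intros s t Hs Ht.
  assert (K : (Cmod (H s t - w) <= 2 * L * h)%R).
  { eapply Rle_trans; [apply H_lip; unfold unit_square; lra|].
    assert (Rabs (s - x0) <= h)%R by (apply Rabs_le; lra).
    assert (Rabs (t - y0) <= h)%R by (apply Rabs_le; lra). nra. }
  unfold p. replace (g (H s t) - (g w + l * (H s t - w))) with
    (g (H s t) - g w - l * (H s t - w)) by ring.
  eapply Rle_trans; [apply Hd; lra|]. apply Rmult_le_compat_l; lra. }
set (kap := (e * (2 * L * h))%R) in *.
assert (KX : forall t, (y <= t <= y + h)%R ->
  (Cmod (EX t x (x + h) - (P (H (x + h) t) - P (H x t))) <= kap * L * h)%R).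
{ intros t Ht. replace (kap * L * h)%R with (kap * L * (x + h - x))%R by ring.
  apply (edge_estimate g P p (fun s => H s t) (fun s => Hx s t)); auto; try lra;
    intros s Hs; try (apply Near; lra);
    (apply H_derx || apply Hx_cont || apply Hx_bound || apply g_diff); unfold unit_square; lra. }
assert (KY : forall s, (x <= s <= x + h)%R ->
  (Cmod (EY s y (y + h) - (P (H s (y + h)) - P (H s y))) <= kap * L * h)%R).
{ intros s Hs. replace (kap * L * h)%R with (kap * L * (y + h - y))%R by ring.
  apply (edge_estimate g P p (fun t => H s t) (fun t => Hy s t)); auto; try lra;
    intros t Ht; try (apply Near; lra);
    (apply H_dery || apply Hy_cont || apply Hy_bound || apply g_diff); unfold unit_square; lra. }
assert (T1 := KX y ltac:(lra)). assert (T2 := KX (y + h)%R ltac:(lra)).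
assert (T3 := KY x ltac:(lra)). assert (T4 := KY (x + h)%R ltac:(lra)).
replace (eps * h ^ 2)%R with (4 * (kap * L * h))%R by (unfold kap, e; field; lra).
unfold E.
set (a := EX y x (x + h) - _) in T1. set (b := EX (y + h) x (x + h) - _) in T2.
set (c := EY x y (y + h) - _) in T3. set (k := EY (x + h) y (y + h) - _) in T4.
(* Around the square the increments of [P] cancel, leaving the four edge errors. *)
replace (EX y x (x + h) + EY (x + h) y (y + h) - EX (y + h) x (x + h) - EY x y (y + h))
  with ((a + k) - (b + c)) by (unfold a, b, c, k; ring).
eapply Rle_trans; [apply Cmod_sub_triangle|].
generalize (Cmod_triangle a k) (Cmod_triangle b c). lra.
Qed.

Theorem goursat_square :
  CI (fun t => g (H t 0) * Hx t 0) 0 1 + CI (fun t => g (H 1 t) * Hy 1 t) 0 1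
  = CI (fun t => g (H t 1) * Hx t 1) 0 1 + CI (fun t => g (H 0 t) * Hy 0 t) 0 1.
Proof.
assert (Z : E 0 0 1 = 0).
{ apply Cmod_eq_0. apply Rle_antisym; [|apply Cmod_ge_0].
  apply (quartering (fun x y h => Cmod (E x y h))); [| |apply Rle_refl].
  - intros x y h P1 P2 P3 P4 P5. rewrite boundary_quarter; auto.
    eapply Rle_trans; [apply Cmod_triangle|]. apply Rplus_le_compat_r.
    eapply Rle_trans; [apply Cmod_triangle|]. apply Rplus_le_compat_r.
    apply Cmod_triangle.
  - apply boundary_local. }
unfold E in Z. rewrite Rplus_0_l in Z. unfold EX, EY in Z.
apply Ceq_minus. rewrite <- Z. ring.
Qed.

End Goursat.

Lemma is_derive_estimate (f : R -> R) (t l : R) : is_derive f t l ->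
  forall eps : R, (0 < eps)%R -> exists del : R, (0 < del)%R /\
    forall s : R, (Rabs (s - t) < del)%R ->
      (Rabs (f s - f t - (s - t) * l) <= eps * Rabs (s - t))%R.
Proof.
intros [_ H] eps He. destruct (H t (fun P HP => HP) (mkposreal eps He)) as [d Hd].
exists d; split; [apply cond_pos|]. intros s Hs. exact (Hd s Hs).
Qed.

Lemma cder_pair (a b : R -> R) t a' b' :
  is_derive a t a' -> is_derive b t b' -> cder (fun s => (a s, b s)) t (a', b').
Proof.
intros Ha Hb eps He.
destruct (is_derive_estimate _ _ _ Ha (eps / 2)%R) as [d [Pd Hd]]; [lra|].
destruct (is_derive_estimate _ _ _ Hb (eps / 2)%R) as [d' [Pd' Hd']]; [lra|].
exists (Rmin d d'); split; [now apply Rmin_pos|]. intros s Hs.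
apply Rmin_Rgt_l in Hs. destruct Hs as [H1 H2]. specialize (Hd s H1). specialize (Hd' s H2).
replace ((a s, b s) - (a t, b t) - RtoC (s - t) * (a', b')) with
  ((a s - a t - (s - t) * a')%R, (b s - b t - (s - t) * b')%R).
2:{ unfold Cminus, Cplus, Copp, Cmult, RtoC; simpl. f_equal; ring. }
eapply Rle_trans; [apply Cmod_2Rmax|]. simpl.
assert (S2 := sqrt_2_lt_2).
assert (S0 := sqrt_pos 2).
assert (M : (Rmax (Rabs (a s - a t - (s - t) * a')) (Rabs (b s - b t - (s - t) * b'))
   <= eps / 2 * Rabs (s - t))%R) by (apply Rmax_lub; auto).
assert (M0 : (0 <= Rmax (Rabs (a s - a t - (s - t) * a')) (Rabs (b s - b t - (s - t) * b')))%R)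
  by (eapply Rle_trans; [|apply Rmax_l]; apply Rabs_pos).
nra.
Qed.

(** One turn over [[0, 1]], so that a mean over the circle is an integral [CI _ 0 1]. *)
Definition circ (r t : R) : C := (r * cos (2 * PI * t), r * sin (2 * PI * t))%R.

Lemma circ_mod r t : (0 <= r)%R -> Cmod (circ r t) = r.
Proof.
intros Hr. unfold Cmod, circ; simpl.
replace (_ + _)%R with (r ^ 2)%R.
- apply sqrt_pow2; auto.
- generalize (sin2_cos2 (2 * PI * t)). unfold Rsqr. intros E.
  transitivity (r ^ 2 * 1)%R; [ring|]. rewrite <- E at 1. ring.
Qed.

Lemma circ_0_1 r : circ r 0 = circ r 1.
Proof.
unfold circ. rewrite Rmult_0_r, Rmult_1_r, cos_0, sin_0, cos_2PI, sin_2PI. reflexivity.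
Qed.

Lemma circ_der r t : cder (circ r) t (RtoC (2 * PI) * Ci * circ r t).
Proof.
replace (RtoC (2 * PI) * Ci * circ r t) with
  ((r * (- (2 * PI) * sin (2 * PI * t)))%R, (r * (2 * PI * cos (2 * PI * t)))%R).
- apply cder_pair; auto_derive; auto; ring.
- unfold circ, Cmult, Ci, RtoC; simpl. f_equal; ring.
Qed.

Lemma circ_cont r t : ccont (circ r) t.
Proof. eapply cder_ccont, circ_der. Qed.

Lemma two_PI_bounds : (0 < 2 * PI <= 8)%R.
Proof. generalize PI_RGT_0 PI_4. lra. Qed.

Lemma circ_der_bound r t : (0 <= r)%R -> (Cmod (RtoC (2 * PI) * Ci * circ r t) <= 8 * r)%R.
Proof.
intros Hr. rewrite !Cmod_mult, Cmod_Ci, circ_mod, Cmod_R by auto.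
generalize two_PI_bounds; intros B. rewrite Rabs_pos_eq by lra. nra.
Qed.

Lemma circ_lip r s t : (0 <= r)%R -> (Cmod (circ r s - circ r t) <= 8 * r * Rabs (s - t))%R.
Proof.
intros Hr.
assert (K : forall a b, (a <= b)%R -> (Cmod (circ r b - circ r a) <= 8 * r * (b - a))%R).
{ intros a b Hab. rewrite <- (CI_FTC (circ r) (fun t => RtoC (2 * PI) * Ci * circ r t)); auto.
  - replace (8 * r * (b - a))%R with ((b - a) * (8 * r))%R by ring. apply CI_bound; auto.
    + intros; apply ccont_scal, circ_cont.
    + intros; now apply circ_der_bound.
  - intros; apply circ_der.
  - intros; apply ccont_scal, circ_cont. }
destruct (Rle_lt_dec t s) as [L|L].
- rewrite Rabs_pos_eq by lra. auto.
- rewrite Rabs_left by lra. rewrite Cmod_sub_comm.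
  replace (- (s - t))%R with (t - s)%R by ring. apply K; lra.
Qed.

Lemma cder_eq g t d d' : cder g t d -> d = d' -> cder g t d'.
Proof. now intros H <-. Qed.

Lemma cder_real_affine a b t : cder (fun s => RtoC (a + b * s)) t (RtoC b).
Proof.
intros eps He; exists 1%R; split; [lra|]. intros s _.
replace (RtoC (a + b * s) - RtoC (a + b * t) - RtoC (s - t) * RtoC b) with (RtoC 0).
- rewrite Cmod_0. generalize (Rabs_pos (s - t)); nra.
- rewrite <- RtoC_mult, <- !RtoC_minus. f_equal; ring.
Qed.

(** * Cauchy's theorem for a difference quotient, by shrinking the circle *)

Section Cauchy.

Variables (f : C -> C) (z : C) (r : R).
Hypothesis z_in : (Cmod z < r)%R.
Hypothesis f_diff : forall w, (Cmod w <= r)%R -> exists l, cdiff f w l.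

Let g (w : C) : C := (f w - f z) / (w - z).
(** Runs from the circle at [s = 1] towards the point [z] at [s = 0]. Only [s > 0] is used, where
    the denominator of [g] does not vanish. *)
Let hom (s t : R) : C := z + RtoC s * (circ r t - z).

Lemma r_pos : (0 < r)%R.
Proof. generalize (Cmod_ge_0 z); lra. Qed.

Lemma circ_neq t : circ r t - z <> 0.
Proof.
apply Cmod_gt_0. generalize (Cmod_triangle_inv (circ r t) z).
rewrite circ_mod by (generalize r_pos; lra). lra.
Qed.

Lemma hom_g_diff s t : (0 < s <= 1)%R -> exists l, cdiff g (hom s t) l.
Proof.
intros Hs.
assert (B : (Cmod (hom s t) <= r)%R).
{ unfold hom. replace (z + RtoC s * (circ r t - z)) with
    (RtoC (1 - s) * z + RtoC s * circ r t) by (rewrite RtoC_minus; ring).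
  eapply Rle_trans; [apply Cmod_triangle|].
  rewrite !Cmod_mult, !Cmod_R, circ_mod, !Rabs_pos_eq by (generalize r_pos; lra). nra. }
destruct (f_diff _ B) as [l Hl].
eexists. apply cdiff_div.
- unfold hom. replace (z + RtoC s * (circ r t - z) - z) with (RtoC s * (circ r t - z)) by ring.
  apply Cmult_neq_0; [|apply circ_neq]. intros K; apply RtoC_inj in K; lra.
- apply cdiff_minus; [exact Hl | apply cdiff_const].
- apply cdiff_minus; [apply cdiff_id | apply cdiff_const].
Qed.

(** In [goursat_square] for [hom (sig x) y], the edges [y = 0] and [y = 1] have the same image
    because the circle closes up, so they cancel. The other two are the circle and its
    contraction. *)
Lemma homotopy_invariance s0 : (0 < s0 < 1)%R ->
  CI (fun t => g (hom 1 t) * (RtoC 1 * (RtoC (2 * PI) * Ci * circ r t))) 0 1 =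
  CI (fun t => g (hom s0 t) * (RtoC s0 * (RtoC (2 * PI) * Ci * circ r t))) 0 1.
Proof.
intros Hs. assert (Pr := r_pos).
set (sig := fun x : R => (s0 + (1 - s0) * x)%R).
assert (Hsig : forall x, (0 <= x <= 1)%R -> (0 < sig x <= 1)%R).
{ intros x Hx; unfold sig; nra. }
assert (cz : forall t, (Cmod (circ r t - z) <= 2 * r)%R).
{ intros t. eapply Rle_trans; [apply Cmod_sub_triangle|]. rewrite circ_mod by lra. lra. }
(* The constant [16 * r + 1] dominates the radial speed [2 * r] and the angular speed [8 * r], and
   is at least 1. *)
assert (Q := goursat_square g (fun x y => hom (sig x) y)
  (fun x y => RtoC (1 - s0) * (circ r y - z))
  (fun x y => RtoC (sig x) * (RtoC (2 * PI) * Ci * circ r y)) (16 * r + 1)).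
assert (Lip : forall x y x' y', unit_square x y -> unit_square x' y' ->
  (Cmod (hom (sig x) y - hom (sig x') y') <= (16 * r + 1) * (Rabs (x - x') + Rabs (y - y')))%R).
{ intros x y x' y' [X Y] [X' Y'].
  replace (hom (sig x) y - hom (sig x') y') with
   (RtoC ((1 - s0) * (x - x')) * (circ r y - z) + RtoC (sig x') * (circ r y - circ r y')).
  2:{ replace ((1 - s0) * (x - x'))%R with (sig x - sig x')%R by (unfold sig; ring).
      unfold hom. rewrite RtoC_minus. ring. }
  eapply Rle_trans; [apply Cmod_triangle|]. rewrite !Cmod_mult, !Cmod_R.
  assert (K := circ_lip r y y' ltac:(lra)). specialize (cz y).
  assert (S' := Hsig x' X').
  rewrite Rabs_mult, (Rabs_pos_eq (1 - s0)), (Rabs_pos_eq (sig x')) by lra.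
  assert (A := Rabs_pos (x - x')). assert (B := Rabs_pos (y - y')).
  assert (T1 : ((1 - s0) * Rabs (x - x') * Cmod (circ r y - z) <= Rabs (x - x') * (2 * r))%R).
  { apply Rmult_le_compat; auto using Cmod_ge_0; nra. }
  assert (T2 : (sig x' * Cmod (circ r y - circ r y') <= 1 * (8 * r * Rabs (y - y')))%R).
  { apply Rmult_le_compat; auto using Cmod_ge_0; lra. }
  nra. }
assert (sig1 : sig 1%R = 1%R) by (unfold sig; ring).
assert (sig0 : sig 0%R = s0) by (unfold sig; ring).
cbv beta in Q. rewrite sig1, sig0 in Q.
replace (fun t => g (hom (sig t) 1) * (RtoC (1 - s0) * (circ r 1 - z)))
  with (fun t => g (hom (sig t) 0) * (RtoC (1 - s0) * (circ r 0 - z))) in Q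
  by (unfold hom; rewrite (circ_0_1 r); reflexivity).
assert (Cancel : forall a b c : C, a + b = a + c -> b = c).
{ intros a b c E. replace b with (a + b - a) by ring. rewrite E. ring. }
eapply Cancel. apply Q; clear Q; auto.
- lra.
- intros x y _. eapply cder_eq.
  + apply (cder_comp (fun w => z + w * (circ r y - z)) (fun s => RtoC (sig s)) x).
    * apply cder_real_affine.
    * apply cdiff_plus; [apply cdiff_const|].
      apply cdiff_mult; [apply cdiff_id|apply cdiff_const].
  + cbv beta. ring.
- intros x y _. eapply cder_eq.
  + apply (cder_comp (fun w => z + RtoC (sig x) * (w - z)) (circ r) y).
    * apply circ_der.
    * apply cdiff_plus; [apply cdiff_const|]. apply cdiff_mult; [apply cdiff_const|].
      apply cdiff_minus; [apply cdiff_id|apply cdiff_const].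
  + cbv beta. ring.
- intros; apply ccont_const.
- intros; apply ccont_scal, ccont_scal, circ_cont.
- intros x y _. rewrite Cmod_mult, Cmod_R, Rabs_pos_eq by lra. specialize (cz y).
  generalize (Cmod_ge_0 (circ r y - z)). nra.
- intros x y [X Y]. rewrite Cmod_mult, Cmod_R. assert (S' := Hsig x X).
  rewrite Rabs_pos_eq by lra.
  generalize (circ_der_bound r y ltac:(lra)) (Cmod_ge_0 (RtoC (2 * PI) * Ci * circ r y)). nra.
- intros x y [X Y]. apply hom_g_diff. now apply Hsig.
Qed.

Lemma circ_g_cont t : ccont (fun t => g (circ r t)) t.
Proof.
destruct (hom_g_diff 1 t) as [l Hl]; [lra|].
unfold hom in Hl. replace (z + 1 * (circ r t - z)) with (circ r t) in Hl by ring.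
eapply ccont_cdiff; [apply circ_cont | exact Hl].
Qed.

(** The integral does not depend on the contraction factor [s0], [g] stays below [|l| + 1] near [z],
    and the length of the contracted circle tends to 0. The final factor [circ r t] comes from
    [dw = 2 pi i w dt]. *)
Lemma cauchy_difference_quotient :
  CI (fun t => (f (circ r t) - f z) / (circ r t - z) * circ r t) 0 1 = 0.
Proof.
assert (Pr := r_pos).
destruct (f_diff z) as [l Hl]; [lra|].
destruct (cdiff_lipschitz _ _ _ Hl) as [d [Pd Hd]].
assert (I1 : CI (fun t => g (hom 1 t) * (RtoC 1 * (RtoC (2 * PI) * Ci * circ r t))) 0 1 = 0).
{ apply Cmod_le_eps_eq_0. intros eps Pe.
  assert (Al := Cmod_ge_0 l).
  set (K := (8 * r * (Cmod l + 1))%R). assert (PK : (0 < K)%R) by (unfold K; nra).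
  (* The second bound keeps the contracted circle within distance [d] of [z], the third makes the
     integrand at most [eps]. *)
  set (s0 := Rmin (1 / 2) (Rmin (d / (3 * r)) (eps / K))).
  assert (S0 : (0 < s0)%R).
  { unfold s0; repeat apply Rmin_pos; try lra; apply Rdiv_lt_0_compat; lra. }
  assert (S1 : (s0 <= 1 / 2)%R) by apply Rmin_l.
  assert (S2 : (s0 <= d / (3 * r))%R) by (eapply Rle_trans; [apply Rmin_r|apply Rmin_l]).
  assert (S3 : (s0 <= eps / K)%R) by (eapply Rle_trans; [apply Rmin_r|apply Rmin_r]).
  apply Rle_div_r in S2; [|lra]. apply Rle_div_r in S3; [|lra].
  rewrite (homotopy_invariance s0) by lra.
  replace eps with ((1 - 0) * eps)%R by ring.
  apply CI_bound; [lra| |].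
  - intros t Ht. apply ccont_mult; [|apply ccont_scal, ccont_scal, circ_cont].
    destruct (hom_g_diff s0 t) as [m Hm]; [lra|].
    apply (ccont_cdiff g (fun t => hom s0 t) t m); auto.
    unfold hom. apply ccont_plus; [apply ccont_const|]. apply ccont_scal.
    apply ccont_minus; [apply circ_cont|apply ccont_const].
  - intros t Ht.
    assert (N0 : hom s0 t - z <> 0).
    { unfold hom. replace (z + RtoC s0 * (circ r t - z) - z) with (RtoC s0 * (circ r t - z)) by ring.
      apply Cmult_neq_0; [|apply circ_neq]. intros E; apply RtoC_inj in E; lra. }
    assert (N1 : (Cmod (hom s0 t - z) < d)%R).
    { unfold hom. replace (z + RtoC s0 * (circ r t - z) - z) with (RtoC s0 * (circ r t - z)) by ring.
      rewrite Cmod_mult, Cmod_R, Rabs_pos_eq by lra.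
      assert (Cmod (circ r t - z) <= 2 * r)%R.
      { eapply Rle_trans; [apply Cmod_sub_triangle|]. rewrite circ_mod by lra. lra. }
      generalize (Cmod_ge_0 (circ r t - z)). nra. }
    assert (G : (Cmod (g (hom s0 t)) <= Cmod l + 1)%R).
    { unfold g. rewrite Cmod_div by auto. apply Rle_div_l; [|apply Hd; auto].
      now apply Cmod_gt_0. }
    rewrite Cmod_mult, (Cmod_mult (RtoC s0)), Cmod_R, Rabs_pos_eq by lra.
    generalize (circ_der_bound r t ltac:(lra)) (Cmod_ge_0 (RtoC (2 * PI) * Ci * circ r t)).
    set (q := Cmod (RtoC (2 * PI) * Ci * circ r t)). intros Q1 Q2.
    eapply Rle_trans; [|exact S3].
    replace (s0 * K)%R with ((Cmod l + 1) * (s0 * (8 * r)))%R by (unfold K; ring).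
    apply Rmult_le_compat; auto using Cmod_ge_0; nra. }
rewrite (CI_ext _ (fun t => (RtoC (2 * PI) * Ci) * (g (circ r t) * circ r t))) in I1; [|lra|].
2:{ intros t _. unfold hom. replace (z + 1 * (circ r t - z)) with (circ r t) by ring. ring. }
rewrite CI_scal in I1; [|lra|].
2:{ intros t _. apply ccont_mult; [apply circ_g_cont | apply circ_cont]. }
assert (N : RtoC (2 * PI) * Ci <> 0).
{ apply Cmult_neq_0; [|apply Ci_nz]. intros E; apply RtoC_inj in E. generalize PI_RGT_0; lra. }
change (CI (fun t => g (circ r t) * circ r t) 0 1 = 0).
replace (CI (fun t => g (circ r t) * circ r t) 0 1) with
  ((RtoC (2 * PI) * Ci * CI (fun t => g (circ r t) * circ r t) 0 1) / (RtoC (2 * PI) * Ci))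
  by (field; split; [apply Ci_nz | intros E; apply N; rewrite E; ring]).
rewrite I1. unfold Cdiv. ring.
Qed.

End Cauchy.

(** * Taylor remainders *)

(** Taylor coefficient at 0 as a Cauchy integral: for [w = circ r t], [dw / (2 pi i w) = dt]. *)
Definition coef (f : C -> C) (r : R) (n : nat) : C :=
  CI (fun t => f (circ r t) * (/ circ r t) ^ n) 0 1.

(** The Taylor remainder of order [n] divided by [z ^ n]; for [n = 0] it is Cauchy's integral. *)
Definition tail (f : C -> C) (r : R) (n : nat) (z : C) : C :=
  CI (fun t => f (circ r t) * (/ circ r t) ^ n * (circ r t / (circ r t - z))) 0 1.

Definition diff_on_disc (f : C -> C) (r : R) : Prop :=
  forall w, (Cmod w <= r)%R -> exists l, cdiff f w l.

Lemma ccont_bounded (g : R -> C) : (forall t, (0 <= t <= 1)%R -> ccont g t) ->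
  exists B : R, (0 < B)%R /\ forall t, (0 <= t <= 1)%R -> (Cmod (g t) <= B)%R.
Proof.
intros H.
destruct (continuity_ab_maj (fun t => Cmod (g t)) 0 1) as [m [Hm _]]; [lra| |].
- intros t Ht eps Pe. destruct (H t Ht (eps / 2)%R) as [d [Pd Hd]]; [lra|].
  exists d; split; auto. intros s [_ Hs]. simpl in *. unfold Rdist in *.
  specialize (Hd s Hs). apply Rle_lt_trans with (Cmod (g s - g t)); [|lra].
  apply Rabs_le. generalize (Cmod_triangle_inv (g s) (g t)) (Cmod_triangle_inv (g t) (g s)).
  rewrite (Cmod_sub_comm (g t)). lra.
- exists (Cmod (g m) + 1)%R. split; [generalize (Cmod_ge_0 (g m)); lra|].
  intros t Ht. specialize (Hm t Ht). lra.
Qed.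

Lemma circ_nz r t : (0 < r)%R -> circ r t <> 0.
Proof. intros Hr. apply Cmod_gt_0. rewrite circ_mod; lra. Qed.

Lemma circ_inv_cont r t : (0 < r)%R -> ccont (fun s => / circ r s) t.
Proof.
intros Hr. eapply (ccont_cdiff Cinv); [apply circ_cont|]. now apply cdiff_Cinv, circ_nz.
Qed.

Lemma ccont_pow f n t : ccont f t -> ccont (fun s => f s ^ n) t.
Proof.
intros H; induction n as [|n IH].
- apply (ccont_const 1).
- exact (ccont_mult f (fun s => f s ^ n) t H IH).
Qed.

Lemma kernel_cont r z t : (Cmod z < r)%R -> ccont (fun s => circ r s / (circ r s - z)) t.
Proof.
intros Hz. assert (N := circ_neq z r Hz t).
eapply (ccont_cdiff (fun w => w / (w - z))); [apply circ_cont|].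
apply cdiff_div; auto; [apply cdiff_id|].
apply cdiff_minus; [apply cdiff_id|apply cdiff_const].
Qed.

Lemma kernel_bound r z t : (Cmod z < r)%R ->
  (Cmod (circ r t / (circ r t - z)) <= r / (r - Cmod z))%R.
Proof.
intros Hz. assert (N := circ_neq z r Hz t). assert (P := r_pos z r Hz).
rewrite Cmod_div, circ_mod by (auto; lra).
apply Rmult_le_compat_l; [lra|]. apply Rinv_le_contravar; [lra|].
generalize (Cmod_triangle_inv (circ r t) z). rewrite circ_mod; lra.
Qed.

Section Taylor.

Variables (f : C -> C) (r : R).
Hypothesis r_gt_0 : (0 < r)%R.
Hypothesis f_diff : diff_on_disc f r.

Lemma f_circ_cont t : ccont (fun s => f (circ r s)) t.
Proof.
destruct (f_diff (circ r t)) as [l Hl]; [rewrite circ_mod; lra|].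
eapply ccont_cdiff; [apply circ_cont | exact Hl].
Qed.

Lemma coef_cont n t : ccont (fun s => f (circ r s) * (/ circ r s) ^ n) t.
Proof. apply ccont_mult; [apply f_circ_cont|]. now apply ccont_pow, circ_inv_cont. Qed.

Lemma tail_cont n z t : (Cmod z < r)%R ->
  ccont (fun s => f (circ r s) * (/ circ r s) ^ n * (circ r s / (circ r s - z))) t.
Proof. intros Hz. apply ccont_mult; [apply coef_cont | now apply kernel_cont]. Qed.

(** Integrated form of [w / (w - z) = 1 + (z / w) * (w / (w - z))]. *)
Lemma tail_step n z : (Cmod z < r)%R -> tail f r n z = coef f r n + z * tail f r (S n) z.
Proof.
intros Hz. unfold tail, coef.
rewrite <- CI_scal; [|lra|intros; now apply tail_cont].
rewrite <- CI_plus; [|lra|intros; apply coef_cont|intros; apply ccont_scal; now apply tail_cont].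
apply CI_ext; [lra|]. intros t _. cbv beta. rewrite Cpow_S.
assert (N1 := circ_nz r t r_gt_0). assert (N2 := circ_neq z r Hz t).
field. auto.
Qed.

Lemma tail_bound n z B : (Cmod z < r)%R ->
  (forall t, (0 <= t <= 1)%R -> (Cmod (f (circ r t)) <= B)%R) ->
  (Cmod (tail f r n z) <= B * (/ r) ^ n * (r / (r - Cmod z)))%R.
Proof.
intros Hz HB. unfold tail. rewrite <- (Rmult_1_l (B * _ * _)).
replace 1%R with (1 - 0)%R at 2 by ring.
apply CI_bound; [lra|intros; now apply tail_cont|].
intros t Ht. rewrite !Cmod_mult, Cmod_pow, Cmod_inv, circ_mod by (apply circ_nz || idtac; lra).
apply Rmult_le_compat; auto using Cmod_ge_0.
- apply Rmult_le_pos; [apply Cmod_ge_0|]. apply pow_le. left; now apply Rinv_0_lt_compat.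
- apply Rmult_le_compat_r; auto. apply pow_le. left; now apply Rinv_0_lt_compat.
- now apply kernel_bound.
Qed.

End Taylor.

Lemma cdiff_Cpow n z : cdiff (fun w => w ^ S n) z (RtoC (INR (S n)) * z ^ n).
Proof.
induction n as [|n IH].
- apply (cdiff_ext_loc (fun w => w) _ _ _ 1); [lra|intros; simpl; ring|].
  eapply cdiff_eq; [apply cdiff_id|]. simpl; ring.
- eapply cdiff_eq; [apply (cdiff_mult (fun w => w) (fun w => w ^ S n)); [apply cdiff_id|apply IH]|].
  rewrite (S_INR (S n)), RtoC_plus. cbn [Cpow]. ring.
Qed.

Lemma circ_inv_der r t : (0 < r)%R ->
  cder (fun s => / circ r s) t (- (RtoC (2 * PI) * Ci) * / circ r t).
Proof.
intros Hr. eapply cder_eq.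
- apply (cder_comp Cinv (circ r) t); [apply circ_der|]. now apply cdiff_Cinv, circ_nz.
- field. now apply circ_nz.
Qed.

(** Up to the nonzero factor [k] the integrand is its own derivative in [t], and it takes the same
    value at 0 and 1. *)
Lemma mean_inv_pow r n : (0 < r)%R -> CI (fun t => (/ circ r t) ^ S n) 0 1 = 0.
Proof.
intros Hr.
assert (N : - (RtoC (2 * PI) * Ci) * RtoC (INR (S n)) <> 0).
{ apply Cmult_neq_0.
  - intros E. apply (Cmult_neq_0 (RtoC (2 * PI)) Ci).
    + intros K; apply RtoC_inj in K. generalize PI_RGT_0; lra.
    + apply Ci_nz.
    + replace (RtoC (2 * PI) * Ci) with (- - (RtoC (2 * PI) * Ci)) by ring. rewrite E; ring.
  - intros K; apply RtoC_inj in K. generalize (lt_0_INR (S n) ltac:(lia)); lra. }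
set (k := - (RtoC (2 * PI) * Ci) * RtoC (INR (S n))) in *.
assert (Cn : forall t, ccont (fun t => (/ circ r t) ^ S n) t)
  by (intros; now apply ccont_pow, circ_inv_cont).
assert (E : CI (fun t => k * (/ circ r t) ^ S n) 0 1 = 0).
{ rewrite (CI_FTC (fun t => (/ circ r t) ^ S n)); [| lra | |].
  - rewrite circ_0_1. ring.
  - intros t _. eapply cder_eq.
    + apply (cder_comp (fun w => w ^ S n) (fun s => / circ r s)); [now apply circ_inv_der|].
      apply cdiff_Cpow.
    + unfold k. cbn [Cpow]. ring.
  - intros t _. apply ccont_scal, Cn. }
rewrite CI_scal in E; [|lra|intros; apply Cn].
set (x := CI _ 0 1) in *. replace x with (k * x / k) by (field; auto). rewrite E. unfold Cdiv; ring.
Qed.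

Lemma pow_small_le (x K eps : R) : (0 <= x < 1)%R -> (0 <= K)%R -> (0 < eps)%R ->
  exists N, (K * x ^ N <= eps)%R.
Proof.
intros Hx HK He.
destruct (pow_lt_1_zero x (ltac:(rewrite Rabs_pos_eq; lra)) (eps / (K + 1))%R) as [N HN].
{ apply Rdiv_lt_0_compat; lra. }
exists N. specialize (HN N (le_n N)). rewrite Rabs_pos_eq in HN by (apply pow_le; lra).
apply Rlt_div_r in HN; [|lra]. assert (0 <= x ^ N)%R by (apply pow_le; lra). nra.
Qed.

Lemma diff_const_on_disc c r : diff_on_disc (fun _ => c) r.
Proof. intros w _; eexists; apply cdiff_const. Qed.

(** Cauchy's formula for the constant 1, by a geometric series: all higher coefficients vanish, so
    the remainder is [z ^ n * tail] for every [n], which tends to 0. *)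
Lemma kernel_mean r z : (Cmod z < r)%R -> tail (fun _ => 1) r 0 z = 1.
Proof.
intros Hz. assert (P := r_pos z r Hz).
assert (D := diff_const_on_disc 1 r).
assert (C0 : coef (fun _ => 1) r 0 = 1).
{ unfold coef. rewrite (CI_ext _ (fun _ => RtoC 1)); [|lra|intros; simpl; ring].
  unfold CI. etransitivity; [apply (RInt_const (V := C_R_CompleteNormedModule))|].
  etransitivity; [apply scal_R_Cmult|]. rewrite RtoC_minus. ring. }
assert (CS : forall n, coef (fun _ => 1) r (S n) = 0).
{ intros n. unfold coef. rewrite <- (mean_inv_pow r n P). apply CI_ext; [lra|]. intros; ring. }
rewrite tail_step, C0; auto.
assert (Z : tail (fun _ => 1) r 1 z = 0).
{ assert (I : forall n, tail (fun _ => 1) r 1 z = z ^ n * tail (fun _ => 1) r (S n) z).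
  { induction n as [|n IH]; [simpl; ring|].
    rewrite IH, (tail_step _ r P D (S n)), CS by auto. simpl. ring. }
  apply Cmod_le_eps_eq_0. intros eps Pe.
  assert (Q : (0 <= Cmod z / r < 1)%R).
  { split; [apply Rdiv_le_0_compat; auto; apply Cmod_ge_0|]. apply Rlt_div_l; lra. }
  destruct (pow_small_le (Cmod z / r) (/ (r - Cmod z)) eps Q) as [N HN]; auto.
  { left; apply Rinv_0_lt_compat; lra. }
  rewrite (I N), Cmod_mult, Cmod_pow.
  eapply Rle_trans; [apply Rmult_le_compat_l; [apply pow_le, Cmod_ge_0|]|].
  - apply (tail_bound _ r P D (S N) z 1); auto. intros; rewrite Cmod_1; lra.
  - eapply Rle_trans; [|exact HN]. right. unfold Rdiv. rewrite Rpow_mult_distr. simpl. field. lra. }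
rewrite Z. ring.
Qed.

Lemma cauchy_formula f r z : (Cmod z < r)%R -> diff_on_disc f r -> f z = tail f r 0 z.
Proof.
intros Hz D. assert (P := r_pos z r Hz).
assert (Q := cauchy_difference_quotient f z r Hz D).
assert (Dc := diff_const_on_disc 1 r).
rewrite (CI_ext _ (fun t => f (circ r t) * (/ circ r t) ^ 0 * (circ r t / (circ r t - z)) -
  f z * (1 * (/ circ r t) ^ 0 * (circ r t / (circ r t - z))))) in Q; [|lra|].
2:{ intros t _. simpl. field. now apply circ_neq. }
rewrite CI_minus in Q; [|lra|intros; now apply tail_cont|].
2:{ intros. apply ccont_scal. now apply (tail_cont (fun _ => 1)). }
rewrite CI_scal in Q; [|lra|intros; now apply (tail_cont (fun _ => 1))].
change (tail f r 0 z - f z * tail (fun _ => 1) r 0 z = 0) in Q.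
rewrite kernel_mean in Q by auto. symmetry; apply Ceq_minus. rewrite <- Q. ring.
Qed.

Lemma taylor_vanishing f r z n : (Cmod z < r)%R -> diff_on_disc f r ->
  (forall k, (k < n)%nat -> coef f r k = 0) -> f z = z ^ n * tail f r n z.
Proof.
intros Hz D. assert (P := r_pos z r Hz). induction n as [|n IH]; intros H.
- rewrite (cauchy_formula f r z) by auto. simpl; ring.
- rewrite IH by (intros; apply H; lia).
  rewrite (tail_step f r P D n z), H by (auto; lia). simpl. ring.
Qed.

(** Weaker than [f w = o(w ^ n)], since it is asked only at some points tending to 0. For a function
    differentiable on a disc this already kills the coefficients up to [n] ([coef_vanish]). *)
Definition small_order (f : C -> C) (n : nat) : Prop :=
  forall eps del : R, (0 < eps)%R -> (0 < del)%R ->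
    exists w : C, (0 < Cmod w)%R /\ (Cmod w < del)%R /\ (Cmod (f w) <= eps * Cmod w ^ n)%R.

Lemma small_order_le f n m : (n <= m)%nat -> small_order f m -> small_order f n.
Proof.
intros L H eps del Pe Pd. destruct (H eps (Rmin 1 del) Pe) as [w (W1 & W2 & W3)].
{ apply Rmin_pos; lra. }
apply Rmin_Rgt_l in W2. exists w; repeat split; try lra.
eapply Rle_trans; [exact W3|]. apply Rmult_le_compat_l; [lra|].
replace m with (n + (m - n))%nat by lia. rewrite pow_add.
rewrite <- (Rmult_1_r (Cmod w ^ n)) at 2. apply Rmult_le_compat_l; [apply pow_le; lra|].
rewrite <- (pow1 (m - n)). apply pow_incr; lra.
Qed.

(** Once the lower coefficients vanish, [f w / w ^ k] is [coef f r k + w * tail f r (S k) w], whose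
    second term is at most [K * |w|]. *)
Lemma coef_vanish f r n : (0 < r)%R -> diff_on_disc f r -> small_order f n ->
  forall k, (k <= n)%nat -> coef f r k = 0.
Proof.
intros P D Sm k. induction k as [k IH] using (well_founded_induction Wf_nat.lt_wf). intros Hk.
destruct (ccont_bounded (fun t => f (circ r t))) as [B [PB HB]].
{ intros; now apply f_circ_cont. }
set (K := (B * (/ r) ^ (S k) * 2)%R).
assert (PK : (0 < K)%R).
{ unfold K. apply Rmult_lt_0_compat; [|lra]. apply Rmult_lt_0_compat; auto.
  now apply pow_lt, Rinv_0_lt_compat. }
apply Cmod_le_eps_eq_0. intros eps Pe.
destruct (small_order_le f k n Hk Sm (eps / 2)%R (Rmin (r / 2) (eps / (2 * K)))) as [w (W1 & W2 & W3)].
{ lra. }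
{ apply Rmin_pos; [lra|]. apply Rdiv_lt_0_compat; lra. }
apply Rmin_Rgt_l in W2. destruct W2 as [W2 W2'].
assert (Wr : (Cmod w < r)%R) by lra.
rewrite (taylor_vanishing f r w k) in W3; auto.
2:{ intros j Hj; apply IH; lia. }
rewrite Cmod_mult, Cmod_pow, Rmult_comm in W3.
apply Rmult_le_reg_r in W3; [|now apply pow_lt].
rewrite (tail_step f r P D k w Wr) in W3.
assert (T := tail_bound f r P D (S k) w B Wr HB).
assert (Q : (r / (r - Cmod w) <= 2)%R) by (apply Rle_div_l; lra).
assert (T' : (Cmod (tail f r (S k) w) <= K)%R).
{ eapply Rle_trans; [exact T|]. unfold K. apply Rmult_le_compat_l; auto.
  apply Rmult_le_pos; [lra|]. apply pow_le. left; now apply Rinv_0_lt_compat. }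
apply Rgt_lt in W2'. apply Rlt_div_r in W2'; [|lra].
replace (coef f r k) with ((coef f r k + w * tail f r (S k) w) - w * tail f r (S k) w) by ring.
eapply Rle_trans; [apply Cmod_sub_triangle|]. rewrite (Cmod_mult w).
generalize (Cmod_ge_0 (tail f r (S k) w)). nra.
Qed.

(** * Schwarz lemmas and the identity theorem *)

Definition hol_disc (f : C -> C) (R0 : R) : Prop :=
  forall w, (Cmod w < R0)%R -> exists l, cdiff f w l.

Lemma hol_disc_closed f R0 r : (r < R0)%R -> hol_disc f R0 -> diff_on_disc f r.
Proof. intros L H w Hw. apply H. lra. Qed.

(** If [b < a], then [c * (b / a) ^ k] tends to 0; so large powers make the constant [c]
    disappear. *)
Lemma pow_root_le (a b c : R) : (0 <= a)%R -> (0 <= b)%R -> (0 < c)%R ->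
  (forall k, (a ^ S k <= c * b ^ S k)%R) -> (a <= b)%R.
Proof.
intros Ha Hb Hc H. destruct (Rle_lt_dec a b) as [|L]; auto. exfalso.
assert (X : (0 <= b / a < 1)%R).
{ split; [apply Rdiv_le_0_compat; lra|]. apply Rlt_div_l; lra. }
destruct (pow_small_le (b / a) c (1 / 2) X) as [N HN]; [lra|lra|].
specialize (H N).
assert (E : (b ^ S N = (b / a) ^ S N * a ^ S N)%R).
{ rewrite <- Rpow_mult_distr. f_equal. field. lra. }
rewrite E in H. assert (PA : (0 < a ^ S N)%R) by (apply pow_lt; lra).
assert (X0 : (0 <= (b / a) ^ N)%R) by (apply pow_le; lra).
assert (X1 : (c * (b / a) ^ S N <= 1 / 2)%R).
{ simpl. assert (b / a * (b / a) ^ N <= (b / a) ^ N)%R by nra. nra. }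
nra.
Qed.

Lemma pow_limit_le (a b r0 R0 : R) m : (0 <= a)%R -> (r0 < R0)%R ->
  (forall r, (r0 < r < R0)%R -> (a * r ^ m <= b)%R) -> (a * R0 ^ m <= b)%R.
Proof.
intros Ha Hr H. destruct (Rle_lt_dec (a * R0 ^ m) b) as [|L]; auto. exfalso.
assert (Cn : continuity_pt (fun r => a * r ^ m)%R R0).
{ apply continuity_pt_mult; [apply continuity_pt_const; intros ? ?; reflexivity|].
  apply derivable_continuous_pt, derivable_pt_pow. }
destruct (Cn (a * R0 ^ m - b)%R) as [d [Pd Hd]]; [lra|].
set (r := Rmax ((r0 + R0) / 2) (R0 - d / 2)).
assert (R1 : (r0 < r < R0)%R).
{ unfold r; split; [eapply Rlt_le_trans; [|apply Rmax_l]; lra|]. apply Rmax_lub_lt; lra. }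
assert (R2 : (R0 - d / 2 <= r)%R) by apply Rmax_r.
specialize (H r R1). specialize (Hd r). simpl in Hd. unfold Rdist in Hd.
assert (Q : (Rabs (a * r ^ m - a * R0 ^ m) < a * R0 ^ m - b)%R).
{ apply Hd. split; [split; [exact I|lra]|]. rewrite Rabs_left by lra. lra. }
apply Rabs_def2 in Q. lra.
Qed.

(** [O(w ^ m)] along points tending to 0. In this form the order of vanishing is multiplied by [k]
    under [k]-th powers; [small_order f n], which encodes order [n + 1], would lose some of it. *)
Definition big_order (f : C -> C) (m : nat) : Prop :=
  exists K : R, (0 < K)%R /\ forall del : R, (0 < del)%R ->
    exists w : C, (0 < Cmod w)%R /\ (Cmod w < del)%R /\ (Cmod (f w) <= K * Cmod w ^ m)%R.

Lemma big_order_small f m : big_order f (S m) -> small_order f m.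
Proof.
intros (K & PK & H) eps del Pe Pd.
destruct (H (Rmin del (eps / K))) as [w (W1 & W2 & W3)].
{ apply Rmin_pos; auto. now apply Rdiv_lt_0_compat. }
apply Rmin_Rgt_l in W2. destruct W2 as [W2 W2'].
apply Rgt_lt in W2'. apply Rlt_div_r in W2'; auto.
exists w; repeat split; auto. eapply Rle_trans; [exact W3|]. simpl.
assert (0 < Cmod w ^ m)%R by now apply pow_lt. nra.
Qed.

Lemma big_order_pow f m k : big_order f m -> big_order (fun w => f w ^ k) (m * k).
Proof.
intros (K & PK & H). exists (K ^ k)%R; split; [now apply pow_lt|].
intros del Pd. destruct (H del Pd) as [w (W1 & W2 & W3)]. exists w; repeat split; auto.
rewrite Cmod_pow, pow_mult, <- Rpow_mult_distr. apply pow_incr. split; [apply Cmod_ge_0|auto].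
Qed.

(* The [k]-th power of [f] vanishes to order [(m + 1) k] at [0], so its Taylor remainder
   gives [|f z|^k <= c (|z| / r)^((m + 1) k)] with [c] independent of [k]. *)
Lemma schwarz_order f R0 m z : hol_disc f R0 ->
  (forall w, (Cmod w < R0)%R -> (Cmod (f w) <= 1)%R) -> big_order f (S m) ->
  (Cmod z < R0)%R -> (Cmod (f z) * R0 ^ S m <= Cmod z ^ S m)%R.
Proof.
intros Hf B1 BO Hz. apply (pow_limit_le _ _ (Cmod z)); auto using Cmod_ge_0.
intros r [H1 H2]. assert (P := r_pos z r H1).
assert (N : (0 < r ^ S m)%R) by now apply pow_lt.
apply Rle_div_r; auto.
assert (Gz := Cmod_ge_0 z).
apply (pow_root_le _ _ (r / (r - Cmod z))).
- apply Cmod_ge_0.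
- apply Rdiv_le_0_compat; auto. now apply pow_le.
- apply Rdiv_lt_0_compat; lra.
- intros k. set (F := fun w => f w ^ S k).
  assert (DF : diff_on_disc F r).
  { intros w Hw. destruct (Hf w) as [l Hl]; [lra|]. apply (cdiff_pow f w l (S k) Hl). }
  assert (BF := big_order_pow f (S m) (S k) BO).
  (* The order is written as [S M], since the coefficients up to [M] are the ones that vanish. *)
  destruct (S m * S k)%nat as [|M] eqn:EM; [discriminate EM|].
  assert (Co := coef_vanish F r M P DF (big_order_small _ _ BF)).
  rewrite <- Cmod_pow. change (f z ^ S k) with (F z).
  rewrite (taylor_vanishing F r z (S M)); auto.
  2:{ intros j Hj; apply Co; lia. }
  rewrite Cmod_mult, Cmod_pow.
  eapply Rle_trans; [apply Rmult_le_compat_l; [apply pow_le; auto|]|].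
  + apply (tail_bound F r P DF (S M) z 1); auto.
    intros t _. unfold F. rewrite Cmod_pow, <- (pow1 (S k)). apply pow_incr.
    split; [apply Cmod_ge_0|]. apply B1. rewrite circ_mod; lra.
  + rewrite <- EM. unfold Rdiv. rewrite Rpow_mult_distr, !pow_inv, <- !pow_mult. lra.
Qed.

Lemma small_real_point (d : R) : (0 < d)%R ->
  exists e : R, (0 < e)%R /\ (e < d)%R /\ Cmod (RtoC e) = e.
Proof. intros Pd. exists (d / 2)%R. rewrite Cmod_R, Rabs_pos_eq; lra. Qed.

Lemma cdiff_small_order (f : C -> C) : f 0 = 0 -> cdiff f 0 0 -> small_order f 1.
Proof.
intros F0 H eps del Pe Pd. destruct (H eps Pe) as [d [Pd' Hd]].
destruct (small_real_point (Rmin d del)) as (e & E0 & E1 & Me); [now apply Rmin_pos|].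
apply Rmin_Rgt_l in E1. destruct E1 as [E1 E2].
exists (RtoC e). rewrite Me, pow_1. repeat split; auto.
specialize (Hd (RtoC e)). rewrite F0 in Hd.
replace (RtoC e - 0) with (RtoC e) in Hd by ring.
replace (f (RtoC e) - 0 - 0 * RtoC e) with (f (RtoC e)) in Hd by ring.
rewrite Me in Hd. auto.
Qed.

Lemma cdiff_big_order (f : C -> C) l : f 0 = 0 -> cdiff f 0 l -> big_order f 1.
Proof.
intros F0 H. destruct (cdiff_lipschitz _ _ _ H) as [d [Pd Hd]].
exists (Cmod l + 1)%R; split; [generalize (Cmod_ge_0 l); lra|].
intros del Pdel.
destruct (small_real_point (Rmin d del)) as (e & E0 & E1 & Me); [now apply Rmin_pos|].
apply Rmin_Rgt_l in E1. destruct E1 as [E1 E2].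
exists (RtoC e). rewrite Me, pow_1. repeat split; auto.
specialize (Hd (RtoC e)). rewrite F0 in Hd.
replace (RtoC e - 0) with (RtoC e) in Hd by ring.
replace (f (RtoC e) - 0) with (f (RtoC e)) in Hd by ring.
rewrite Me in Hd. auto.
Qed.

Lemma schwarz (f : C -> C) R0 z : hol_disc f R0 -> f 0 = 0 ->
  (forall w, (Cmod w < R0)%R -> (Cmod (f w) <= 1)%R) ->
  (Cmod z < R0)%R -> (Cmod (f z) * R0 <= Cmod z)%R.
Proof.
intros Hf F0 B1 Hz.
destruct (Hf 0) as [l Hl]; [rewrite Cmod_0; generalize (Cmod_ge_0 z); lra|].
generalize (schwarz_order f R0 0 z Hf B1 (cdiff_big_order f l F0 Hl) Hz).
rewrite !pow_1. auto.
Qed.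

Lemma cdiff_unique f z l l' : cdiff f z l -> cdiff f z l' -> l = l'.
Proof.
intros H H'. apply Ceq_minus. apply Cmod_le_eps_eq_0. intros eps Pe.
destruct (H (eps / 2)%R) as [d [Pd Hd]]; [lra|].
destruct (H' (eps / 2)%R) as [d' [Pd' Hd']]; [lra|].
destruct (small_real_point (Rmin d d')) as (e & E0 & E1 & Me); [now apply Rmin_pos|].
apply Rmin_Rgt_l in E1. destruct E1 as [E1 E2].
set (w := z + RtoC e).
assert (W : w - z = RtoC e) by (unfold w; ring).
specialize (Hd w). specialize (Hd' w). rewrite W, Me in Hd, Hd'.
assert (K1 := Hd E1). assert (K2 := Hd' E2).
assert (K : (e * Cmod (l - l') <= e * eps)%R).
{ rewrite <- Me at 1. rewrite <- Cmod_mult.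
  replace (RtoC e * (l - l')) with
    ((f w - f z - l' * RtoC e) - (f w - f z - l * RtoC e)) by ring.
  eapply Rle_trans; [apply Cmod_sub_triangle|]. lra. }
now apply Rmult_le_reg_l in K.
Qed.

Lemma two_nz : RtoC 2 <> 0.
Proof. intros K; apply RtoC_inj in K; lra. Qed.

(** Evenness makes the derivative at 0 equal to its own negative, hence 0; the second-order Taylor
    remainder then bounds [f]. *)
Lemma even_big_order (f : C -> C) R0 : (0 < R0)%R -> hol_disc f R0 -> f 0 = 0 ->
  (forall w, (Cmod w < R0)%R -> f (- w) = f w) -> big_order f 2.
Proof.
intros PR Hf F0 Ev.
destruct (Hf 0) as [l Hl]; [rewrite Cmod_0; auto|].
assert (L0 : l = 0).
{ assert (H2 : cdiff f 0 (- l)).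
  { apply (cdiff_ext_loc (fun w => f (- w)) f 0 (- l) R0); auto.
    - intros w Hw. apply Ev. replace w with (w - 0) by ring. auto.
    - eapply cdiff_eq.
      + apply (cdiff_comp (fun w => - w) f 0); [apply cdiff_opp, cdiff_id|].
        replace (- 0) with (RtoC 0) by ring. exact Hl.
      + ring. }
  assert (E := cdiff_unique _ _ _ _ Hl H2).
  assert (E2 : RtoC 2 * l = 0) by (replace (RtoC 2 * l) with (l - - l) by ring;
    rewrite <- E; ring).
  replace l with (/ 2 * (2 * l)) by (field; apply two_nz). rewrite E2; ring. }
subst l.
assert (So := cdiff_small_order f F0 Hl).
set (r := (R0 / 2)%R). assert (Pr : (0 < r)%R) by (unfold r; lra).
assert (D : diff_on_disc f r) by (apply (hol_disc_closed f R0); auto; unfold r; lra).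
destruct (ccont_bounded (fun t => f (circ r t))) as [B [PB HB]].
{ intros; now apply f_circ_cont. }
exists (B * (/ r) ^ 2 * 2)%R; split.
{ apply Rmult_lt_0_compat; [|lra]. apply Rmult_lt_0_compat; auto.
  now apply pow_lt, Rinv_0_lt_compat. }
intros del Pd.
destruct (small_real_point (Rmin (r / 2) del)) as (e & E0 & E1 & Me); [apply Rmin_pos; lra|].
apply Rmin_Rgt_l in E1. destruct E1 as [E1 E2].
exists (RtoC e). rewrite Me. repeat split; auto.
rewrite (taylor_vanishing f r (RtoC e) 2); auto.
- rewrite Cmod_mult, Cmod_pow, Me, Rmult_comm.
  apply Rmult_le_compat_r; [apply pow_le; lra|].
  eapply Rle_trans; [apply (tail_bound f r Pr D 2 _ B); auto; rewrite Me; lra|].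
  rewrite Me. apply Rmult_le_compat_l.
  + apply Rmult_le_pos; [lra|]. apply pow_le. left; now apply Rinv_0_lt_compat.
  + apply Rle_div_l; lra.
- rewrite Me; lra.
- intros k Hk. apply (coef_vanish f r 1); auto. lia.
Qed.

(** Zeros on a segment ending at 0 make [f] of small order for every [n], so [|f z|] is at most a
    constant times [(|z| / r) ^ n] for all [n]. *)
Lemma identity_disc (f : C -> C) R0 (q z : C) : hol_disc f R0 -> q <> 0 ->
  (forall t : R, (0 < t <= 1)%R -> f (RtoC t * q) = 0) -> (Cmod z < R0)%R -> f z = 0.
Proof.
intros Hf Hq F0 Hz. set (r := ((Cmod z + R0) / 2)%R).
assert (Zr : (Cmod z < r)%R) by (unfold r; lra).
assert (Pr := r_pos z r Zr).
assert (D : diff_on_disc f r) by (apply (hol_disc_closed f R0); auto; unfold r; lra).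
assert (Q : (0 < Cmod q)%R) by now apply Cmod_gt_0.
assert (So : forall n, small_order f n).
{ intros n eps del Pe Pd.
  set (t := Rmin 1 (del / (2 * Cmod q))).
  assert (T0 : (0 < t)%R) by (apply Rmin_pos; [lra|]; apply Rdiv_lt_0_compat; lra).
  assert (T1 : (t <= 1)%R) by apply Rmin_l.
  assert (T2 : (t <= del / (2 * Cmod q))%R) by apply Rmin_r.
  apply Rle_div_r in T2; [|lra].
  exists (RtoC t * q). rewrite F0 by lra. rewrite Cmod_mult, Cmod_R, Rabs_pos_eq, Cmod_0 by lra.
  repeat split; [nra|nra|]. apply Rmult_le_pos; [lra|]. apply pow_le. nra. }
destruct (ccont_bounded (fun t => f (circ r t))) as [B [PB HB]].
{ intros; now apply f_circ_cont. }
apply Cmod_le_eps_eq_0. intros eps Pe.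
assert (X : (0 <= Cmod z / r < 1)%R).
{ split; [apply Rdiv_le_0_compat; auto; apply Cmod_ge_0|]. apply Rlt_div_l; lra. }
destruct (pow_small_le (Cmod z / r) (B * (r / (r - Cmod z))) eps X) as [N HN]; auto.
{ apply Rmult_le_pos; [lra|]. apply Rdiv_le_0_compat; lra. }
rewrite (taylor_vanishing f r z N); auto.
2:{ intros k Hk. apply (coef_vanish f r N); auto. lia. }
rewrite Cmod_mult, Cmod_pow. eapply Rle_trans; [|exact HN].
eapply Rle_trans; [apply Rmult_le_compat_l; [apply pow_le, Cmod_ge_0|]|].
- apply (tail_bound f r Pr D N z B); auto.
- right. unfold Rdiv. rewrite Rpow_mult_distr. ring.
Qed.

(** Continuation along the segment from 0 to [x], whose direction may differ from that of [q]. The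
    zeros towards [q] give vanishing near 0; at the supremum [T] of the parameters reached, the
    zeros already found give a full disc, hence more of the segment unless [T = 1]. *)
Lemma identity_star (Om : C -> Prop) (f : C -> C) (q x : C) :
  (forall w, Om w -> exists d : R, (0 < d)%R /\ forall v, (Cmod (v - w) < d)%R -> Om v) ->
  (forall w, Om w -> exists l, cdiff f w l) ->
  q <> 0 -> (forall t : R, (0 <= t <= 1)%R -> f (RtoC t * q) = 0) ->
  (forall t : R, (0 <= t <= 1)%R -> Om (RtoC t * x)) -> f x = 0.
Proof.
intros Op Hf Hq F0 Hx.
assert (Loc : forall w, Om w -> exists d : R, (0 < d)%R /\ forall q' : C, q' <> 0 ->
  (forall t : R, (0 < t <= 1)%R -> f (w + RtoC t * q') = 0) ->
  forall v, (Cmod (v - w) < d)%R -> f v = 0).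
{ intros w Ow. destruct (Op w Ow) as [d [Pd Hd]]. exists d; split; auto.
  intros q' Hq' F' v Hv.
  replace v with (w + (v - w)) by ring.
  refine (identity_disc (fun u => f (w + u)) d q' (v - w) _ Hq' F' Hv).
  intros u Hu. destruct (Hf (w + u)) as [l Hl].
  { apply Hd. replace (w + u - w) with u by ring. auto. }
  eexists. apply (cdiff_comp (fun u => w + u) f); [|exact Hl].
  apply cdiff_plus; [apply cdiff_const|apply cdiff_id]. }
destruct (Ceq_dec x 0) as [->|Nx].
{ transitivity (f (RtoC 0 * q)); [f_equal; ring | apply F0; lra]. }
assert (Px : (0 < Cmod x)%R) by now apply Cmod_gt_0.
set (Z := fun t : R => (0 <= t <= 1)%R /\
  forall s : R, (0 <= s <= t)%R -> f (RtoC s * x) = 0).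
destruct (Loc 0) as [d0 [Pd0 H0]].
{ replace (RtoC 0) with (RtoC 0 * x) by ring. apply Hx. lra. }
assert (Z0 : Z (Rmin 1 (d0 / (2 * Cmod x)))).
{ set (t := Rmin _ _).
  assert (T0 : (0 < t)%R) by (apply Rmin_pos; [lra|]; apply Rdiv_lt_0_compat; lra).
  assert (T1 : (t <= 1)%R) by apply Rmin_l.
  assert (T2 : (t <= d0 / (2 * Cmod x))%R) by apply Rmin_r.
  apply Rle_div_r in T2; [|lra].
  split; [lra|]. intros s Hs. apply (H0 q Hq).
  - intros u Hu. replace (0 + RtoC u * q) with (RtoC u * q) by ring. apply F0; lra.
  - replace (RtoC s * x - 0) with (RtoC s * x) by ring.
    rewrite Cmod_mult, Cmod_R, Rabs_pos_eq by lra. nra. }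
destruct (completeness Z) as [T [U1 U2]].
{ exists 1%R. intros t [Ht _]; lra. }
{ eexists; exact Z0. }
assert (T0 : (0 < T)%R).
{ eapply Rlt_le_trans; [|apply (U1 _ Z0)]. apply Rmin_pos; [lra|].
  apply Rdiv_lt_0_compat; lra. }
assert (T1 : (T <= 1)%R) by (apply U2; intros t [Ht _]; lra).
assert (Below : forall s : R, (0 <= s < T)%R -> f (RtoC s * x) = 0).
{ intros s Hs. destruct (Classical_Prop.classic (exists t, Z t /\ (s <= t)%R)) as [[t [[_ Zt] Ht]]|N].
  - apply Zt; lra.
  - exfalso. assert (T <= s)%R; [|lra]. apply U2. intros t Zt.
    destruct (Rle_lt_dec t s); auto. exfalso; apply N. exists t; split; auto; lra. }
destruct (Loc (RtoC T * x)) as [d [Pd Hd]]; [apply Hx; lra|].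
(* Seen from [T * x], the known zeros lie in the direction of the origin. *)
assert (Ball : forall v, (Cmod (v - RtoC T * x) < d)%R -> f v = 0).
{ apply (Hd (- (RtoC T * x))).
  - intros E. assert (E' : RtoC T * x = 0) by
      (replace (RtoC T * x) with (- - (RtoC T * x)) by ring; rewrite E; ring).
    revert E'. apply Cmult_neq_0; auto. intros K; apply RtoC_inj in K; lra.
  - intros t Ht. replace (RtoC T * x + RtoC t * - (RtoC T * x)) with (RtoC (T - t * T) * x).
    + apply Below. nra.
    + rewrite RtoC_minus, RtoC_mult. ring. }
set (T' := Rmin 1 (T + d / (2 * Cmod x))).
assert (ZT : Z T').
{ assert (A : (T' <= 1)%R) by apply Rmin_l.
  assert (A2 : (T' <= T + d / (2 * Cmod x))%R) by apply Rmin_r.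
  assert (Pq : (0 < d / (2 * Cmod x))%R) by (apply Rdiv_lt_0_compat; lra).
  assert (A3 : (0 < T')%R) by (apply Rmin_pos; lra).
  split; [lra|]. intros s Hs. destruct (Rlt_le_dec s T) as [L|L]; [apply Below; lra|].
  apply Ball. replace (RtoC s * x - RtoC T * x) with (RtoC (s - T) * x) by (rewrite RtoC_minus; ring).
  rewrite Cmod_mult, Cmod_R, Rabs_pos_eq by lra.
  assert (B : (s - T <= d / (2 * Cmod x))%R) by lra. apply Rle_div_r in B; [|lra]. nra. }
assert (TT := U1 _ ZT).
assert (Pq : (0 < d / (2 * Cmod x))%R) by (apply Rdiv_lt_0_compat; lra).
assert (T' = 1%R).
{ destruct (Rle_lt_dec 1 (T + d / (2 * Cmod x))) as [l|l]; [now apply Rmin_left|].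
  exfalso. unfold T' in TT. rewrite Rmin_right in TT; lra. }
destruct ZT as [_ ZT]. transitivity (f (RtoC 1 * x)); [f_equal; ring | apply ZT; lra].
Qed.

Lemma Cmod_sq (z : C) : (Cmod z ^ 2 = fst z ^ 2 + snd z ^ 2)%R.
Proof. rewrite Cmod2_alt. reflexivity. Qed.

(* With [h = f - id] and [|c| = r], [|f c| <= 1] reads
   [|h c|^2 <= 1 - r^2 - 2 r^2 Re (h c / c)], and [Re (h c / c)] has mean [0]; AM-GM
   with weight [del] then makes the mean of [|h|] small as [r] tends to [1]. *)
Lemma schwarz_equality (f : C -> C) z : hol_disc f 1 ->
  (forall w, (Cmod w < 1)%R -> (Cmod (f w) <= 1)%R) -> f 0 = 0 -> cdiff f 0 1 ->
  (Cmod z < 1)%R -> f z = z.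
Proof.
intros Hf B1 F0 D0 Hz.
assert (Gz := Cmod_ge_0 z).
set (h := fun w => f w - w).
assert (Hh : hol_disc h 1).
{ intros w Hw. destruct (Hf w Hw) as [l Hl]. eexists. apply cdiff_minus; [exact Hl|apply cdiff_id]. }
assert (So : small_order h 1).
{ apply cdiff_small_order; [unfold h; rewrite F0; ring|].
  eapply cdiff_eq; [apply cdiff_minus; [exact D0|apply cdiff_id]|]. ring. }
apply Ceq_minus. change (h z = 0). apply Cmod_le_eps_eq_0. intros eps Pe.
(* Bounds the kernel [r / (r - |z|)] once [r >= (1 + |z|) / 2]. *)
set (K := (2 / (1 - Cmod z))%R).
assert (PK : (0 < K)%R) by (apply Rdiv_lt_0_compat; lra).
set (del := (eps / K)%R). assert (Pdel : (0 < del)%R) by now apply Rdiv_lt_0_compat.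
(* The second bound makes [(1 - r ^ 2) / del <= del], so that [a] below is at most
   [K * del = eps]. *)
set (r := Rmax ((1 + Cmod z) / 2) (1 - del ^ 2 / 2)).
assert (Pd2 : (0 < del ^ 2)%R) by now apply pow_lt.
assert (R1 : ((1 + Cmod z) / 2 <= r)%R) by apply Rmax_l.
assert (R2 : (1 - del ^ 2 / 2 <= r)%R) by apply Rmax_r.
assert (R3 : (r < 1)%R) by (apply Rmax_lub_lt; lra).
assert (Zr : (Cmod z < r)%R) by lra. assert (Pr := r_pos z r Zr).
assert (Dh : diff_on_disc h r) by (apply (hol_disc_closed h 1); auto).
rewrite (cauchy_formula h r z Zr Dh). unfold tail.
assert (C1 : coef h r 1 = 0) by (apply (coef_vanish h r 1); auto).
(* AM-GM bounds the integrand by a function affine in [Re (h c / c)], with constant term [a] and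
   slope [b]. Its mean is [a], because the mean of [h c / c] is [coef h r 1 = 0]. *)
set (a := (K * (del + (1 - r ^ 2) / del) / 2)%R).
set (b := (- (K * r ^ 2 / del))%R).
assert (I : is_RInt (fun t => a + b * fst (h (circ r t) * (/ circ r t) ^ 1)%C)%R 0 1 a).
{ assert (J := CI_correct _ 0 1 Rle_0_1 (fun t _ => coef_cont h r Pr Dh 1 t)).
  change (CI _ 0 1) with (coef h r 1) in J. rewrite C1 in J.
  apply (is_RInt_fct_extend_fst (U := R_NormedModule) (V := R_NormedModule)) in J.
  assert (J2 := is_RInt_plus (V := R_NormedModule) _ _ _ _ _ _
    (is_RInt_const (V := R_NormedModule) 0 1 a) (is_RInt_scal (V := R_NormedModule) _ _ _ b _ J)).
  match type of J2 with is_RInt _ _ _ ?x => assert (Ex : x = a) end.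
  { unfold plus, scal; simpl. unfold mult; simpl. ring. }
  rewrite Ex in J2. exact J2. }
rewrite <- C_R_norm.
apply Rle_trans with a.
- apply (norm_RInt_le (V := C_R_NormedModule)
    (fun t => h (circ r t) * (/ circ r t) ^ 0 * (circ r t / (circ r t - z)))
    (fun t => a + b * fst (h (circ r t) * (/ circ r t) ^ 1)%C)%R 0 1); [lra| |
    now apply CI_correct; [lra|intros; apply tail_cont] | exact I].
  intros t Ht. rewrite C_R_norm.
  assert (Kb := kernel_bound r z t Zr).
  assert (KK : (r / (r - Cmod z) <= K)%R).
  { unfold K. apply Rle_div_l; [lra|].
    replace (2 / (1 - Cmod z) * (r - Cmod z))%R with (2 * (r - Cmod z) / (1 - Cmod z))%R by (field; lra).
    apply Rle_div_r; nra. }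
  rewrite Cmod_mult. simpl Cpow. rewrite Cmult_1_r, Cmult_1_r.
  assert (N := circ_nz r t Pr). assert (Mc := circ_mod r t ltac:(lra)).
  assert (Bf : (Cmod (f (circ r t)) <= 1)%R) by (apply B1; lra).
  set (c := circ r t) in *. set (q := h c).
  assert (Eq : fst (q * / c)%C = ((fst q * fst c + snd q * snd c) / r ^ 2)%R).
  { assert (S2 := Cmod_sq c). rewrite Mc in S2. unfold Cinv, Cmult; simpl.
    simpl in S2. rewrite <- S2. field. lra. }
  rewrite Eq.
  assert (Hq : (Cmod q ^ 2 <= 1 - r ^ 2 - 2 * (fst q * fst c + snd q * snd c))%R).
  { assert (Fq : f c = q + c) by (unfold q, h; ring).
    assert (S1 := Cmod_sq (q + c)).
    assert (S2 := Cmod_sq c). rewrite Mc in S2. rewrite (Cmod_sq q).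
    rewrite Fq in Bf. assert (G0 := Cmod_ge_0 (q + c)).
    assert (S3 : (Cmod (q + c) ^ 2 <= 1)%R) by nra.
    rewrite S1 in S3. change (fst (q + c)) with (fst q + fst c)%R in S3.
    change (snd (q + c)) with (snd q + snd c)%R in S3. nra. }
  set (s := (fst q * fst c + snd q * snd c)%R) in *.
  assert (AG : (Cmod q <= (del + (1 - r ^ 2 - 2 * s) / del) / 2)%R).
  { replace ((del + (1 - r ^ 2 - 2 * s) / del) / 2)%R with
      ((del ^ 2 + (1 - r ^ 2 - 2 * s)) / (2 * del))%R by (field; lra).
    apply Rle_div_r; [lra|]. generalize (pow2_ge_0 (Cmod q - del)). lra. }
  apply Rle_trans with (((del + (1 - r ^ 2 - 2 * s) / del) / 2) * K)%R.
  + apply Rmult_le_compat; auto using Cmod_ge_0. lra.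
  + right. unfold a, b. field. lra.
- unfold a. assert (X : ((1 - r ^ 2) / del <= del)%R) by (apply Rle_div_l; nra).
  replace eps with (K * (2 * del) / 2)%R by (unfold del; field; lra).
  nra.
Qed.

(** * The upper half-plane *)

Definition UH (u : C) : Prop := (0 < snd u)%R.

Lemma Cmod_half_identity (u b : C) :
  (Cmod (u - Cconj b) ^ 2 = Cmod (u - b) ^ 2 + 4 * snd u * snd b)%R.
Proof. rewrite !Cmod_sq. destruct u, b; simpl. ring. Qed.

Lemma UH_sub_conj_nz (u b : C) : UH u -> UH b -> u - Cconj b <> 0.
Proof.
unfold UH; intros Hu Hb E. apply (f_equal snd) in E. destruct u, b; simpl in *. lra.
Qed.

(** Cayley transform sending [b] to 0 and infinity to 1; [disc_to_half] is its inverse. *)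
Definition half_to_disc (b u : C) : C := (u - b) / (u - Cconj b).
Definition disc_to_half (b z : C) : C := (b - Cconj b * z) / (1 - z).

Lemma half_to_disc_lt (b u : C) : UH u -> UH b -> (Cmod (half_to_disc b u) < 1)%R.
Proof.
intros Hu Hb. assert (N := UH_sub_conj_nz u b Hu Hb).
unfold half_to_disc. rewrite Cmod_div by auto.
assert (P : (0 < Cmod (u - Cconj b))%R) by now apply Cmod_gt_0.
apply Rlt_div_l; auto. generalize (Cmod_half_identity u b) (Cmod_ge_0 (u - b)).
unfold UH in *. assert (0 < snd u * snd b)%R by now apply Rmult_lt_0_compat. nra.
Qed.

Lemma disc_neq_1 (z : C) : (Cmod z < 1)%R -> 1 - z <> 0.
Proof.
intros Hz. apply Cmod_gt_0. generalize (Cmod_triangle_inv 1 z). rewrite Cmod_1. lra.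
Qed.

Lemma sub_conj_nz (b : C) : UH b -> b - Cconj b <> 0.
Proof. intros H; now apply UH_sub_conj_nz. Qed.

Lemma disc_to_half_UH (b z : C) : UH b -> (Cmod z < 1)%R -> UH (disc_to_half b z).
Proof.
intros Hb Hz. assert (N := disc_neq_1 z Hz). set (u := disc_to_half b z).
assert (E1 : u - b = z * ((b - Cconj b) / (1 - z))) by (unfold u, disc_to_half; field; auto).
assert (E2 : u - Cconj b = (b - Cconj b) / (1 - z)) by (unfold u, disc_to_half; field; auto).
assert (I := Cmod_half_identity u b). rewrite E1, E2, Cmod_mult in I.
assert (P : (0 < Cmod ((b - Cconj b) / (1 - z)))%R).
{ apply Cmod_gt_0. apply Cmult_neq_0; [now apply sub_conj_nz|].
  intros E. apply C1_nz. rewrite <- (Cinv_r _ N), E. ring. }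
set (p := Cmod ((b - Cconj b) / (1 - z))) in *. assert (Gz := Cmod_ge_0 z). unfold UH in *.
assert (0 < p ^ 2 - (Cmod z * p) ^ 2)%R.
{ replace (p ^ 2 - (Cmod z * p) ^ 2)%R with (p ^ 2 * (1 - Cmod z ^ 2))%R by ring.
  apply Rmult_lt_0_compat; nra. }
nra.
Qed.

Lemma half_to_disc_inv (b z : C) : UH b -> (Cmod z < 1)%R ->
  half_to_disc b (disc_to_half b z) = z.
Proof.
intros Hb Hz. unfold half_to_disc, disc_to_half.
assert (N := disc_neq_1 z Hz). assert (N2 := sub_conj_nz b Hb). field.
split; auto. intros E; apply N2; rewrite <- E; ring.
Qed.

Lemma disc_to_half_inv (b u : C) : UH b -> UH u ->
  disc_to_half b (half_to_disc b u) = u.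
Proof.
intros Hb Hu. unfold half_to_disc, disc_to_half.
assert (N := UH_sub_conj_nz u b Hu Hb). assert (N2 := sub_conj_nz b Hb). field.
split; auto. intros E; apply N2; rewrite <- E; ring.
Qed.

Lemma disc_to_half_cdiff (b z : C) : (Cmod z < 1)%R ->
  cdiff (disc_to_half b) z ((b - Cconj b) / ((1 - z) * (1 - z))).
Proof.
intros Hz. assert (N := disc_neq_1 z Hz). eapply cdiff_eq.
- apply cdiff_div; auto; apply cdiff_minus; try apply cdiff_const; try apply cdiff_id.
  apply cdiff_mult; [apply cdiff_const|apply cdiff_id].
- cbv beta. field. auto.
Qed.

Lemma half_to_disc_cdiff (b u : C) : u - Cconj b <> 0 ->
  cdiff (half_to_disc b) u ((b - Cconj b) / ((u - Cconj b) * (u - Cconj b))).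
Proof.
intros N. eapply cdiff_eq.
- apply cdiff_div; auto; apply cdiff_minus; try apply cdiff_const; apply cdiff_id.
- cbv beta. field. auto.
Qed.

Definition hol_UH (k : C -> C) : Prop := forall u, UH u -> exists l, cdiff k u l.

Definition transfer (k : C -> C) (b z : C) : C := half_to_disc (k b) (k (disc_to_half b z)).

Section Transfer.

Variables (k : C -> C) (b : C).
Hypothesis k_hol : hol_UH k.
Hypothesis k_UH : forall u, UH u -> UH (k u).
Hypothesis b_UH : UH b.

Lemma disc_to_half_0 : disc_to_half b 0 = b.
Proof. unfold disc_to_half. field. Qed.

Lemma transfer_hol : hol_disc (transfer k b) 1.
Proof.
intros z Hz. destruct (k_hol (disc_to_half b z)) as [l Hl]; [now apply disc_to_half_UH|].
eexists. apply (cdiff_comp (fun z => k (disc_to_half b z)) (half_to_disc (k b))).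
- apply (cdiff_comp (disc_to_half b) k); [now apply disc_to_half_cdiff|exact Hl].
- apply half_to_disc_cdiff. apply UH_sub_conj_nz; auto. now apply k_UH, disc_to_half_UH.
Qed.

Lemma transfer_0 : transfer k b 0 = 0.
Proof. unfold transfer, half_to_disc. rewrite disc_to_half_0. unfold Cdiv; ring. Qed.

Lemma transfer_bound z : (Cmod z < 1)%R -> (Cmod (transfer k b z) <= 1)%R.
Proof.
intros Hz. left. apply half_to_disc_lt; auto. now apply k_UH, disc_to_half_UH.
Qed.

Lemma transfer_cdiff l : k b = b -> cdiff k b l -> cdiff (transfer k b) 0 l.
Proof.
intros Kb Hl. assert (N := sub_conj_nz b b_UH).
assert (Z : (Cmod 0 < 1)%R) by (rewrite Cmod_0; lra).
rewrite <- disc_to_half_0 in Hl. eapply cdiff_eq.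
- apply (cdiff_comp (fun z => k (disc_to_half b z)) (half_to_disc (k b))).
  + apply (cdiff_comp (disc_to_half b) k); [now apply disc_to_half_cdiff|exact Hl].
  + apply half_to_disc_cdiff. cbv beta. rewrite disc_to_half_0, Kb. auto.
- cbv beta. rewrite disc_to_half_0, Kb. field. auto.
Qed.

End Transfer.

Lemma schwarz_pick (k : C -> C) (a b : C) : hol_UH k -> (forall u, UH u -> UH (k u)) ->
  UH a -> UH b ->
  (Cmod (k a - k b) ^ 2 * (snd a * snd b) <= Cmod (a - b) ^ 2 * (snd (k a) * snd (k b)))%R.
Proof.
intros Hk KU Ha Hb.
assert (S := schwarz (transfer k b) 1 (half_to_disc b a) (transfer_hol k b Hk KU Hb)
  (transfer_0 k b) (transfer_bound k b KU Hb) (half_to_disc_lt b a Ha Hb)).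
unfold transfer in S. rewrite disc_to_half_inv in S by auto. rewrite Rmult_1_r in S.
unfold half_to_disc in S.
assert (N1 := UH_sub_conj_nz a b Ha Hb).
assert (N2 := UH_sub_conj_nz (k a) (k b) (KU a Ha) (KU b Hb)).
rewrite !Cmod_div in S by auto.
assert (P1 : (0 < Cmod (a - Cconj b))%R) by now apply Cmod_gt_0.
assert (P2 : (0 < Cmod (k a - Cconj (k b)))%R) by now apply Cmod_gt_0.
apply (proj1 (Rle_div_l _ _ _ P2)) in S.
replace (Cmod (a - b) / Cmod (a - Cconj b) * Cmod (k a - Cconj (k b)))%R with
 (Cmod (a - b) * Cmod (k a - Cconj (k b)) / Cmod (a - Cconj b))%R in S by (field; lra).
apply (proj2 (Rle_div_r _ _ _ P1)) in S.
assert (I1 := Cmod_half_identity a b). assert (I2 := Cmod_half_identity (k a) (k b)).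
assert (G1 := Cmod_ge_0 (a - b)). assert (G2 := Cmod_ge_0 (k a - k b)).
assert (Q : ((Cmod (k a - k b) * Cmod (a - Cconj b)) ^ 2 <=
  (Cmod (a - b) * Cmod (k a - Cconj (k b))) ^ 2)%R).
{ apply pow_incr. split; auto. apply Rmult_le_pos; lra. }
rewrite !Rpow_mult_distr, I1, I2 in Q. nra.
Qed.

Lemma half_plane_rigidity (k : C -> C) (b u : C) : hol_UH k -> (forall u, UH u -> UH (k u)) ->
  UH b -> k b = b -> cdiff k b 1 -> UH u -> k u = u.
Proof.
intros Hk KU Hb Kb K1 Hu.
assert (E := schwarz_equality (transfer k b) (half_to_disc b u) (transfer_hol k b Hk KU Hb)
  (transfer_bound k b KU Hb) (transfer_0 k b) (transfer_cdiff k b Hb 1 Kb K1)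
  (half_to_disc_lt b u Hu Hb)).
unfold transfer in E. rewrite disc_to_half_inv, Kb in E by auto.
rewrite <- (disc_to_half_inv b (k u)), E, disc_to_half_inv; auto.
Qed.

Lemma derivative_le_1 (g : C -> C) l : (forall z, (Cmod z < 1)%R -> (Cmod (g z) <= Cmod z)%R) ->
  g 0 = 0 -> cdiff g 0 l -> (Cmod l <= 1)%R.
Proof.
intros H G0 D. apply Rnot_lt_le. intros L.
destruct (D ((Cmod l - 1) / 2)%R) as [d [Pd Hd]]; [lra|].
destruct (small_real_point (Rmin d 1)) as (e & Pe & E1 & Me); [apply Rmin_pos; lra|].
apply Rmin_Rgt_l in E1. destruct E1 as [E1 E2].
specialize (Hd (RtoC e)). rewrite G0 in Hd.
replace (RtoC e - 0) with (RtoC e) in Hd by ring. rewrite Me in Hd.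
specialize (Hd E1).
specialize (H (RtoC e)). rewrite Me in H. specialize (H E2).
generalize (Cmod_triangle_inv (l * RtoC e) (g (RtoC e))).
rewrite Cmod_mult, Me, Cmod_sub_comm.
replace (g (RtoC e) - l * RtoC e) with (g (RtoC e) - 0 - l * RtoC e) by ring. nra.
Qed.

Lemma half_plane_derivative (k : C -> C) (b l : C) : hol_UH k -> (forall u, UH u -> UH (k u)) ->
  UH b -> k b = b -> cdiff k b l -> (Cmod l <= 1)%R.
Proof.
intros Hk KU Hb Kb Hl. apply (derivative_le_1 (transfer k b)).
- intros z Hz. rewrite <- (Rmult_1_r (Cmod (transfer k b z))).
  apply schwarz; auto using transfer_hol, transfer_0, transfer_bound.
- apply transfer_0.
- now apply transfer_cdiff.
Qed.

(* A Harnack-type bound; the [big_order] hypothesis holds with [m = 0] for every [phi] and with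
   [m = 1] for even [phi]. *)
Lemma disc_to_UH_bound (phi : C -> C) (R0 : R) (m : nat) (h : C) : (0 < R0)%R ->
  hol_disc phi R0 -> (forall w, (Cmod w < R0)%R -> UH (phi w)) ->
  big_order (fun w => half_to_disc (phi 0) (phi w)) (S m) ->
  (Cmod h < R0)%R -> (Cmod h ^ S m <= R0 ^ S m / 2)%R ->
  (Cmod (phi h - phi 0) <= 4 * snd (phi 0) * (Cmod h ^ S m / R0 ^ S m))%R.
Proof.
intros PR Hphi U BO Hh Hh2.
assert (U0 : UH (phi 0)) by (apply U; rewrite Cmod_0; auto).
assert (Sc := schwarz_order (fun w => half_to_disc (phi 0) (phi w)) R0 m h).
cbv beta in Sc.
assert (N := UH_sub_conj_nz (phi h) (phi 0) (U h Hh) U0).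
assert (PRm : (0 < R0 ^ S m)%R) by now apply pow_lt.
assert (Sc' : (Cmod (half_to_disc (phi 0) (phi h)) <= Cmod h ^ S m / R0 ^ S m)%R).
{ apply Rle_div_r; auto. apply Sc; auto.
  - intros w Hw. destruct (Hphi w Hw) as [l Hl]. eexists.
    apply (cdiff_comp phi (half_to_disc (phi 0))); [exact Hl|].
    apply half_to_disc_cdiff. apply UH_sub_conj_nz; auto.
  - intros w Hw. left. apply half_to_disc_lt; auto. }
set (rho := (Cmod h ^ S m / R0 ^ S m)%R) in *.
assert (Rh : (rho <= 1 / 2)%R) by (apply Rle_div_l; lra).
unfold half_to_disc in Sc'. rewrite Cmod_div in Sc' by auto.
assert (P : (0 < Cmod (phi h - Cconj (phi 0)))%R) by now apply Cmod_gt_0.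
apply (proj1 (Rle_div_l _ _ _ P)) in Sc'.
(* For [X = |phi h - phi 0|] this gives [X <= rho * (X + 2 * Im (phi 0))], and [rho <= 1/2] turns it
   into [X <= 4 * rho * Im (phi 0)]. *)
assert (T : (Cmod (phi h - Cconj (phi 0)) <= Cmod (phi h - phi 0) + 2 * snd (phi 0))%R).
{ replace (phi h - Cconj (phi 0)) with ((phi h - phi 0) + (phi 0 - Cconj (phi 0))) by ring.
  eapply Rle_trans; [apply Cmod_triangle|]. apply Rplus_le_compat_l.
  right. rewrite im_alt', !Cmod_mult, Cmod_Ci, !Cmod_R. unfold UH, Im in *.
  rewrite !Rabs_pos_eq by lra. ring. }
unfold UH in U0. assert (G := Cmod_ge_0 (phi h - phi 0)).
assert (R0' : (0 <= rho)%R) by (apply Rdiv_le_0_compat; auto; apply pow_le, Cmod_ge_0).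
nra.
Qed.

(** * Boundary rigidity in the half-plane *)

Definition iR (y : R) : C := (0%R, y).

Lemma julia_square_bound (y q e : R) : (0 <= y)%R -> (-1 <= e - y <= 1)%R ->
  (y ^ 2 - 2 * y * (1 + q) <= (q + - e) ^ 2)%R.
Proof.
intros Hy He. replace ((q + - e) ^ 2)%R with (y ^ 2 - 2 * y * (q - (e - y)) + (q - (e - y)) ^ 2)%R by ring.
generalize (pow2_ge_0 (q - (e - y))). nra.
Qed.

(** The hypothesis is Schwarz-Pick between [u = x + i s] and [i y], with [k u = p + i q] and
    [k (i y) = e1 + i e2]. Both sides have leading order [y^3], with coefficients [s] and [q];
    dividing by [y^2] leaves the stated error. *)
Lemma julia_inequality (x s p q e1 e2 y : R) : (0 < s)%R -> (0 < q)%R -> (2 <= y)%R ->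
  (-1 <= e2 - y <= 1)%R ->
  (((p + - e1) ^ 2 + (q + - e2) ^ 2) * (s * y) <=
    ((x + - 0) ^ 2 + (s + - y) ^ 2) * (q * e2))%R ->
  ((s - q) * y <= 2 * s * (1 + q) + q * (1 + 2 * (x ^ 2 + s ^ 2)))%R.
Proof.
intros Hs Hq Hy He S.
assert (A1 := pow2_ge_0 (p + - e1)).
assert (A2 := julia_square_bound y q e2 ltac:(lra) He).
assert (A3 := pow2_ge_0 x). assert (A4 := pow2_ge_0 (s + - y)).
set (M := (x ^ 2 + s ^ 2)%R). assert (PM : (0 <= M)%R) by (unfold M; nra).
assert (Psy : (0 < s * y)%R) by nra. assert (Pqe : (0 < q * e2)%R) by nra.
assert (T1 : ((y ^ 2 - 2 * y * (1 + q)) * (s * y) <=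
  ((p + - e1) ^ 2 + (q + - e2) ^ 2) * (s * y))%R).
{ apply Rmult_le_compat_r; lra. }
assert (T2 : (((x + - 0) ^ 2 + (s + - y) ^ 2) * (q * e2) <= (y ^ 2 + M) * (q * (y + 1)))%R).
{ replace ((x + - 0) ^ 2 + (s + - y) ^ 2)%R with (y ^ 2 + M - 2 * (s * y))%R by (unfold M; ring).
  apply Rle_trans with ((y ^ 2 + M) * (q * e2))%R.
  - apply Rmult_le_compat_r; lra.
  - apply Rmult_le_compat_l; [generalize (pow2_ge_0 y); lra|]. apply Rmult_le_compat_l; lra. }
assert (T3 : ((y ^ 2 - 2 * y * (1 + q)) * (s * y) <= (y ^ 2 + M) * (q * (y + 1)))%R) by lra.
clear T1 T2 S A1 A2 A3 A4.
assert (QM : (0 <= q * M)%R) by nra.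
assert (Y1 : (1 <= y ^ 2)%R) by nra. assert (Y2 : (y <= y ^ 2)%R) by nra.
assert (X1 : (q * M * y <= q * M * y ^ 2)%R) by (apply Rmult_le_compat_l; lra).
assert (X2 : (q * M * 1 <= q * M * y ^ 2)%R) by (apply Rmult_le_compat_l; lra).
apply Rmult_le_reg_r with (y ^ 2)%R; [lra|]. lra.
Qed.

(** Since [k] displaces [i y] by at most 1, Schwarz-Pick between [u] and [i y] compares [Im u] with
    [Im (k u)] in its leading term as [y] grows. *)
Lemma julia_at_infinity (k : C -> C) (Y : R) (u : C) : hol_UH k -> (forall u, UH u -> UH (k u)) ->
  (forall y, (Y <= y)%R -> (Cmod (k (iR y) - iR y) <= 1)%R) ->
  UH u -> (snd u <= snd (k u))%R.
Proof.
intros Hk KU HY Hu. apply Rnot_lt_le. intros L.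
assert (Ku := KU u Hu). unfold UH in Hu, Ku.
destruct u as [x s]. set (q := snd (k (x, s))) in *. simpl in Hu, L.
set (M := (x ^ 2 + s ^ 2)%R). assert (PM : (0 <= M)%R) by (unfold M; nra).
set (D := (2 * s * (1 + q) + q * (1 + 2 * M))%R).
assert (PD : (0 < D)%R) by (unfold D; nra).
set (y := Rmax (Rmax Y 2) (D / (s - q) + 1)).
assert (Y1 : (Y <= y)%R) by (eapply Rle_trans; [|apply Rmax_l]; apply Rmax_l).
assert (Y2 : (2 <= y)%R) by (eapply Rle_trans; [|apply Rmax_l]; apply Rmax_r).
assert (Y3 : (D / (s - q) + 1 <= y)%R) by apply Rmax_r.
assert (Y4 : (D < y * (s - q))%R) by (apply Rlt_div_l; lra).
specialize (HY y Y1).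
assert (Uy : UH (iR y)) by (unfold UH, iR; simpl; lra).
assert (S := schwarz_pick k (x, s) (iR y) Hk KU Hu Uy).
fold q in S.
assert (B := Rmax_Cmod (k (iR y) - iR y)).
assert (B2 := Rle_trans _ _ _ (Rmax_r _ _) (Rle_trans _ _ _ B HY)).
rewrite !Cmod_sq in S.
destruct (k (iR y)) as [e1 e2]. destruct (k (x, s)) as [p q'] eqn:E.
subst q. unfold iR, Cminus, Cplus, Copp in *; simpl in *.
apply Rabs_le_between in B2.
assert (T := julia_inequality x s p q' e1 e2 y Hu Ku Y2 ltac:(lra)). fold M in T. fold D in T.
assert (T' := T ltac:(simpl; lra)). simpl in T'. unfold D, M in Y4. lra.
Qed.

(** Schwarz-Pick between [u] and [i y] bounds [|F u - F (i y)|^2] by a multiple of [y * Im F (i y)],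
    up to the shift below; this is [O(y^-2)], and [F (i y)] itself tends to 0. *)
Lemma rigidity_at_infinity (F : C -> C) (A Y : R) (u : C) : hol_UH F ->
  (forall u, UH u -> (0 <= snd (F u))%R) -> (0 <= A)%R ->
  (forall y, (Y <= y)%R -> (Cmod (F (iR y)) <= A / y)%R /\ (snd (F (iR y)) <= A / y ^ 3)%R) ->
  UH u -> F u = 0.
Proof.
intros HF FU PA HY Hu. assert (Fu := FU u Hu). unfold UH in Hu.
set (M := (fst u ^ 2 + snd u ^ 2 + 1)%R).
set (D := (M * (snd (F u) + 1) * (A + 1) / snd u + 1)%R).
assert (PM : (0 < M)%R) by (unfold M; nra).
assert (PD : (1 <= D)%R).
{ assert (0 <= M * (snd (F u) + 1) * (A + 1) / snd u)%R; [|unfold D; lra].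
  apply Rdiv_le_0_compat; auto. repeat apply Rmult_le_pos; lra. }
apply Cmod_le_eps_eq_0. intros eps Pe.
set (y := Rmax (Rmax Y 1) ((D + A) / eps)).
assert (Y1 : (Y <= y)%R) by (eapply Rle_trans; [|apply Rmax_l]; apply Rmax_l).
assert (Y2 : (1 <= y)%R) by (eapply Rle_trans; [|apply Rmax_l]; apply Rmax_r).
assert (Y3 : ((D + A) / eps <= y)%R) by apply Rmax_r.
apply (proj1 (Rle_div_l _ _ _ Pe)) in Y3.
destruct (HY y Y1) as [H1 H2].
assert (P3 : (1 <= y ^ 3)%R) by (apply pow_R1_Rle; auto).
assert (Pi3 : (0 < / y ^ 3 <= 1)%R).
{ split; [apply Rinv_0_lt_compat; lra|]. rewrite <- Rinv_1. apply Rinv_le_contravar; lra. }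
assert (Uy : UH (iR y)) by (unfold UH, iR; simpl; lra).
(* Schwarz-Pick wants values in the open half-plane; a shift by [i / y^3] provides this and has the
   order of the bound on [Im F (i y)]. *)
set (k := fun w => F w + iR (/ y ^ 3)).
assert (Hk : hol_UH k).
{ intros w Hw. destruct (HF w Hw) as [l Hl]. eexists.
  apply cdiff_plus; [exact Hl|apply cdiff_const]. }
assert (KU : forall w, UH w -> UH (k w)).
{ intros w Hw. specialize (FU w Hw). unfold UH, k, iR; simpl. simpl in *. lra. }
assert (S := schwarz_pick k u (iR y) Hk KU Hu Uy).
replace (k u - k (iR y)) with (F u - F (iR y)) in S by (unfold k; ring).
change (snd (k u)) with (snd (F u) + / y ^ 3)%R in S.
change (snd (k (iR y))) with (snd (F (iR y)) + / y ^ 3)%R in S.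
change (snd (iR y)) with y in S.
assert (N := Cmod_sq (u - iR y)).
set (m := Cmod (F u - F (iR y))) in *. assert (Gm : (0 <= m)%R) by apply Cmod_ge_0.
assert (N2 : (Cmod (u - iR y) ^ 2 <= M * y ^ 2)%R).
{ rewrite N. change (fst (u - iR y)) with (fst u + - 0)%R.
  change (snd (u - iR y)) with (snd u + - y)%R. unfold M. unfold UH in Uy.
  assert (1 <= y ^ 2)%R by (apply pow_R1_Rle; auto). nra. }
assert (FUy := FU (iR y) Uy).
assert (S2 : (m ^ 2 * (snd u * y) <= M * y ^ 2 * ((snd (F u) + 1) * ((A + 1) * / y ^ 3)))%R).
{ eapply Rle_trans; [exact S|]. apply Rmult_le_compat; auto.
  - apply pow_le, Cmod_ge_0.
  - apply Rmult_le_pos; lra.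
  - unfold Rdiv in H2. apply Rmult_le_compat; lra. }
assert (S3 : (m ^ 2 * y ^ 2 <= D)%R).
{ assert (Q : (m ^ 2 * y ^ 2 <= M * (snd (F u) + 1) * (A + 1) / snd u)%R); [|unfold D; lra].
  apply (proj1 (Rle_div_r _ _ _ Hu)).
  apply (Rmult_le_compat_r y) in S2; [|lra].
  replace (M * y ^ 2 * ((snd (F u) + 1) * ((A + 1) * / y ^ 3)) * y)%R
    with (M * (snd (F u) + 1) * (A + 1))%R in S2 by (field; lra).
  lra. }
assert (S4 : (m * y <= D)%R).
{ assert (0 <= m * y)%R by nra. nra. }
apply (proj2 (Rle_div_r _ _ _ (Rlt_le_trans _ _ _ Rlt_0_1 Y2))) in H1.
replace (F u) with ((F u - F (iR y)) + F (iR y)) by ring.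
eapply Rle_trans; [apply Cmod_triangle|]. fold m.
apply Rmult_le_reg_r with y; lra.
Qed.

(** * Functions on the half-plane model of the symmetrized bidisc *)

(* [Gam u v] says that [u + d] and [u - d] lie in the upper half-plane, where [d^2 = v];
   indeed [|v| - Re v = 2 (Im d)^2]. *)
Definition Gam (u v : C) : Prop := UH u /\ (Cmod v - fst v < 2 * snd u ^ 2)%R.

(** [|v| - Re v] is nonnegative and is multiplied by [t] along with [v]. *)
Lemma Gam_star u v t : Gam u v -> (0 <= t <= 1)%R -> Gam u (RtoC t * v).
Proof.
intros [Hu H] Ht. split; auto. rewrite Cmod_mult, Cmod_R, Rabs_pos_eq by lra.
change (fst (RtoC t * v)) with (t * fst v - 0 * snd v)%R.
assert (0 <= Cmod v - fst v)%R.
{ generalize (re_le_Cmod v) (Rle_abs (Re v)). unfold Re; lra. }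
nra.
Qed.

Lemma Gam_open_v u v : Gam u v ->
  exists d : R, (0 < d)%R /\ forall w, (Cmod (w - v) < d)%R -> Gam u w.
Proof.
intros [Hu H]. exists ((2 * snd u ^ 2 - (Cmod v - fst v)) / 2)%R. split; [lra|].
intros w Hw. split; auto.
generalize (Cmod_triangle_inv w v) (re_le_Cmod (v - w)) (Rle_abs (Re (v - w))).
rewrite (Cmod_sub_comm v). unfold Re. change (fst (v - w)) with (fst v + - fst w)%R. lra.
Qed.

Lemma Gam_open_u u v : Gam u v ->
  exists d : R, (0 < d)%R /\ forall t : R, (0 <= t < d)%R -> Gam (u + iR t) v.
Proof.
intros [Hu H]. exists 1%R. split; [lra|]. intros t Ht. unfold UH in *. split.
- unfold UH, iR; simpl. simpl in *. lra.
- change (snd (u + iR t)) with (snd u + t)%R. nra.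
Qed.

Lemma Gam_real u v : UH u -> (0 <= v)%R -> Gam u (RtoC v).
Proof.
intros Hu Hv. split; auto. rewrite Cmod_R, Rabs_pos_eq by auto. unfold RtoC; simpl fst.
unfold UH in Hu. nra.
Qed.

Section Rigidity.

Variable K : C * C -> C.
Hypothesis K_diff : forall u v, Gam u v -> exists a b, cdiff2 K (u, v) a b.
Hypothesis K_UH : forall u v, Gam u v -> UH (K (u, v)).

Lemma slice_identity (u q v : C) : UH u -> q <> 0 ->
  (forall t : R, (0 <= t <= 1)%R -> K (u, RtoC t * q) = u) -> Gam u v -> K (u, v) = u.
Proof.
intros Hu Hq Kq Hv. apply Ceq_minus.
apply (identity_star (Gam u) (fun w => K (u, w) - u) q v).
- apply Gam_open_v.
- intros w Hw. destruct (K_diff u w Hw) as (a & b & Hab). eexists.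
  apply cdiff_minus; [|apply cdiff_const].
  apply (cdiff2_comp_curve K (fun _ => u) (fun w => w) w a b); auto using cdiff_const, cdiff_id.
- auto.
- intros t Ht. rewrite Kq by auto. ring.
- intros t Ht. now apply Gam_star.
Qed.

(** For [t = 1] this is the strict triangle inequality [|u^2 + 1| < |u|^2 + 1], as [u^2] is not a
    nonnegative real. *)
Lemma parabola_in_Gam u t : UH u -> (0 <= t <= 1)%R -> Gam u (RtoC t * (u * u + 1)).
Proof.
intros Hu Ht. apply Gam_star; auto. split; auto.
destruct u as [x y]. unfold UH in Hu; simpl in Hu.
set (w := (x, y) * (x, y) + 1). assert (S := Cmod_sq w).
assert (Fw : fst w = (x ^ 2 - y ^ 2 + 1)%R) by (unfold w; simpl; ring).
assert (Sw : snd w = (2 * x * y)%R) by (unfold w; simpl; ring).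
rewrite Fw. rewrite Fw, Sw in S. simpl snd.
assert (Cmod w < x ^ 2 + y ^ 2 + 1)%R; [|lra].
apply Rsqr_incrst_0; [|apply Cmod_ge_0|nra]. unfold Rsqr.
replace (Cmod w * Cmod w)%R with (Cmod w ^ 2)%R by ring. rewrite S.
assert (0 < y ^ 2)%R by now apply pow_lt. nra.
Qed.

(* The discs [v = t (u^2 + 1)], [0 <= t <= 1], all pass through [(i, 0)]. Those with [t = 0] and
   [t = 1] have derivatives of modulus at most [1] there by Schwarz, and the one with
   [t = c] is a convex combination equal to [1]; so every derivative is [1]. *)
Theorem parabola_rigidity (c : R) : (0 < c < 1)%R ->
  (forall u, UH u -> K (u, RtoC c * (u * u + 1)) = u) ->
  forall u v, Gam u v -> K (u, v) = u.
Proof.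
intros Hc Kc.
assert (Ui : UH Ci) by (unfold UH; simpl; lra).
assert (Ei : forall t, RtoC t * (Ci * Ci + 1) = 0).
{ intros t. replace (Ci * Ci + 1) with (RtoC 0); [ring|].
  unfold Ci, Cmult, Cplus, RtoC; simpl. f_equal; ring. }
assert (Gi : Gam Ci 0) by (apply (Gam_real Ci 0); auto; lra).
destruct (K_diff Ci 0 Gi) as (a & b & Hab).
assert (Ki : K (Ci, RtoC 0) = Ci) by (rewrite <- (Ei c); now apply Kc).
set (k := fun t u => K (u, RtoC t * (u * u + 1))).
assert (Hk : forall t, (0 <= t <= 1)%R -> hol_UH (k t)).
{ intros t Ht u Hu. destruct (K_diff u _ (parabola_in_Gam u t Hu Ht)) as (a' & b' & H').
  eexists. apply (cdiff2_comp_curve K (fun u => u) (fun u => RtoC t * (u * u + 1)) u a' b'); auto.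
  - apply cdiff_id.
  - apply cdiff_mult; [apply cdiff_const|]. apply cdiff_plus; [|apply cdiff_const].
    apply cdiff_mult; apply cdiff_id. }
assert (KU : forall t, (0 <= t <= 1)%R -> forall u, UH u -> UH (k t u)).
{ intros t Ht u Hu. now apply K_UH, parabola_in_Gam. }
assert (Kb : forall t, k t Ci = Ci) by (intros t; unfold k; now rewrite Ei).
assert (Dk : forall t, cdiff (k t) Ci (a + RtoC t * (2 * Ci * b))).
{ intros t. eapply cdiff_eq.
  - apply (cdiff2_comp_curve K (fun u => u) (fun u => RtoC t * (u * u + 1)) Ci a b).
    + rewrite Ei. exact Hab.
    + apply cdiff_id.
    + apply cdiff_mult; [apply cdiff_const|]. apply cdiff_plus; [|apply cdiff_const].
      apply cdiff_mult; apply cdiff_id.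
  - cbv beta. ring. }
assert (D1 : a + RtoC c * (2 * Ci * b) = 1).
{ eapply cdiff_unique; [apply Dk|].
  apply (cdiff_ext_loc (fun u => u) _ Ci 1 1); [lra| |apply cdiff_id].
  intros w Hw. symmetry. apply Kc. unfold UH.
  assert (B := Rle_trans _ _ _ (Rmax_r _ _) (Rmax_Cmod (w - Ci))).
  change (snd (w - Ci)) with (snd w + - 1)%R in B.
  assert (B2 := Rle_lt_trans _ _ _ B Hw). apply Rabs_def2 in B2. lra. }
assert (L0 := half_plane_derivative (k 0%R) Ci _ (Hk 0%R ltac:(lra)) (KU 0%R ltac:(lra)) Ui (Kb _) (Dk 0%R)).
assert (L1 := half_plane_derivative (k 1%R) Ci _ (Hk 1%R ltac:(lra)) (KU 1%R ltac:(lra)) Ui (Kb _) (Dk 1%R)).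
set (d := 2 * Ci * b) in *.
replace (a + RtoC 0 * d) with a in L0 by ring.
replace (a + RtoC 1 * d) with (a + d) in L1 by ring.
(* [a] and [a + d] lie in the closed unit disc and average to 1 with weights [1 - c] and [c]; 1 is
   an extreme point of that disc. *)
assert (Ea : a = 1 /\ d = 0).
{ assert (S0 := Cmod_sq a). assert (S1 := Cmod_sq (a + d)).
  assert (G0 := Cmod_ge_0 a). assert (G1 := Cmod_ge_0 (a + d)).
  destruct a as [a1 a2]. destruct d as [d1 d2].
  change (fst ((a1, a2) + (d1, d2))) with (a1 + d1)%R in S1.
  change (snd ((a1, a2) + (d1, d2))) with (a2 + d2)%R in S1. simpl fst in S0; simpl snd in S0.
  assert (E1 := f_equal fst D1). assert (E2 := f_equal snd D1). simpl in E1, E2.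
  assert (Q0 : (a1 ^ 2 + a2 ^ 2 <= 1)%R) by nra.
  assert (Q1 : ((a1 + d1) ^ 2 + (a2 + d2) ^ 2 <= 1)%R) by nra.
  assert (B0 : (a1 <= 1)%R) by nra. assert (B1 : (a1 + d1 <= 1)%R) by nra.
  assert (E : ((1 - c) * (1 - a1) + c * (1 - (a1 + d1)) = 0)%R) by lra.
  assert (P0 : (0 <= (1 - c) * (1 - a1))%R) by (apply Rmult_le_pos; lra).
  assert (P1 : (0 <= c * (1 - (a1 + d1)))%R) by (apply Rmult_le_pos; lra).
  assert (F0 : ((1 - c) * (1 - a1) = 0)%R) by lra.
  assert (F1 : (c * (1 - (a1 + d1)) = 0)%R) by lra.
  apply Rmult_integral in F0. apply Rmult_integral in F1.
  assert (a1 = 1)%R by lra. subst a1. assert (d1 = 0)%R by lra. subst d1.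
  assert (a2 = 0)%R by nra. subst a2. assert (d2 = 0)%R by nra. subst d2.
  split; reflexivity. }
destruct Ea as [Ea Ed].
assert (Kt : forall t u, (0 <= t <= 1)%R -> UH u -> k t u = u).
{ intros t u Ht Hu. apply (half_plane_rigidity (k t) Ci u); auto.
  eapply cdiff_eq; [apply Dk|]. rewrite Ea, Ed. ring. }
assert (Off : forall u v, u * u + 1 <> 0 -> Gam u v -> K (u, v) = u).
{ intros u v Hq Hv. apply (slice_identity u (u * u + 1)); auto; [apply Hv|].
  intros t Ht. apply (Kt t u Ht). apply Hv. }
(* At [u = i] the segment towards [u * u + 1] collapses to a point; the value is reached by
   continuity from [u + i t], where it does not. *)
intros u v Hv. destruct (Ceq_dec (u * u + 1) 0) as [Z|N]; [|now apply Off].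
apply Ceq_minus. apply Cmod_le_eps_eq_0. intros eps Pe.
destruct (Gam_open_u u v Hv) as [d1 [Pd1 Hd1]].
destruct (K_diff u v Hv) as (a' & b' & H').
assert (Dc : cdiff (fun w => K (w, v) - w) u (a' * 1 + b' * 0 - 1)).
{ apply cdiff_minus; [|apply cdiff_id].
  apply (cdiff2_comp_curve K (fun w => w) (fun _ => v)); auto using cdiff_id, cdiff_const. }
destruct (cdiff_cont _ _ _ Dc eps Pe) as [d2 [Pd2 Hd2]].
set (t := (Rmin d1 d2 / 2)%R).
assert (Pm : (0 < Rmin d1 d2)%R) by now apply Rmin_pos.
assert (E1 := Rmin_l d1 d2). assert (E2 := Rmin_r d1 d2).
assert (Pt : (0 < t)%R) by (unfold t; lra).
specialize (Hd2 (u + iR t)).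
assert (Mt : Cmod (iR t) = t).
{ unfold iR, Cmod; simpl. replace (0 * (0 * 1) + t * (t * 1))%R with (t ^ 2)%R by ring.
  apply sqrt_pow2; lra. }
replace (u + iR t - u) with (iR t) in Hd2 by ring. rewrite Mt in Hd2.
specialize (Hd2 ltac:(unfold t; lra)).
rewrite Off in Hd2; [| |apply Hd1; unfold t; lra].
- replace (u + iR t - (u + iR t) - (K (u, v) - u)) with (- (K (u, v) - u)) in Hd2 by ring.
  rewrite Cmod_opp in Hd2. exact Hd2.
- intros Z2. destruct Hv as [Hu _]. unfold UH in Hu.
  assert (Z3 : iR t * (2 * u + iR t) = 0).
  { replace (iR t * (2 * u + iR t)) with
      ((u + iR t) * (u + iR t) + 1 - (u * u + 1)) by ring. rewrite Z, Z2. ring. }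
  revert Z3. apply Cmult_neq_0; apply Cmod_gt_0.
  + rewrite Mt; auto.
  + assert (B := Rle_trans _ _ _ (Rmax_r _ _) (Rmax_Cmod (2 * u + iR t))).
    change (snd (2 * u + iR t)) with (2 * snd u + 0 * fst u + t)%R in B.
    rewrite Rabs_pos_eq in B; lra.
Qed.

Section Parallel.

Variable v0 : R.
Hypothesis v0_pos : (0 < v0)%R.
Hypothesis K_v0 : forall u, UH u -> K (u, RtoC v0) = u.

Let phi (y : R) (h : C) : C := K (iR y, RtoC v0 + h).

Lemma iR_UH y : (0 < y)%R -> UH (iR y).
Proof. auto. Qed.

(** [|v0 + h| - Re (v0 + h) <= 2 |h|]. The radius [y^2], large against a fixed [h], is the source of
    the decay in [y] below. *)
Lemma Gam_near y h : (0 < y)%R -> (Cmod h < y ^ 2)%R -> Gam (iR y) (RtoC v0 + h).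
Proof.
intros Py Hh. split; [now apply iR_UH|].
generalize (Cmod_triangle (RtoC v0) h) (re_le_Cmod h) (Rle_abs (- Re h)).
rewrite Rabs_Ropp, Cmod_R, Rabs_pos_eq by lra. unfold Re.
change (fst (RtoC v0 + h)) with (v0 + fst h)%R. unfold iR; simpl snd. lra.
Qed.

Lemma phi_hol y : (0 < y)%R -> hol_disc (phi y) (y ^ 2).
Proof.
intros Py h Hh. destruct (K_diff _ _ (Gam_near y h Py Hh)) as (a & b & H). eexists.
apply (cdiff2_comp_curve K (fun _ => iR y) (fun h => RtoC v0 + h) h a b); auto.
- apply cdiff_const.
- apply cdiff_plus; [apply cdiff_const|apply cdiff_id].
Qed.

Lemma phi_0 y : (0 < y)%R -> phi y 0 = iR y.
Proof. intros Py. unfold phi. rewrite Cplus_0_r. apply K_v0. now apply iR_UH. Qed.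

(** [disc_to_UH_bound] with [m = 0] on the disc of radius [y^2]: the bound is [4 y (|h| / y^2)]. *)
Lemma phi_first_order y h : (0 < y)%R -> (2 * Cmod h <= y ^ 2)%R ->
  (Cmod (phi y h - iR y) <= 4 * Cmod h / y)%R.
Proof.
intros Py Hh. assert (P2 : (0 < y ^ 2)%R) by now apply pow_lt.
assert (U : forall w, (Cmod w < y ^ 2)%R -> UH (phi y w)).
{ intros w Hw. now apply K_UH, Gam_near. }
assert (U0 : UH (phi y 0)) by (rewrite phi_0 by auto; now apply iR_UH).
assert (B := disc_to_UH_bound (phi y) (y ^ 2) 0 h P2 (phi_hol y Py) U).
rewrite phi_0, !pow_1 in B by auto.
replace (4 * Cmod h / y)%R with (4 * y * (Cmod h / y ^ 2))%R by (field; lra).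
assert (G := Cmod_ge_0 h).
apply B; try lra.
destruct (phi_hol y Py 0) as [l Hl]; [rewrite Cmod_0; auto|].
eapply cdiff_big_order.
- cbv beta. rewrite phi_0 by auto. unfold half_to_disc, Cdiv. ring.
- apply (cdiff_comp (phi y) (half_to_disc (iR y))); [exact Hl|].
  apply half_to_disc_cdiff, UH_sub_conj_nz; auto.
Qed.

(** The mean over [h] and [- h] is even in [h], so [disc_to_UH_bound] applies with [m = 1] and gives
    [4 y (|h| / y^2)^2]. *)
Lemma phi_second_order y h : (0 < y)%R -> (2 * Cmod h <= y ^ 2)%R ->
  (Cmod ((phi y h + phi y (- h)) * / 2 - iR y) <= 4 * Cmod h ^ 2 / y ^ 3)%R.
Proof.
intros Py Hh. assert (P2 : (0 < y ^ 2)%R) by now apply pow_lt.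
set (psi := fun h => (phi y h + phi y (- h)) * / 2).
assert (U : forall w, (Cmod w < y ^ 2)%R -> UH (psi w)).
{ intros w Hw. assert (U1 : UH (phi y w)) by now apply K_UH, Gam_near.
  assert (U2 : UH (phi y (- w))) by (apply K_UH, Gam_near; auto; now rewrite Cmod_opp).
  unfold UH, psi in *. rewrite <- (RtoC_inv 2) by lra.
  assert (E := im_scal_r (phi y w + phi y (- w)) (/ 2)). unfold Im in E. rewrite E.
  change (snd (phi y w + phi y (- w))) with (snd (phi y w) + snd (phi y (- w)))%R. lra. }
assert (E0 : psi 0 = iR y).
{ unfold psi. replace (- 0) with (RtoC 0) by ring. rewrite phi_0 by auto. field. }
assert (Hpsi : hol_disc psi (y ^ 2)).
{ intros w Hw. destruct (phi_hol y Py w Hw) as [l Hl].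
  destruct (phi_hol y Py (- w)) as [l' Hl']; [now rewrite Cmod_opp|].
  eexists. apply cdiff_mult; [|apply cdiff_const]. apply cdiff_plus; [exact Hl|].
  apply (cdiff_comp (fun w => - w) (phi y)); [apply cdiff_opp, cdiff_id|exact Hl']. }
assert (U0 : UH (psi 0)) by (rewrite E0; now apply iR_UH).
assert (G := Cmod_ge_0 h).
assert (B := disc_to_UH_bound psi (y ^ 2) 1 h P2 Hpsi U).
rewrite E0 in B. change (snd (iR y)) with y in B.
replace (4 * Cmod h ^ 2 / y ^ 3)%R with (4 * y * (Cmod h ^ 2 / (y ^ 2) ^ 2))%R by (field; lra).
apply B; try lra.
- apply (even_big_order _ (y ^ 2)); auto.
  + intros w Hw. destruct (Hpsi w Hw) as [l Hl]. eexists.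
    apply (cdiff_comp psi (half_to_disc (iR y))); [exact Hl|].
    apply half_to_disc_cdiff, UH_sub_conj_nz; auto.
  + rewrite E0. unfold half_to_disc, Cdiv. ring.
  + intros w _. f_equal. unfold psi. replace (- - w) with w by ring. ring.
- nra.
Qed.

(* For real [v] near [v0], Julia's lemma gives [Im K (u, v) >= Im u]; adding the second-order
   estimate for [v0 + h] and [v0 - h] forces [Im K (i y, v) - y = O(y^-3)], too small for a
   nonzero function of nonnegative imaginary part. *)
Theorem parallel_rigidity u v : Gam u v -> K (u, v) = u.
Proof.
intros Hv.
set (Y := (1 + 2 * v0)%R).
assert (Large : forall y h, (Y <= y)%R -> (0 <= h <= v0)%R -> (0 < y)%R /\
  (2 * Cmod (RtoC h) <= y ^ 2)%R /\ Cmod (RtoC h) = h).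
{ intros y h Hy Hh. unfold Y in Hy. rewrite Cmod_R, Rabs_pos_eq by lra. repeat split; nra. }
set (k := fun (h : R) (w : C) => K (w, RtoC (v0 + h))).
assert (Hk : forall h, (- v0 <= h)%R -> hol_UH (k h)).
{ intros h Hh w Hw. destruct (K_diff w _ (Gam_real w (v0 + h) Hw ltac:(lra))) as (a & b & H).
  eexists. apply (cdiff2_comp_curve K (fun w => w) (fun _ => RtoC (v0 + h)) w a b); auto.
  - apply cdiff_id.
  - apply cdiff_const. }
assert (KU : forall h, (- v0 <= h)%R -> forall w, UH w -> UH (k h w)).
{ intros h Hh w Hw. apply K_UH, Gam_real; auto. lra. }
assert (kphi : forall h y, k h (iR y) = phi y (RtoC h)).
{ intros h y. unfold k, phi. rewrite RtoC_plus. reflexivity. }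
assert (First : forall h y, (- v0 <= h <= v0)%R -> (Y <= y)%R ->
  (Cmod (k h (iR y) - iR y) <= 4 * v0 / y)%R).
{ intros h y Hh Hy. rewrite kphi.
  assert (Mh : (Cmod (RtoC h) <= v0)%R) by (rewrite Cmod_R; apply Rabs_le; lra).
  destruct (Large y v0 Hy ltac:(lra)) as (Py & L1 & L2). rewrite L2 in L1.
  eapply Rle_trans; [apply phi_first_order; auto; lra|].
  apply Rmult_le_compat_r; [left; now apply Rinv_0_lt_compat|]. lra. }
assert (Julia : forall h w, (- v0 <= h <= v0)%R -> UH w -> (snd w <= snd (k h w))%R).
(* Beyond this threshold [4 * v0 / y <= 1]. *)
{ intros h w Hh Hw. apply (julia_at_infinity (k h) (Y + 4 * v0)%R); auto.
  - apply Hk; lra.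
  - apply KU; lra.
  - intros y Hy. eapply Rle_trans; [apply First; auto; lra|].
    apply Rle_div_l; unfold Y in Hy; lra. }
assert (Id : forall h w, (- v0 <= h <= v0)%R -> UH w -> k h w = w).
{ intros h w Hh Hw. apply Ceq_minus.
  (* [4 * v0] serves the first-order bound; [8 * v0 ^ 2] is twice the constant of the second-order
     one. *)
  apply (rigidity_at_infinity (fun w => k h w - w) (4 * v0 + 8 * v0 ^ 2)%R Y); auto.
  - intros x Hx. destruct (Hk h ltac:(lra) x Hx) as [l Hl]. eexists.
    apply cdiff_minus; [exact Hl|apply cdiff_id].
  - intros x Hx. change (snd (k h x - x)) with (snd (k h x) + - snd x)%R.
    generalize (Julia h x Hh Hx). lra.
  - nra.
  - intros y Hy. destruct (Large y v0 Hy ltac:(lra)) as (Py & L1 & L2). rewrite L2 in L1.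
    assert (Mh : (Cmod (RtoC h) <= v0)%R) by (rewrite Cmod_R; apply Rabs_le; lra).
    assert (P3 : (0 < y ^ 3)%R) by now apply pow_lt.
    split.
    + eapply Rle_trans; [apply First; auto; lra|].
      apply Rmult_le_compat_r; [left; now apply Rinv_0_lt_compat|]. nra.
    + assert (S := phi_second_order y (RtoC h) Py ltac:(lra)).
      rewrite <- (RtoC_opp h), <- !kphi in S.
      (* At [- h] the imaginary part is at least [y], so the bound on the mean becomes an upper
         bound at [h] alone. *)
      assert (J := Julia (- h)%R (iR y) ltac:(lra) (iR_UH y Py)).
      assert (S1 := Rle_trans _ _ _ (Rle_trans _ _ _ (Rle_abs _) (Rmax_r _ _))
        (Rle_trans _ _ _ (Rmax_Cmod _) S)).
      assert (E : snd ((k h (iR y) + k (- h)%R (iR y)) * / 2 - iR y) =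
        ((snd (k h (iR y)) + snd (k (- h)%R (iR y))) * / 2 - y)%R).
      { rewrite <- (RtoC_inv 2) by lra.
        assert (I := im_scal_r (k h (iR y) + k (- h)%R (iR y)) (/ 2)). unfold Im in I.
        change (snd ((k h (iR y) + k (- h)%R (iR y)) * RtoC (/ 2))%C + - y =
          (snd (k h (iR y)) + snd (k (- h)%R (iR y))) * / 2 - y)%R. rewrite I.
        change (snd (k h (iR y) + k (- h)%R (iR y))) with
          (snd (k h (iR y)) + snd (k (- h)%R (iR y)))%R. ring. }
      rewrite E in S1. change (snd (iR y)) with y in J.
      change (snd (k h (iR y) - iR y)) with (snd (k h (iR y)) + - y)%R.
      assert (Q : (4 * Cmod (RtoC h) ^ 2 / y ^ 3 <= 4 * v0 ^ 2 / y ^ 3)%R).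
      { apply Rmult_le_compat_r; [left; now apply Rinv_0_lt_compat|].
        generalize (Cmod_ge_0 (RtoC h)). nra. }
      apply Rle_trans with (8 * v0 ^ 2 / y ^ 3)%R.
      * unfold Rdiv in *. lra.
      * apply Rmult_le_compat_r; [left; now apply Rinv_0_lt_compat|]. nra. }
(* [v0 + h] with [- v0 <= h <= 0] fills the segment from 0 to [v0]. *)
apply (slice_identity u (RtoC v0) v); auto.
- apply Hv.
- intros E; apply RtoC_inj in E; lra.
- intros t Ht. rewrite <- RtoC_mult.
  replace (t * v0)%R with (v0 + (t * v0 - v0))%R by ring. apply (Id (t * v0 - v0)%R u); [|apply Hv].
  nra.
Qed.

End Parallel.

End Rigidity.

(** * The half-plane model *)

Definition ex_cdiff2 (F : C * C -> C) (p : C * C) : Prop := exists a b, cdiff2 F p a b.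

Lemma ex_cdiff2_const c p : ex_cdiff2 (fun _ => c) p.
Proof.
exists 0, 0. intros eps He; exists 1%R; split; [lra|]. intros q _ _.
replace (c - c - (0 * (fst q - fst p) + 0 * (snd q - snd p))) with (RtoC 0) by ring.
rewrite Cmod_0. generalize (Cmod_ge_0 (fst q - fst p)) (Cmod_ge_0 (snd q - snd p)); nra.
Qed.

Lemma ex_cdiff2_fst p : ex_cdiff2 fst p.
Proof. exists 1, 0. apply cdiff2_fst. Qed.

Lemma ex_cdiff2_snd p : ex_cdiff2 snd p.
Proof.
exists 0, 1. intros eps He; exists 1%R; split; [lra|]. intros q _ _.
replace (snd q - snd p - (0 * (fst q - fst p) + 1 * (snd q - snd p))) with (RtoC 0) by ring.
rewrite Cmod_0. generalize (Cmod_ge_0 (fst q - fst p)) (Cmod_ge_0 (snd q - snd p)); nra.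
Qed.

Lemma ex_cdiff2_comp2 F G1 G2 p : ex_cdiff2 F (G1 p, G2 p) -> ex_cdiff2 G1 p -> ex_cdiff2 G2 p ->
  ex_cdiff2 (fun q => F (G1 q, G2 q)) p.
Proof.
intros (a & b & HF) (a1 & b1 & H1) (a2 & b2 & H2). eexists; eexists.
eapply cdiff2_comp2; eauto.
Qed.

Lemma ex_cdiff2_comp f G p m : cdiff f (G p) m -> ex_cdiff2 G p -> ex_cdiff2 (fun q => f (G q)) p.
Proof. intros Hf (a & b & HG). eexists; eexists. eapply cdiff2_comp; eauto. Qed.

Lemma ex_cdiff2_plus F G p : ex_cdiff2 F p -> ex_cdiff2 G p -> ex_cdiff2 (fun q => F q + G q) p.
Proof.
intros HF HG. apply (ex_cdiff2_comp2 (fun q => fst q + snd q) F G); auto.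
eexists; eexists; apply cdiff2_plus.
Qed.

Lemma ex_cdiff2_mult F G p : ex_cdiff2 F p -> ex_cdiff2 G p -> ex_cdiff2 (fun q => F q * G q) p.
Proof.
intros HF HG. apply (ex_cdiff2_comp2 (fun q => fst q * snd q) F G); auto.
eexists; eexists; apply cdiff2_mult.
Qed.

Lemma ex_cdiff2_opp F p : ex_cdiff2 F p -> ex_cdiff2 (fun q => - F q) p.
Proof.
intros HF. eapply (ex_cdiff2_comp (fun w => - w)); auto. apply cdiff_opp, cdiff_id.
Qed.

Lemma ex_cdiff2_minus F G p : ex_cdiff2 F p -> ex_cdiff2 G p -> ex_cdiff2 (fun q => F q - G q) p.
Proof. intros HF HG. apply ex_cdiff2_plus; auto using ex_cdiff2_opp. Qed.

Lemma ex_cdiff2_div F G p : G p <> RtoC 0 -> ex_cdiff2 F p -> ex_cdiff2 G p ->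
  ex_cdiff2 (fun q => F q / G q) p.
Proof.
intros H0 HF HG. apply ex_cdiff2_mult; auto.
eapply (ex_cdiff2_comp Cinv); auto. now apply cdiff_Cinv.
Qed.

(** [Cminus] and [Cdiv] unfold to a sum and a product, so their own lemmas are tried before
    [ex_cdiff2_plus] and [ex_cdiff2_mult]. *)
Ltac ex_cdiff2_solve :=
  repeat first [ apply ex_cdiff2_const | apply ex_cdiff2_fst | apply ex_cdiff2_snd
    | apply ex_cdiff2_minus | apply ex_cdiff2_plus | apply ex_cdiff2_div
    | apply ex_cdiff2_mult | apply ex_cdiff2_opp ].

Lemma complex_sqrt (v : C) : exists d : C, d * d = v.
Proof.
destruct v as [a b]. set (m := Cmod (a, b)).
assert (S := Cmod_sq (a, b)). fold m in S. simpl fst in S; simpl snd in S.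
assert (Gm : (0 <= m)%R) by apply Cmod_ge_0.
assert (Ha : (Rabs a <= m)%R) by exact (re_le_Cmod (a, b)).
apply Rabs_le_between in Ha.
set (x := sqrt ((m + a) / 2)). set (y := sqrt ((m - a) / 2)).
assert (Hx : (x * x = (m + a) / 2)%R) by (apply sqrt_sqrt; lra).
assert (Hy : (y * y = (m - a) / 2)%R) by (apply sqrt_sqrt; lra).
assert (Hxy : (x * y = Rabs b / 2)%R).
{ unfold x, y. rewrite <- sqrt_mult by lra.
  replace ((m + a) / 2 * ((m - a) / 2))%R with (Rsqr (b / 2)).
  - rewrite sqrt_Rsqr_abs. unfold Rdiv. rewrite Rabs_mult, (Rabs_pos_eq (/ 2)) by lra. reflexivity.
  - unfold Rsqr. replace ((m + a) / 2 * ((m - a) / 2))%R with ((m ^ 2 - a ^ 2) / 4)%R by field.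
    rewrite S. field. }
destruct (Rle_lt_dec 0 b) as [L|L].
- exists (x, y). unfold Cmult; simpl. rewrite Rabs_pos_eq in Hxy by auto. f_equal; lra.
- exists (x, (- y)%R). unfold Cmult; simpl. rewrite Rabs_left in Hxy by auto. f_equal; lra.
Qed.

Lemma Gam_of_pair u d : UH (u + d) -> UH (u - d) -> Gam u (d * d).
Proof.
unfold UH, Gam. intros H1 H2. rewrite Cmod_mult.
change (snd (u + d)) with (snd u + snd d)%R in H1.
change (snd (u - d)) with (snd u + - snd d)%R in H2.
replace (Cmod d * Cmod d)%R with (Cmod d ^ 2)%R by ring. rewrite Cmod_sq.
change (fst (d * d)) with (fst d * fst d - snd d * snd d)%R. unfold UH. split; nra.
Qed.

Lemma pair_of_Gam u v : Gam u v -> exists d, v = d * d /\ UH (u + d) /\ UH (u - d).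
Proof.
intros [Hu H]. destruct (complex_sqrt v) as [d Hd]. exists d. split; auto.
rewrite <- Hd, Cmod_mult in H. replace (Cmod d * Cmod d)%R with (Cmod d ^ 2)%R in H by ring.
rewrite Cmod_sq in H. change (fst (d * d)) with (fst d * fst d - snd d * snd d)%R in H.
unfold UH in *. change (snd (u + d)) with (snd u + snd d)%R.
change (snd (u - d)) with (snd u + - snd d)%R. split; nra.
Qed.

(* For [|zt| = 1], [cay zt z = i (zt + z) / (zt - z)] is the Cayley transform sending [zt] to infinity.
   [Psi zt (u, v)] is the point [pi (z, w)] whose Cayley transforms [Z], [W] have mean [u] and
   [((Z - W) / 2)^2 = v]. *)
Definition cay (zt z : C) : C := disc_to_half Ci (z / zt).
Definition icay (zt u : C) : C := zt * half_to_disc Ci u.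

Definition Psi (zt : C) (q : C * C) : C * C :=
  let (u, v) := q in
  (zt * (2 * (u * u + 1 - v)) / ((u + Ci) * (u + Ci) - v),
   zt * zt * ((u - Ci) * (u - Ci) - v) / ((u + Ci) * (u + Ci) - v)).

Lemma UH_Ci : UH Ci.
Proof. unfold UH; simpl; lra. Qed.

Lemma Cconj_Ci : Cconj Ci = - Ci.
Proof. unfold Cconj, Ci, Copp; simpl. f_equal; ring. Qed.

Lemma UH_plus_Ci u : UH u -> u + Ci <> 0.
Proof.
intros Hu. generalize (UH_sub_conj_nz u Ci Hu UH_Ci). rewrite Cconj_Ci.
replace (u - - Ci) with (u + Ci) by ring. auto.
Qed.

Lemma icay_eq zt u : UH u -> icay zt u = zt * (u - Ci) / (u + Ci).
Proof.
intros Hu. unfold icay, half_to_disc. rewrite Cconj_Ci. assert (N := UH_plus_Ci u Hu).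
field. auto.
Qed.

Lemma Ci_sq : Ci * Ci = - (1).
Proof. unfold Ci, Cmult, Copp, RtoC; simpl. f_equal; ring. Qed.

Section Model.

Variable zt : C.
Hypothesis zt_1 : Cmod zt = 1%R.

Lemma zt_nz : zt <> 0.
Proof. apply Cmod_gt_0. rewrite zt_1; lra. Qed.

Lemma zt_div_mod z : Cmod (z / zt) = Cmod z.
Proof. rewrite Cmod_div, zt_1 by apply zt_nz. field. Qed.

Lemma cay_UH z : unit_disc z -> UH (cay zt z).
Proof. intros Hz. apply disc_to_half_UH; [apply UH_Ci|]. rewrite zt_div_mod; auto. Qed.

Lemma icay_disc u : UH u -> unit_disc (icay zt u).
Proof.
intros Hu. unfold unit_disc, icay. rewrite Cmod_mult, zt_1, Rmult_1_l.
apply half_to_disc_lt; auto using UH_Ci.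
Qed.

Lemma cay_icay u : UH u -> cay zt (icay zt u) = u.
Proof.
intros Hu. unfold cay, icay.
replace (zt * half_to_disc Ci u / zt) with (half_to_disc Ci u) by (field; apply zt_nz).
apply disc_to_half_inv; auto using UH_Ci.
Qed.

Lemma icay_cay z : unit_disc z -> icay zt (cay zt z) = z.
Proof.
intros Hz. unfold cay, icay. rewrite half_to_disc_inv.
- field. apply zt_nz.
- apply UH_Ci.
- rewrite zt_div_mod; auto.
Qed.

Lemma zt_sub_nz z : unit_disc z -> zt - z <> 0.
Proof.
intros Hz E. assert (K : zt = z) by (apply Ceq_minus; auto). unfold unit_disc in Hz.
rewrite <- K, zt_1 in Hz. lra.
Qed.

Lemma cay_eq z : unit_disc z -> cay zt z = Ci * (zt + z) / (zt - z).
Proof.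
intros Hz. unfold cay, disc_to_half. rewrite Cconj_Ci. assert (N := zt_sub_nz z Hz).
assert (N2 := zt_nz). field. auto.
Qed.

Lemma cay_cdiff z : unit_disc z -> exists l, cdiff (cay zt) z l.
Proof.
intros Hz. eexists. apply (cdiff_comp (fun z => z / zt) (disc_to_half Ci)).
- apply cdiff_mult; [apply cdiff_id|apply cdiff_const].
- apply disc_to_half_cdiff. rewrite zt_div_mod; auto.
Qed.

Lemma icay_cdiff u : UH u -> exists l, cdiff (icay zt) u l.
Proof.
intros Hu. eexists. apply cdiff_mult; [apply cdiff_const|].
apply half_to_disc_cdiff. apply UH_sub_conj_nz; auto using UH_Ci.
Qed.

Lemma Psi_sympi u d : UH (u + d) -> UH (u - d) ->
  Psi zt (u, d * d) = sympi (icay zt (u + d), icay zt (u - d)).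
Proof.
intros H1 H2. unfold sympi; simpl fst; simpl snd. rewrite !icay_eq by auto.
assert (N1 := UH_plus_Ci _ H1). assert (N2 := UH_plus_Ci _ H2).
assert (N3 : (u + Ci) * (u + Ci) - d * d <> 0).
{ replace ((u + Ci) * (u + Ci) - d * d) with ((u + d + Ci) * (u - d + Ci)) by ring.
  now apply Cmult_neq_0. }
unfold Psi. f_equal.
- replace (u * u + 1 - d * d) with (u * u - d * d - Ci * Ci) by (rewrite Ci_sq; ring). field; auto.
- field; auto.
Qed.

Lemma Psi_den u v : Gam u v -> (u + Ci) * (u + Ci) - v <> 0.
Proof.
intros H. destruct (pair_of_Gam u v H) as (d & -> & H1 & H2).
replace ((u + Ci) * (u + Ci) - d * d) with ((u + d + Ci) * (u - d + Ci)) by ring.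
apply Cmult_neq_0; now apply UH_plus_Ci.
Qed.

Lemma Psi_G2 u v : Gam u v -> G2 (Psi zt (u, v)).
Proof.
intros H. destruct (pair_of_Gam u v H) as (d & -> & H1 & H2). rewrite Psi_sympi by auto.
exists (icay zt (u + d), icay zt (u - d)). simpl. auto using icay_disc.
Qed.

Lemma sympi_Psi z w : unit_disc z -> unit_disc w ->
  let u := (cay zt z + cay zt w) * / 2 in let d := (cay zt z - cay zt w) * / 2 in
  Gam u (d * d) /\ sympi (z, w) = Psi zt (u, d * d).
Proof.
intros Hz Hw u d. assert (T := two_nz).
assert (E1 : u + d = cay zt z) by (unfold u, d; field; auto).
assert (E2 : u - d = cay zt w) by (unfold u, d; field; auto).
assert (U1 : UH (u + d)) by (rewrite E1; now apply cay_UH).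
assert (U2 : UH (u - d)) by (rewrite E2; now apply cay_UH).
split; [now apply Gam_of_pair|]. rewrite Psi_sympi, E1, E2, !icay_cay; auto.
Qed.

Definition model (F : C * C -> C) (q : C * C) : C := cay zt (F (Psi zt q)).

Lemma model_diff F : holomorphic2 G2 F -> (forall p, G2 p -> unit_disc (F p)) ->
  forall u v, Gam u v -> exists a b, cdiff2 (model F) (u, v) a b.
Proof.
intros HF FU u v H. assert (G := Psi_G2 u v H).
destruct (cay_cdiff _ (FU _ G)) as [l Hl].
assert (D := Psi_den u v H).
assert (EF : ex_cdiff2 F (Psi zt (u, v))) by (apply ex_filterdiff_cdiff2; auto).
apply (ex_cdiff2_comp (cay zt) (fun q => F (Psi zt q)) (u, v) l Hl).
(* [Psi] matches on its argument; the chain rule is applied to the same map written with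
   projections. *)
assert (X : ex_cdiff2 (fun q => F (zt * (2 * (fst q * fst q + 1 - snd q)) / ((fst q + Ci) * (fst q + Ci) - snd q),
   zt * zt * ((fst q - Ci) * (fst q - Ci) - snd q) / ((fst q + Ci) * (fst q + Ci) - snd q))) (u, v)).
{ apply (ex_cdiff2_comp2 F
    (fun q => zt * (2 * (fst q * fst q + 1 - snd q)) / ((fst q + Ci) * (fst q + Ci) - snd q))
    (fun q => zt * zt * ((fst q - Ci) * (fst q - Ci) - snd q) / ((fst q + Ci) * (fst q + Ci) - snd q))).
  - exact EF.
  - ex_cdiff2_solve; exact D.
  - ex_cdiff2_solve; exact D. }
destruct X as (a & b & X). exists a, b. intros eps He.
destruct (X eps He) as [d [Pd Hd]]. exists d; split; auto. intros [q1 q2]. apply Hd.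
Qed.

Lemma model_UH F : (forall p, G2 p -> unit_disc (F p)) -> forall u v, Gam u v -> UH (model F (u, v)).
Proof. intros FU u v H. now apply cay_UH, FU, Psi_G2. Qed.

(** [Psi zt] maps onto [G2] by [sympi_Psi] and [cay zt] is injective on the disc, so equal models
    force equal left inverses. *)
Lemma unique_of_model f (k : C -> C -> C) : (exists F, is_left_inverse f F) ->
  (forall F, is_left_inverse f F -> forall u v, Gam u v -> model F (u, v) = k u v) ->
  has_unique_left_inverse f.
Proof.
intros Ex H. split; auto. intros F1 F2 H1 H2 p (l & Hz & Hw & ->). destruct l as [z w].
simpl in Hz, Hw.
destruct (sympi_Psi z w Hz Hw) as [G E]. rewrite E.
set (u := (cay zt z + cay zt w) * / 2) in *. set (v := _ * _) in G, E |- *.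
assert (GP := Psi_G2 u v G).
destruct H1 as (A1 & B1 & C1) eqn:E1. destruct H2 as (A2 & B2 & C2) eqn:E2.
rewrite <- (icay_cay (F1 _) (B1 _ GP)), <- (icay_cay (F2 _) (B2 _ GP)). f_equal.
transitivity (k u v); [|symmetry]; apply H; auto; repeat split; auto.
Qed.

End Model.

(** * Left inverses of graphs of half-plane affine maps *)

Lemma UH_plus u v : UH u -> UH v -> UH (u + v).
Proof. unfold UH. change (snd (u + v)) with (snd u + snd v)%R. lra. Qed.

Lemma UH_plus_R u (x : R) : UH u -> UH (u + RtoC x).
Proof. unfold UH. change (snd (u + RtoC x)) with (snd u + 0)%R. lra. Qed.

Lemma UH_minus_R u (x : R) : UH u -> UH (u - RtoC x).
Proof. unfold UH. change (snd (u - RtoC x)) with (snd u + - 0)%R. lra. Qed.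

Lemma UH_scal (k : R) u : (0 < k)%R -> UH u -> UH (RtoC k * u).
Proof.
unfold UH. intros Hk Hu. generalize (im_scal_l k u). unfold Im. intros ->.
now apply Rmult_lt_0_compat.
Qed.

Lemma UH_nz u : UH u -> u <> 0.
Proof. unfold UH. intros H E. rewrite E in H. simpl in H. lra. Qed.

Lemma UH_neg_inv u : UH u -> UH (- / u).
Proof.
intros Hu. assert (N := UH_nz u Hu). assert (P : (0 < Cmod u)%R) by now apply Cmod_gt_0.
assert (S := Cmod_sq u). destruct u as [x y]. unfold UH, Cinv, Copp in *; simpl in *.
assert (Q : (0 < x * (x * 1) + y * (y * 1))%R) by (rewrite <- S; nra).
replace (- (- y / (x * (x * 1) + y * (y * 1))))%R with (y / (x * (x * 1) + y * (y * 1)))%R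
  by (field; lra).
now apply Rdiv_lt_0_compat.
Qed.

Section AffineGraph.

Variable zt : C.
Hypothesis zt_1 : Cmod zt = 1%R.

(** With [Z], [W] the Cayley transforms of [z], [w] at [zt], this and [cay_prod] are [(Z + W) / 2]
    and [Z W] as rational functions of [z + w] and [z w]; the denominator is [(zt - z) (zt - w)]. *)
Definition cay_mean (p : C * C) : C :=
  Ci * (zt * zt - snd p) / (zt * zt - zt * fst p + snd p).

Definition cay_prod (p : C * C) : C :=
  - (zt * zt + zt * fst p + snd p) / (zt * zt - zt * fst p + snd p).

Lemma cay_den z w : unit_disc z -> unit_disc w ->
  zt * zt - zt * fst (sympi (z, w)) + snd (sympi (z, w)) <> 0.
Proof.
intros Hz Hw. unfold sympi; simpl.
replace (zt * zt - zt * (z + w) + z * w) with ((zt - z) * (zt - w)) by ring.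
apply Cmult_neq_0; now apply zt_sub_nz.
Qed.

Lemma cay_mean_sympi z w : unit_disc z -> unit_disc w ->
  cay_mean (sympi (z, w)) = (cay zt z + cay zt w) * / 2.
Proof.
intros Hz Hw. assert (D := cay_den z w Hz Hw). unfold cay_mean.
rewrite !(cay_eq zt zt_1) by auto. unfold sympi in *; simpl in *.
assert (N1 := zt_sub_nz zt zt_1 z Hz). assert (N2 := zt_sub_nz zt zt_1 w Hw).
field. auto.
Qed.

Lemma cay_prod_sympi z w : unit_disc z -> unit_disc w ->
  cay_prod (sympi (z, w)) = cay zt z * cay zt w.
Proof.
intros Hz Hw. assert (D := cay_den z w Hz Hw). unfold cay_prod.
rewrite !(cay_eq zt zt_1) by auto. unfold sympi in *; simpl in *.
assert (N1 := zt_sub_nz zt zt_1 z Hz). assert (N2 := zt_sub_nz zt zt_1 w Hw).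
replace (Ci * (zt + z) / (zt - z) * (Ci * (zt + w) / (zt - w))) with
  ((Ci * Ci) * ((zt + z) * (zt + w)) / ((zt - z) * (zt - w))) by (field; auto).
rewrite Ci_sq. field. auto.
Qed.

Lemma ex_cdiff2_cay_mean z w : unit_disc z -> unit_disc w -> ex_cdiff2 cay_mean (sympi (z, w)).
Proof. intros Hz Hw. unfold cay_mean. ex_cdiff2_solve. now apply cay_den. Qed.

Lemma ex_cdiff2_cay_prod z w : unit_disc z -> unit_disc w -> ex_cdiff2 cay_prod (sympi (z, w)).
Proof. intros Hz Hw. unfold cay_prod. ex_cdiff2_solve. now apply cay_den. Qed.

Lemma left_inverse_of_model f (h : C * C -> C) :
  (forall z w, unit_disc z -> unit_disc w ->
     ex_cdiff2 h (sympi (z, w)) /\ UH (h (sympi (z, w)))) ->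
  (forall z, unit_disc z -> h (f z) = cay zt z) ->
  is_left_inverse f (fun p => icay zt (h p)).
Proof.
intros Hh Hf. repeat split.
- intros p ([z w] & Hz & Hw & ->). destruct (Hh z w Hz Hw) as [D U].
  apply ex_filterdiff_cdiff2. destruct (icay_cdiff zt _ U) as [l Hl].
  exact (ex_cdiff2_comp (icay zt) h _ l Hl D).
- intros p ([z w] & Hz & Hw & ->). apply icay_disc; auto. now apply Hh.
- intros z Hz. rewrite Hf by auto. now apply icay_cay.
Qed.

Variables (f : C -> C * C) (a : C -> C) (k tau : R).
Hypothesis k_pos : (0 < k)%R.
Hypothesis a_disc : forall z, unit_disc z -> unit_disc (a z).
Hypothesis a_affine : forall z, unit_disc z -> cay zt (a z) = RtoC k * cay zt z + RtoC tau.
Hypothesis f_graph : forall z, unit_disc z -> f z = sympi (z, a z).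

(* The Cayley transforms of the two coordinates of [f z] are [Z] and [k Z + tau]; subtracting
   [tau] from their sum and dividing by [1 + k] recovers [Z]. *)
Definition arithmetic_inverse (p : C * C) : C :=
  icay zt ((2 * cay_mean p - RtoC tau) / RtoC (1 + k)).

Lemma one_plus_k_nz : RtoC (1 + k) <> 0.
Proof. intros E; apply RtoC_inj in E; lra. Qed.

Lemma arithmetic_left_inverse : is_left_inverse f arithmetic_inverse.
Proof.
assert (N := one_plus_k_nz). assert (T := two_nz).
apply (left_inverse_of_model f (fun p => (2 * cay_mean p - RtoC tau) / RtoC (1 + k))).
- intros z w Hz Hw. split.
  + apply ex_cdiff2_div; auto using ex_cdiff2_const. apply ex_cdiff2_minus; auto using ex_cdiff2_const.
    apply ex_cdiff2_mult; auto using ex_cdiff2_const, ex_cdiff2_cay_mean.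
  + rewrite cay_mean_sympi by auto.
    replace ((2 * ((cay zt z + cay zt w) * / 2) - RtoC tau) / RtoC (1 + k)) with
      (RtoC (/ (1 + k)) * (cay zt z + cay zt w - RtoC tau)) by (rewrite RtoC_inv by lra; field; auto).
    apply UH_scal; [apply Rinv_0_lt_compat; lra|]. apply UH_minus_R, UH_plus; now apply cay_UH.
- intros z Hz. rewrite f_graph, cay_mean_sympi, a_affine by auto.
  rewrite RtoC_plus in *. field. auto.
Qed.

(** The pair [Z], [Z + tau] has mean [u = Z + tau / 2] and [v = tau^2 / 4 > 0], so the model shifted
    by [tau / 2] is [u] on this disc and [parallel_rigidity] applies. *)
Lemma graph_unique : k = 1%R -> tau <> 0%R -> has_unique_left_inverse f.
Proof.
intros Hk Ht. assert (T := two_nz).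
apply (unique_of_model zt zt_1 f (fun u _ => u - RtoC (tau / 2))).
{ eexists; apply arithmetic_left_inverse. }
intros F (HF & FU & Ff) u v Hv.
apply Ceq_minus.
assert (R0 := parallel_rigidity (fun q => model zt F q + RtoC (tau / 2))).
assert (E : model zt F (u, v) + RtoC (tau / 2) = u).
{ refine (R0 _ _ (tau ^ 2 / 4)%R _ _ u v Hv); clear R0.
  - intros u' v' H. destruct (model_diff zt zt_1 F HF FU u' v' H) as (b & c & D).
    exact (ex_cdiff2_plus (model zt F) (fun _ => RtoC (tau / 2)) (u', v')
      (ex_intro _ b (ex_intro _ c D)) (ex_cdiff2_const _ _)).
  - intros u' v' H. apply UH_plus_R. now apply model_UH.
  - assert (0 < tau ^ 2)%R by (apply pow2_gt_0; auto). lra.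
  - intros w Hw. set (z := icay zt (w - RtoC (tau / 2))).
    assert (Hw' : UH (w - RtoC (tau / 2))) by now apply UH_minus_R.
    assert (Hz : unit_disc z) by now apply icay_disc.
    assert (Cz : cay zt z = w - RtoC (tau / 2)) by now apply cay_icay.
    destruct (sympi_Psi zt zt_1 z (a z) Hz (a_disc z Hz)) as [_ E].
    assert (Fz := Ff z Hz). rewrite f_graph, E, a_affine, Cz, Hk in Fz by auto.
    assert (Et : RtoC (tau / 2) = RtoC tau / 2) by (rewrite RtoC_div by lra; reflexivity).
    replace ((w - RtoC (tau / 2) + (RtoC 1 * (w - RtoC (tau / 2)) + RtoC tau)) * / 2) with w in Fz
      by (rewrite Et; field; auto).
    replace ((w - RtoC (tau / 2) - (RtoC 1 * (w - RtoC (tau / 2)) + RtoC tau)) * / 2 *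
      ((w - RtoC (tau / 2) - (RtoC 1 * (w - RtoC (tau / 2)) + RtoC tau)) * / 2)) with
      (RtoC (tau ^ 2 / 4)) in Fz.
    2:{ rewrite Et, RtoC_div, RtoC_pow by lra. field; auto. }
    unfold model. rewrite Fz, Cz. ring. }
replace (model zt F (u, v)) with (model zt F (u, v) + RtoC (tau / 2) - RtoC (tau / 2)) by ring.
rewrite E. ring.
Qed.

(* Recentred at its fixed point [x0], the affine map is [Z |-> k Z], so [Z] is also recovered from
   [Z W / (Z + W)]. *)
Lemma graph_not_unique : k <> 1%R -> ~ has_unique_left_inverse f.
Proof.
intros Hk [_ Uq]. assert (N := one_plus_k_nz). assert (T := two_nz).
assert (Nk : RtoC k <> 0) by (intros E; apply RtoC_inj in E; lra).
set (x0 := (tau / (1 - k))%R).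
assert (Hx0 : tau = (x0 * (1 - k))%R) by (unfold x0; field; lra).
set (h := fun p => RtoC x0 + RtoC ((1 + k) / k) *
  ((cay_prod p - 2 * cay_mean p * RtoC x0 + RtoC x0 * RtoC x0) / (2 * cay_mean p - 2 * RtoC x0))).
assert (Hh : forall z w, unit_disc z -> unit_disc w -> h (sympi (z, w)) =
  RtoC x0 + RtoC ((1 + k) / k) * ((cay zt z - RtoC x0) * (cay zt w - RtoC x0) /
    ((cay zt z - RtoC x0) + (cay zt w - RtoC x0)))).
{ intros z w Hz Hw. unfold h. rewrite cay_mean_sympi, cay_prod_sympi by auto.
  assert (D := UH_nz _ (UH_plus _ _ (UH_minus_R _ x0 (cay_UH zt zt_1 z Hz))
    (UH_minus_R _ x0 (cay_UH zt zt_1 w Hw)))).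
  set (Z := cay zt z) in *. set (W := cay zt w) in *.
  replace (2 * ((Z + W) * / 2) - 2 * RtoC x0) with (Z - RtoC x0 + (W - RtoC x0)) by (field; auto).
  replace (Z * W - 2 * ((Z + W) * / 2) * RtoC x0 + RtoC x0 * RtoC x0)
    with ((Z - RtoC x0) * (W - RtoC x0)) by (field; auto).
  reflexivity. }
assert (LI2 : is_left_inverse f (fun p => icay zt (h p))).
{ apply (left_inverse_of_model f h).
  - intros z w Hz Hw.
    assert (U1 := UH_minus_R _ x0 (cay_UH zt zt_1 z Hz)).
    assert (U2 := UH_minus_R _ x0 (cay_UH zt zt_1 w Hw)).
    assert (D := UH_nz _ (UH_plus _ _ U1 U2)).
    assert (N1 := UH_nz _ U1). assert (N2 := UH_nz _ U2). split.
    + assert (M := ex_cdiff2_cay_mean z w Hz Hw). assert (P := ex_cdiff2_cay_prod z w Hz Hw).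
      unfold h. repeat first [apply ex_cdiff2_const | exact M | exact P | apply ex_cdiff2_minus
        | apply ex_cdiff2_plus | apply ex_cdiff2_div | apply ex_cdiff2_mult].
      rewrite cay_mean_sympi by auto. intros E. apply D. rewrite <- E. field; auto.
    + rewrite Hh by auto.
      set (Z := cay zt z - RtoC x0) in *. set (W := cay zt w - RtoC x0) in *.
      rewrite Cplus_comm. apply UH_plus_R. apply UH_scal; [apply Rdiv_lt_0_compat; lra|].
      assert (U3 := UH_plus _ _ (UH_neg_inv _ U1) (UH_neg_inv _ U2)).
      (* [u |-> - 1 / u] preserves the upper half-plane. *)
      replace (Z * W / (Z + W)) with (- / (- / Z + - / W)); [now apply UH_neg_inv|].
      assert (D3 := UH_nz _ U3). field. repeat split; auto.
      intros E. apply D. match type of E with ?x = _ => replace (Z + W) with (- x) by ring end.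
      rewrite E. ring.
  - intros z Hz. rewrite f_graph, Hh, a_affine by auto. rewrite Hx0, RtoC_mult, RtoC_minus.
    assert (U1 := UH_nz _ (UH_minus_R _ x0 (cay_UH zt zt_1 z Hz))).
    set (Z := cay zt z) in *.
    replace (RtoC k * Z + RtoC x0 * (1 - RtoC k) - RtoC x0) with (RtoC k * (Z - RtoC x0)) by ring.
    rewrite RtoC_div, RtoC_plus by lra. rewrite RtoC_plus in N.
    replace (Z - RtoC x0 + RtoC k * (Z - RtoC x0)) with ((1 + RtoC k) * (Z - RtoC x0)) by ring.
    field. auto. }
(* At [Z = W = x0 + i] the two inverses give [x0 + 2 i / (1 + k)] and [x0 + i (1 + k) / (2 k)],
   which agree only if [(1 - k)^2 = 0]. *)
set (q := RtoC x0 + Ci).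
assert (Uq' : UH q) by (unfold UH, q; simpl; lra).
set (z := icay zt q). assert (Hz : unit_disc z) by now apply icay_disc.
assert (E := Uq _ _ arithmetic_left_inverse LI2 (sympi (z, z))
  (ex_intro _ (z, z) (conj Hz (conj Hz eq_refl)))).
cbv beta in E. unfold arithmetic_inverse in E.
assert (Cz : cay zt z = q) by now apply cay_icay.
rewrite Hh, cay_mean_sympi, Cz in E by auto.
assert (Z1 : q - RtoC x0 = Ci) by (unfold q; ring). rewrite Z1 in E.
assert (X1 : (2 * ((q + q) * / 2) - RtoC tau) / RtoC (1 + k) = RtoC x0 + RtoC (2 / (1 + k)) * Ci).
{ unfold q. rewrite Hx0, RtoC_mult, RtoC_minus, RtoC_div, RtoC_plus by lra.
  rewrite RtoC_plus in N. field. auto. }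
assert (X2 : RtoC x0 + RtoC ((1 + k) / k) * (Ci * Ci / (Ci + Ci)) =
  RtoC x0 + RtoC ((1 + k) / (2 * k)) * Ci).
{ rewrite !RtoC_div, RtoC_plus, RtoC_mult by lra. field. repeat split; auto using Ci_nz.
  intros K. apply (Cmult_neq_0 2 Ci T Ci_nz). rewrite <- K. ring. }
rewrite X1, X2 in E. apply (f_equal (cay zt)) in E.
assert (Pk : (0 < 2 / (1 + k))%R) by (apply Rdiv_lt_0_compat; lra).
assert (Pk' : (0 < (1 + k) / (2 * k))%R) by (apply Rdiv_lt_0_compat; lra).
rewrite !cay_icay in E; auto.
- apply (f_equal snd) in E. simpl in E.
  assert (E2 : (2 / (1 + k) = (1 + k) / (2 * k))%R) by lra.
  apply Hk. apply (f_equal (fun x => x * (1 + k) * (2 * k))%R) in E2.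
  field_simplify in E2; try lra. nra.
- rewrite Cplus_comm. now apply UH_plus_R, UH_scal, UH_Ci.
- rewrite Cplus_comm. now apply UH_plus_R, UH_scal, UH_Ci.
Qed.

End AffineGraph.

(** * Automorphisms of the disc *)

Definition mobius (b z : C) : C := (z - b) / (1 - Cconj b * z).

Lemma mobius_den (b z : C) : unit_disc b -> unit_disc z -> 1 - Cconj b * z <> 0.
Proof.
unfold unit_disc. intros Hb Hz. apply disc_neq_1. rewrite Cmod_mult, Cmod_conj.
generalize (Cmod_ge_0 b) (Cmod_ge_0 z). nra.
Qed.

Lemma mobius_identity (b z : C) :
  (Cmod (1 - Cconj b * z) ^ 2 - Cmod (z - b) ^ 2 = (1 - Cmod z ^ 2) * (1 - Cmod b ^ 2))%R.
Proof. rewrite !Cmod_sq. destruct b, z; simpl. ring. Qed.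

Lemma mobius_disc (b z : C) : unit_disc b -> unit_disc z -> unit_disc (mobius b z).
Proof.
intros Hb Hz. assert (N := mobius_den b z Hb Hz). unfold unit_disc, mobius in *.
rewrite Cmod_div by auto. assert (P : (0 < Cmod (1 - Cconj b * z))%R) by now apply Cmod_gt_0.
apply (proj2 (Rlt_div_l _ _ _ P)). rewrite Rmult_1_l.
assert (I := mobius_identity b z). assert (Gb := Cmod_ge_0 b). assert (Gz := Cmod_ge_0 z).
assert (Q : (0 < (1 - Cmod z ^ 2) * (1 - Cmod b ^ 2))%R) by (apply Rmult_lt_0_compat; nra).
generalize (Cmod_ge_0 (z - b)). nra.
Qed.

Lemma unit_disc_opp b : unit_disc b -> unit_disc (- b).
Proof. unfold unit_disc. now rewrite Cmod_opp. Qed.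

Lemma mobius_inv (b z : C) : unit_disc b -> unit_disc z -> mobius (- b) (mobius b z) = z.
Proof.
intros Hb Hz. assert (N := mobius_den b z Hb Hz). assert (Nb := mobius_den b b Hb Hb).
unfold mobius. rewrite Copp_conj. field. split; auto.
intros E; apply Nb; rewrite <- E; ring.
Qed.

Lemma mobius_cdiff (b z : C) : unit_disc b -> unit_disc z -> exists l, cdiff (mobius b) z l.
Proof.
intros Hb Hz. eexists. apply cdiff_div.
- now apply mobius_den.
- apply cdiff_minus; [apply cdiff_id|apply cdiff_const].
- apply cdiff_minus; [apply cdiff_const|]. apply cdiff_mult; [apply cdiff_const|apply cdiff_id].
Qed.

Lemma holomorphic1_cdiff (D : C -> Prop) (f : C -> C) :
  holomorphic1 (V := C_NormedModule) D f -> forall z, D z -> exists l, cdiff f z l.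
Proof. intros H z Hz. destruct (H z Hz) as [l Hl]. exists l. now apply cdiff_is_derive. Qed.

Lemma unit_disc_0 : unit_disc 0.
Proof. unfold unit_disc. rewrite Cmod_0. lra. Qed.

(** The derivatives of [g] and [h] at 0 have modulus at most 1 and product 1, so [|l| = 1] and the
    equality case of Schwarz applies to [g / l]. *)
Lemma disc_bijection_fixing_0 (g h : C -> C) : hol_disc g 1 -> hol_disc h 1 ->
  (forall z, unit_disc z -> unit_disc (g z)) -> (forall z, unit_disc z -> unit_disc (h z)) ->
  g 0 = 0 -> h 0 = 0 -> (forall z, unit_disc z -> h (g z) = z) ->
  exists kap : C, Cmod kap = 1%R /\ forall z, unit_disc z -> g z = kap * z.
Proof.
intros Hg Hh Ug Uh G0 H0 Inv.
assert (D0 := unit_disc_0). unfold unit_disc in *.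
destruct (Hg 0 D0) as [l Hl]. destruct (Hh 0 D0) as [m Hm].
assert (L1 : (Cmod l <= 1)%R).
{ apply (derivative_le_1 g); auto. intros z Hz. rewrite <- (Rmult_1_r (Cmod (g z))).
  apply schwarz; auto. intros; left; auto. }
assert (M1 : (Cmod m <= 1)%R).
{ apply (derivative_le_1 h); auto. intros z Hz. rewrite <- (Rmult_1_r (Cmod (h z))).
  apply schwarz; auto. intros; left; auto. }
assert (ML : m * l = 1).
{ apply (cdiff_unique (fun z => z) 0); [|apply cdiff_id].
  apply (cdiff_ext_loc (fun z => h (g z)) _ 0 _ 1); [lra| |].
  - intros w Hw. apply Inv. replace w with (w - 0) by ring. exact Hw.
  - apply (cdiff_comp g h); [exact Hl|]. rewrite G0. exact Hm. }
assert (E : (Cmod m * Cmod l = 1)%R) by (rewrite <- Cmod_mult, ML, Cmod_1; reflexivity).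
assert (El : Cmod l = 1%R).
{ generalize (Cmod_ge_0 l) (Cmod_ge_0 m). nra. }
assert (Nl : l <> 0) by (apply Cmod_gt_0; lra).
exists l; split; auto. intros z Hz.
assert (S : g z * / l = z).
{ apply (schwarz_equality (fun z => g z * / l) z); auto.
  - intros w Hw. destruct (Hg w Hw) as [d Hd]. eexists. apply cdiff_mult; [exact Hd|apply cdiff_const].
  - intros w Hw. rewrite Cmod_mult, Cmod_inv, El, Rinv_1, Rmult_1_r by auto. left; auto.
  - rewrite G0; ring.
  - eapply cdiff_eq; [apply cdiff_mult; [exact Hl|apply cdiff_const]|]. rewrite G0. field. auto. }
rewrite <- S at 2. field. auto.
Qed.

Lemma disc_automorphism_mobius (a : C -> C) : disc_automorphism a ->
  exists kap b : C, Cmod kap = 1%R /\ unit_disc b /\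
    forall z, unit_disc z -> a z = kap * mobius b z.
Proof.
intros (Ha & Ua & a' & Ha' & Ua' & I1 & I2).
assert (D0 := unit_disc_0).
set (b := a' 0). assert (Hb : unit_disc b) by (apply Ua'; auto).
assert (Hnb := unit_disc_opp b Hb).
destruct (disc_bijection_fixing_0 (fun w => a (mobius (- b) w)) (fun z => mobius b (a' z)))
  as (kap & K1 & K2).
- intros w Hw. destruct (mobius_cdiff (- b) w Hnb Hw) as [l Hl].
  destruct (holomorphic1_cdiff _ a Ha _ (mobius_disc (- b) w Hnb Hw)) as [m Hm].
  eexists. apply (cdiff_comp (mobius (- b)) a); eauto.
- intros w Hw. destruct (holomorphic1_cdiff _ a' Ha' _ Hw) as [l Hl].
  destruct (mobius_cdiff b _ Hb (Ua' w Hw)) as [m Hm].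
  eexists. apply (cdiff_comp a' (mobius b)); eauto.
- intros z Hz. now apply Ua, mobius_disc.
- intros z Hz. now apply mobius_disc, Ua'.
- replace (mobius (- b) 0) with b; [apply I2; auto|].
  unfold mobius. field.
- fold b. unfold mobius, Cdiv. ring.
- intros z Hz. cbv beta. rewrite I1 by now apply mobius_disc.
  replace b with (- - b) at 1 by ring. now apply mobius_inv.
- exists kap, b. repeat split; auto. intros z Hz.
  rewrite <- K2 by now apply mobius_disc. now rewrite mobius_inv.
Qed.

(** Numerator of [kap * mobius b z - z]. *)
Definition fixed_quadratic (kap b z : C) : C := Cconj b * z * z + (kap - 1) * z - kap * b.

Lemma fixed_quadratic_spec kap b z : unit_disc b -> unit_disc z ->
  kap * mobius b z - z = fixed_quadratic kap b z / (1 - Cconj b * z).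
Proof.
intros Hb Hz. assert (N := mobius_den b z Hb Hz). unfold mobius, fixed_quadratic. field. auto.
Qed.

(** The two roots lie outside the open disc, and their product [- kap * b / Cconj b] has modulus 1,
    so both lie on the circle. For [b = 0] the map would fix 0. *)
Lemma boundary_fixed_point (kap b : C) : Cmod kap = 1%R -> unit_disc b ->
  (forall z, unit_disc z -> kap * mobius b z <> z) ->
  b <> 0 /\ exists zt : C, Cmod zt = 1%R /\ fixed_quadratic kap b zt = 0.
Proof.
intros Hk Hb Nf.
assert (Nb : b <> 0).
{ intros ->. apply (Nf 0 unit_disc_0). unfold mobius, Cdiv. ring. }
split; auto.
assert (Ncb : Cconj b <> 0).
{ apply Cmod_gt_0. rewrite Cmod_conj. now apply Cmod_gt_0. }
assert (T := two_nz).
destruct (complex_sqrt ((kap - 1) * (kap - 1) + 4 * kap * b * Cconj b)) as [d Hd].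
set (z0 := (1 - kap + d) / (2 * Cconj b)). set (z1 := (1 - kap - d) / (2 * Cconj b)).
assert (Q0 : fixed_quadratic kap b z0 = 0).
{ unfold fixed_quadratic, z0.
  replace (Cconj b * ((1 - kap + d) / (2 * Cconj b)) * ((1 - kap + d) / (2 * Cconj b)) +
    (kap - 1) * ((1 - kap + d) / (2 * Cconj b)) - kap * b) with
    ((d * d - ((kap - 1) * (kap - 1) + 4 * kap * b * Cconj b)) / (4 * Cconj b)) by (field; auto).
  rewrite Hd. unfold Cdiv. ring. }
assert (Q1 : fixed_quadratic kap b z1 = 0).
{ unfold fixed_quadratic, z1.
  replace (Cconj b * ((1 - kap - d) / (2 * Cconj b)) * ((1 - kap - d) / (2 * Cconj b)) +
    (kap - 1) * ((1 - kap - d) / (2 * Cconj b)) - kap * b) with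
    ((d * d - ((kap - 1) * (kap - 1) + 4 * kap * b * Cconj b)) / (4 * Cconj b)) by (field; auto).
  rewrite Hd. unfold Cdiv. ring. }
assert (Out : forall z, fixed_quadratic kap b z = 0 -> (1 <= Cmod z)%R).
{ intros z Hz. apply Rnot_lt_le. intros L. apply (Nf z L).
  apply Ceq_minus. rewrite fixed_quadratic_spec, Hz by auto. unfold Cdiv; ring. }
assert (P : (Cmod z0 * Cmod z1 = 1)%R).
{ assert (E : z0 * z1 * Cconj b = - (kap * b)).
  { unfold z0, z1.
    replace ((1 - kap + d) / (2 * Cconj b) * ((1 - kap - d) / (2 * Cconj b)) * Cconj b) with
      (((1 - kap) * (1 - kap) - d * d) / (4 * Cconj b)) by (field; auto).
    rewrite Hd. field. auto. }
  apply (f_equal Cmod) in E. rewrite Cmod_opp, !Cmod_mult, Cmod_conj, Hk in E.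
  assert (Pb : (0 < Cmod b)%R) by now apply Cmod_gt_0.
  apply Rmult_eq_reg_r with (Cmod b); lra. }
exists z0; split; auto. generalize (Out z0 Q0) (Out z1 Q1). nra.
Qed.

Section FixedPoint.

Variables (kap b zt : C).
Hypothesis kap_1 : Cmod kap = 1%R.
Hypothesis b_disc : unit_disc b.
Hypothesis b_nz : b <> 0.
Hypothesis zt_1 : Cmod zt = 1%R.
Hypothesis zt_fixed : fixed_quadratic kap b zt = 0.

(** Rotating [zt] to 1 turns [b] into [Cconj x]; the fixed-point equation becomes
    [kap = (1 - x) / (1 - Cconj x)]. *)
Let x : C := Cconj b * zt.

(* In the coordinate [cay zt], which sends the fixed point [zt] to infinity, the automorphism is
   [Z |-> dilation * Z + translation]. *)
Definition dilation : R := (Cmod (1 - x) ^ 2 / (1 - Cmod x ^ 2))%R.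
Definition translation : R := (- (2) * snd x / (1 - Cmod x ^ 2))%R.

Lemma x_mod : (0 < Cmod x < 1)%R.
Proof.
unfold x. rewrite Cmod_mult, Cmod_conj, zt_1, Rmult_1_r. split; auto. now apply Cmod_gt_0.
Qed.

Lemma x_sq : (0 < 1 - Cmod x ^ 2)%R.
Proof. generalize x_mod. nra. Qed.

Lemma zt_conj : zt * Cconj zt = 1.
Proof. rewrite <- Cmod2_conj, zt_1. f_equal. ring. Qed.

Lemma b_eq : b = zt * Cconj x.
Proof.
unfold x. rewrite Cmult_conj, Cconj_conj.
replace (zt * (b * Cconj zt)) with ((zt * Cconj zt) * b) by ring. rewrite zt_conj. ring.
Qed.

Lemma kap_eq : kap * (1 - Cconj x) = 1 - x.
Proof.
assert (N := zt_nz zt zt_1).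
assert (E : zt * (kap * (1 - Cconj x)) = zt * (1 - x)).
{ apply Ceq_minus. rewrite <- zt_fixed. unfold fixed_quadratic. rewrite b_eq at 2.
  fold x. ring. }
replace (kap * (1 - Cconj x)) with (zt * (kap * (1 - Cconj x)) / zt) by (field; auto).
rewrite E. field. auto.
Qed.

Lemma x_conj_nz : 1 - Cconj x <> 0.
Proof. apply disc_neq_1. rewrite Cmod_conj. apply x_mod. Qed.

Lemma x_x_nz : 1 - x * Cconj x <> 0.
Proof.
rewrite <- Cmod2_conj, <- RtoC_minus. intros E; apply RtoC_inj in E. generalize x_sq; lra.
Qed.

Lemma dilation_C : RtoC dilation = (1 - x) * (1 - Cconj x) / (1 - x * Cconj x).
Proof.
unfold dilation. generalize x_sq; intros S. rewrite RtoC_div by lra.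
rewrite RtoC_minus, !Cmod2_conj, Cminus_conj. f_equal. f_equal. f_equal.
unfold Cconj, RtoC; simpl. f_equal; ring.
Qed.

Lemma translation_C : RtoC translation = Ci * (x - Cconj x) / (1 - x * Cconj x).
Proof.
unfold translation. generalize x_sq; intros S. rewrite RtoC_div by lra.
rewrite RtoC_minus, Cmod2_conj, im_alt', RtoC_mult, RtoC_opp. f_equal.
replace (Ci * (2 * Ci * RtoC (Im x))) with (2 * (Ci * Ci) * RtoC (Im x)) by ring.
rewrite Ci_sq. unfold Im. ring.
Qed.

Lemma cay_affine z : unit_disc z ->
  cay zt (kap * mobius b z) = RtoC dilation * cay zt z + RtoC translation.
Proof.
intros Hz. assert (N := zt_nz zt zt_1).
assert (Ha : unit_disc (kap * mobius b z)).
{ unfold unit_disc. rewrite Cmod_mult, kap_1, Rmult_1_l. now apply mobius_disc. }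
rewrite !(cay_eq zt zt_1), dilation_C, translation_C by auto.
set (h := z / zt). assert (Ez : z = zt * h) by (unfold h; field; auto).
assert (Nh : 1 - h <> 0) by (apply disc_neq_1; unfold h; rewrite zt_div_mod; auto).
assert (Ny := x_conj_nz). assert (Nxy := x_x_nz).
assert (Nxh : 1 - x * h <> 0).
{ assert (D := mobius_den b z b_disc Hz). unfold x, h.
  replace (Cconj b * zt * (z / zt)) with (Cconj b * z) by (field; auto). auto. }
assert (Ek : kap = (1 - x) / (1 - Cconj x)) by (rewrite <- kap_eq; field; auto).
assert (Em : kap * mobius b z = zt * ((1 - x) * (h - Cconj x) / ((1 - Cconj x) * (1 - x * h)))).
{ unfold mobius. rewrite Ek.
  replace (Cconj b * z) with (x * h) by (unfold x; rewrite Ez; ring).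
  rewrite b_eq, Ez at 1. field. auto. }
rewrite Em, Ez. set (y := Cconj x) in *.
(* The factor [1 - h] shows that infinity is fixed: the image is [zt] only at [h = 1]. *)
assert (Nd : (1 - y) * (1 - x * h) - (1 - x) * (h - y) <> 0).
{ replace ((1 - y) * (1 - x * h) - (1 - x) * (h - y)) with ((1 - h) * (1 - x * y)) by ring.
  now apply Cmult_neq_0. }
replace (zt + zt * ((1 - x) * (h - y) / ((1 - y) * (1 - x * h)))) with
  (zt * (((1 - y) * (1 - x * h) + (1 - x) * (h - y)) / ((1 - y) * (1 - x * h)))) by (field; auto).
replace (zt - zt * ((1 - x) * (h - y) / ((1 - y) * (1 - x * h)))) with
  (zt * ((1 - h) * (1 - x * y) / ((1 - y) * (1 - x * h)))) by (field; auto).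
replace (zt - zt * h) with (zt * (1 - h)) by ring.
field. auto.
Qed.

Lemma dilation_pos : (0 < dilation)%R.
Proof.
apply Rdiv_lt_0_compat; [|apply x_sq]. apply pow_lt, Cmod_gt_0, disc_neq_1, x_mod.
Qed.

Lemma dilation_1_iff : dilation = 1%R <-> x + Cconj x = 2 * (x * Cconj x).
Proof.
assert (D := dilation_C). assert (N := x_x_nz). split.
- intros E. rewrite E in D.
  assert (E2 : (1 - x) * (1 - Cconj x) = 1 - x * Cconj x).
  { replace ((1 - x) * (1 - Cconj x)) with
      ((1 - x) * (1 - Cconj x) / (1 - x * Cconj x) * (1 - x * Cconj x)) by (field; auto).
    rewrite <- D. ring. }
  replace (x + Cconj x) with (1 + x * Cconj x - (1 - x) * (1 - Cconj x)) by ring.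
  rewrite E2. ring.
- intros E. apply RtoC_inj. rewrite D.
  replace ((1 - x) * (1 - Cconj x)) with (1 + x * Cconj x - (x + Cconj x)) by ring.
  rewrite E. field. auto.
Qed.

(** Dilation 1 and translation 0 would make [x] real with [x = x^2], against [0 < |x| < 1]. *)
Lemma translation_nz : dilation = 1%R -> translation <> 0%R.
Proof.
intros E T. apply dilation_1_iff in E. generalize x_mod x_sq; intros M S.
assert (X2 : snd x = 0%R).
{ unfold translation in T. apply (f_equal (fun t => t * (1 - Cmod x ^ 2))%R) in T.
  field_simplify in T; lra. }
assert (Sq := Cmod_sq x). rewrite X2 in Sq.
apply (f_equal fst) in E. destruct x as [x1 x2]. simpl in E, X2, Sq. subst x2.
assert (x1 = 0 \/ x1 = 1)%R as [-> | ->] by (destruct (Req_dec x1 0); [now left|right; nra]);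
  nra.
Qed.

End FixedPoint.

(** * Double roots on the circle *)

Lemma locally_of_Cmod (z : C) (P : C -> Prop) (d : R) : (0 < d)%R ->
  (forall w, (Cmod (w - z) < d)%R -> P w) -> locally z P.
Proof.
intros Pd H. assert (P2 : (0 < d / 2)%R) by lra. exists (mkposreal _ P2). intros w Hw.
apply H. apply C_NormedModule_mixin_compat2 in Hw. simpl in Hw.
assert (S2 := sqrt_2_lt_2).
eapply Rlt_trans; [exact Hw|]. nra.
Qed.

Lemma Cmod_of_locally (z : C) (P : C -> Prop) : locally z P ->
  exists d : R, (0 < d)%R /\ forall w, (Cmod (w - z) < d)%R -> P w.
Proof.
intros [d Hd]. exists d; split; [apply cond_pos|]. intros w Hw. apply Hd.
now apply C_NormedModule_mixin_compat1.
Qed.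

Lemma zero_of_linear_bound (f : C -> C) (l : C) (K t0 : R) : (0 < t0)%R -> (0 <= K)%R ->
  cdiff f 0 l -> (forall t : R, (0 < t < t0)%R -> (Cmod (f (RtoC t)) <= K * t)%R) -> f 0 = 0.
Proof.
intros P0 PK Df H. apply Cmod_le_eps_eq_0. intros eps Pe.
destruct (cdiff_cont _ _ _ Df (eps / 2)%R) as [d [Pd Hd]]; [lra|].
assert (PL : (0 < eps / (2 * (K + 1)))%R) by (apply Rdiv_lt_0_compat; lra).
destruct (small_real_point (Rmin (Rmin t0 d) (eps / (2 * (K + 1))))) as (t & T0 & T1 & Mt).
{ repeat apply Rmin_pos; auto. }
apply Rmin_Rgt_l in T1. destruct T1 as [T1 T3]. apply Rmin_Rgt_l in T1. destruct T1 as [T1 T2].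
apply Rgt_lt in T3. apply (proj2 (Rlt_div_r _ _ _ (ltac:(lra) : (2 * (K + 1) > 0)%R))) in T3.
specialize (Hd (RtoC t)). replace (RtoC t - 0) with (RtoC t) in Hd by ring. rewrite Mt in Hd.
specialize (H t (conj T0 T1)). specialize (Hd T2).
generalize (Cmod_triangle_inv (f 0) (f (RtoC t))). rewrite Cmod_sub_comm. nra.
Qed.

Lemma quadratic_vanishing (A B E : C) (K t0 : R) : (0 < t0 <= 1)%R -> (0 <= K)%R ->
  (forall t : R, (0 < t < t0)%R ->
    (Cmod (A + RtoC t * B + RtoC t * RtoC t * E) <= K * t ^ 2)%R) -> A = 0 /\ B = 0.
Proof.
intros P0 PK H.
assert (A0 : A = 0).
{ assert (Z : A + 0 * B + 0 * 0 * E = 0).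
  { eapply (zero_of_linear_bound (fun z => A + z * B + z * z * E) _ K t0); auto; [lra| |].
    - apply cdiff_plus; [apply cdiff_plus; [apply cdiff_const|]|];
        (apply cdiff_mult; [|apply cdiff_const]); [|apply cdiff_mult]; apply cdiff_id.
    - intros t Ht. eapply Rle_trans; [now apply H|]. apply Rmult_le_compat_l; nra. }
  rewrite <- Z. ring. }
split; auto. subst A.
assert (Z : B + 0 * E = 0).
{ eapply (zero_of_linear_bound (fun z => B + z * E) _ K t0); auto; [lra| |].
  - apply cdiff_plus; [apply cdiff_const|]. apply cdiff_mult; [apply cdiff_id|apply cdiff_const].
  - intros t Ht. specialize (H t Ht).
    replace (0 + RtoC t * B + RtoC t * RtoC t * E) with (RtoC t * (B + RtoC t * E)) in H by ring.
    rewrite Cmod_mult, Cmod_R, Rabs_pos_eq in H by lra.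
    apply Rmult_le_reg_l with t; lra. }
rewrite <- Z. ring.
Qed.

Section DoubleRoot.

Variables (a : C -> C) (kap b zt : C).
Hypothesis kap_1 : Cmod kap = 1%R.
Hypothesis b_disc : unit_disc b.
Hypothesis b_nz : b <> 0.
Hypothesis zt_1 : Cmod zt = 1%R.
Hypothesis zt_fixed : fixed_quadratic kap b zt = 0.
Hypothesis a_eq : forall z, unit_disc z -> a z = kap * mobius b z.

Let x : C := Cconj b * zt.

(** Dilation 1 gives [kap = 1 - 2 * x] and [kap * b = - (x * zt)], whence [fixed_quadratic kap b z =
    Cconj b * (z - zt) ^ 2]. *)
Lemma double_root_of_dilation : dilation b zt = 1%R ->
  has_double_root_on_circle (fun z => a z - z).
Proof.
intros E. apply (dilation_1_iff b zt b_disc b_nz zt_1) in E. fold x in E.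
assert (Ny := x_conj_nz b zt b_disc b_nz zt_1). fold x in Ny.
assert (Ke := kap_eq kap b zt zt_1 zt_fixed). fold x in Ke.
assert (Be := b_eq b zt zt_1). fold x in Be.
assert (K2 : kap = 1 - 2 * x).
{ assert (Q : kap * (1 - Cconj x) = (1 - 2 * x) * (1 - Cconj x)).
  { rewrite Ke. replace ((1 - 2 * x) * (1 - Cconj x)) with
      (1 - 2 * x - Cconj x + 2 * (x * Cconj x)) by ring. rewrite <- E. ring. }
  replace kap with (kap * (1 - Cconj x) / (1 - Cconj x)) by (field; auto).
  rewrite Q. field. auto. }
assert (K3 : kap * b = - (x * zt)).
{ rewrite Be, K2. replace ((1 - 2 * x) * (zt * Cconj x)) with
    (zt * (Cconj x - 2 * (x * Cconj x))) by ring. rewrite <- E. ring. }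
assert (Den : forall z, (Cmod (Cconj b * z) < 1)%R -> 1 - Cconj b * z <> 0)
  by (intros; now apply disc_neq_1).
assert (Pb : (0 < Cmod b)%R) by now apply Cmod_gt_0.
assert (Op : forall z, (Cmod (Cconj b * z) < 1)%R ->
  exists d : R, (0 < d)%R /\ forall w, (Cmod (w - z) < d)%R -> (Cmod (Cconj b * w) < 1)%R).
{ intros z Hz. exists ((1 - Cmod (Cconj b * z)) / Cmod b)%R. split.
  - apply Rdiv_lt_0_compat; lra.
  - intros w Hw. apply (proj2 (Rlt_div_r _ _ _ Pb)) in Hw.
    replace (Cconj b * w) with (Cconj b * z + Cconj b * (w - z)) by ring.
    eapply Rle_lt_trans; [apply Cmod_triangle|].
    rewrite (Cmod_mult _ (w - z)), Cmod_conj. lra. }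
(* The disc of radius [1 / |b| > 1], up to the pole of [mobius b]. *)
exists (fun z => (Cmod (Cconj b * z) < 1)%R), (fun z => kap * mobius b z - z).
repeat split.
- intros z Hz. destruct (Op z Hz) as [d [Pd Hd]]. now apply (locally_of_Cmod z _ d).
- intros z Hz. rewrite Cmod_mult, Cmod_conj. unfold unit_disc in b_disc.
  generalize (Cmod_ge_0 z). nra.
- intros z Hz. assert (D := Den z Hz). eexists. apply cdiff_is_derive.
  apply cdiff_minus; [|apply cdiff_id]. apply cdiff_mult; [apply cdiff_const|].
  apply cdiff_div; auto.
  + apply cdiff_minus; [apply cdiff_id|apply cdiff_const].
  + apply cdiff_minus; [apply cdiff_const|]. apply cdiff_mult; [apply cdiff_const|apply cdiff_id].
- intros z Hz. now rewrite a_eq.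
- exists zt; split; auto. exists (fun z => Cconj b / (1 - Cconj b * z)).
  assert (Z0 : (Cmod (Cconj b * zt) < 1)%R) by (rewrite Cmod_mult, Cmod_conj, zt_1; unfold unit_disc in b_disc; lra).
  split.
  + apply Cmult_neq_0.
    * apply Cmod_gt_0. now rewrite Cmod_conj.
    * intros K. apply C1_nz. rewrite <- (Cinv_r _ (Den zt Z0)), K. ring.
  + destruct (Op zt Z0) as [d [Pd Hd]]. apply (locally_of_Cmod zt _ d); auto.
    intros z Hz. specialize (Hd z Hz). assert (D := Den z Hd). split.
    * eexists. apply cdiff_is_derive. apply cdiff_div; auto; [apply cdiff_const|].
      apply cdiff_minus; [apply cdiff_const|]. apply cdiff_mult; [apply cdiff_const|apply cdiff_id].
    * unfold mobius. replace (kap * ((z - b) / (1 - Cconj b * z)) - z) with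
        ((kap * z - kap * b - z * (1 - Cconj b * z)) / (1 - Cconj b * z)) by (field; auto).
      rewrite K3, K2. unfold x. simpl Cpow. field. auto.
Qed.

(** [g] is known to be [a z - z] only inside the disc, so [zeta] is approached radially by
    [(1 - t) zeta]. There [fixed_quadratic] is [O(t^2)], so [zeta] is its double root and the root
    [zt] equals [zeta]. *)
Lemma dilation_of_double_root :
  has_double_root_on_circle (fun z => a z - z) -> dilation b zt = 1%R.
Proof.
intros (U & g & _ & HU & Hg & Ga & zeta & Z1 & h & _ & Hl).
destruct (Cmod_of_locally _ _ Hl) as [d [Pd Hd]].
assert (Hz0 : (Cmod (zeta - zeta) < d)%R).
{ replace (zeta - zeta) with (RtoC 0) by ring. now rewrite Cmod_0. }
destruct (Hd zeta Hz0) as [[l Dh] _]. apply cdiff_is_derive in Dh.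
destruct (cdiff_cont _ _ _ Dh 1%R Rlt_0_1) as [d' [Pd' Hd']].
set (K := (2 * (Cmod (h zeta) + 1))%R).
assert (Gh := Cmod_ge_0 (h zeta)).
assert (V : fixed_quadratic kap b zeta = 0 /\ - zeta * (2 * Cconj b * zeta + kap - 1) = 0).
{ apply (quadratic_vanishing _ _ (Cconj b * zeta * zeta) K (Rmin 1 (Rmin d d'))).
  - split; [repeat apply Rmin_pos; lra|apply Rmin_l].
  - unfold K; lra.
  - intros t [T0 T1]. apply Rmin_Rgt_l in T1. destruct T1 as [T1 T2].
    apply Rmin_Rgt_l in T2. destruct T2 as [T2 T3].
    set (z := zeta - RtoC t * zeta).
    assert (Mz : Cmod (z - zeta) = t).
    { unfold z. replace (zeta - RtoC t * zeta - zeta) with (- (RtoC t * zeta)) by ring.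
      rewrite Cmod_opp, Cmod_mult, Cmod_R, Z1, Rabs_pos_eq; lra. }
    assert (Uz : unit_disc z).
    { unfold unit_disc, z. replace (zeta - RtoC t * zeta) with (RtoC (1 - t) * zeta)
        by (rewrite RtoC_minus; ring).
      rewrite Cmod_mult, Cmod_R, Z1, Rabs_pos_eq; lra. }
    replace (fixed_quadratic kap b zeta + RtoC t * (- zeta * (2 * Cconj b * zeta + kap - 1)) +
      RtoC t * RtoC t * (Cconj b * zeta * zeta)) with (fixed_quadratic kap b z)
      by (unfold fixed_quadratic, z; ring).
    assert (D := mobius_den b z b_disc Uz).
    assert (Q := Ga z Uz). cbv beta in Q. rewrite a_eq, fixed_quadratic_spec in Q by auto.
    destruct (Hd z ltac:(lra)) as [_ Gz]. rewrite Gz in Q.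
    assert (Q2 : fixed_quadratic kap b z = (z - zeta) ^ 2 * h z * (1 - Cconj b * z)).
    { rewrite Q. field. auto. }
    rewrite Q2, !Cmod_mult, Cmod_pow, Mz.
    assert (B1 : (Cmod (h z) <= Cmod (h zeta) + 1)%R).
    { generalize (Cmod_triangle_inv (h z) (h zeta)) (Hd' z ltac:(lra)). lra. }
    assert (B2 : (Cmod (1 - Cconj b * z) <= 2)%R).
    { eapply Rle_trans; [apply Cmod_sub_triangle|]. rewrite Cmod_1, Cmod_mult, Cmod_conj.
      unfold unit_disc in *. generalize (Cmod_ge_0 b) (Cmod_ge_0 z). nra. }
    replace (K * t ^ 2)%R with (t ^ 2 * (Cmod (h zeta) + 1) * 2)%R by (unfold K; ring).
    assert (0 < t ^ 2)%R by now apply pow_lt.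
    apply Rmult_le_compat; auto using Cmod_ge_0.
    + apply Rmult_le_pos; [lra|apply Cmod_ge_0].
    + apply Rmult_le_compat_l; lra. }
destruct V as [V0 V1].
assert (Nz : zeta <> 0) by (apply Cmod_gt_0; lra).
assert (V2 : 2 * Cconj b * zeta + kap - 1 = 0).
{ replace (2 * Cconj b * zeta + kap - 1) with
    (- (- zeta * (2 * Cconj b * zeta + kap - 1)) / zeta) by (field; auto).
  rewrite V1. field. auto. }
(* Taylor expansion of the quadratic at [zeta], evaluated at its root [zt]. *)
assert (V3 : Cconj b * ((zt - zeta) * (zt - zeta)) = 0).
{ replace (Cconj b * ((zt - zeta) * (zt - zeta))) with
    (fixed_quadratic kap b zt - fixed_quadratic kap b zeta -
     (2 * Cconj b * zeta + kap - 1) * (zt - zeta)) by (unfold fixed_quadratic; ring).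
  rewrite zt_fixed, V0, V2. ring. }
assert (Ez : zt = zeta).
{ destruct (Ceq_dec (zt - zeta) 0) as [E|N]; [now apply Ceq_minus|]. exfalso.
  revert V3. apply Cmult_neq_0; [|now apply Cmult_neq_0].
  apply Cmod_gt_0. rewrite Cmod_conj. now apply Cmod_gt_0. }
apply (dilation_1_iff b zt b_disc b_nz zt_1). fold x.
assert (Ke := kap_eq kap b zt zt_1 zt_fixed). fold x in Ke.
rewrite <- Ez in V2.
assert (K2 : kap = 1 - 2 * x).
{ apply Ceq_minus. rewrite <- V2. unfold x. ring. }
rewrite K2 in Ke. apply Ceq_minus.
replace (x + Cconj x - 2 * (x * Cconj x)) with
  ((1 - x) - (1 - 2 * x) * (1 - Cconj x)) by ring.
rewrite Ke. ring.
Qed.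

End DoubleRoot.

(** * The two families of geodesics *)

(** With [c = |alpha|^2], [f lam] has sum [2 (1 - c) lam / (1 - Cconj alpha^2 lam)] and product [lam
    (lam - alpha^2) / (1 - Cconj alpha^2 lam)]. This [zt] gives [alpha^2 = c zt], and
    [Cconj alpha^2 lam = c h] for [lam = zt h]: up to powers of [zt], only the real [c] remains. *)
Lemma root_form_model alpha f u : unit_disc alpha -> alpha <> 0 -> root_form alpha f ->
  let zt := alpha / Cconj alpha in
  UH u -> f (icay zt u) = Psi zt (u, RtoC (Cmod alpha ^ 2) * (u * u + 1)).
Proof.
intros Ha Na [_ Hf] zt Hu. set (y := Cconj alpha) in *.
assert (Ny : y <> 0) by (apply Cmod_gt_0; unfold y; rewrite Cmod_conj; now apply Cmod_gt_0).
assert (zt_1 : Cmod zt = 1%R).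
{ unfold zt. rewrite Cmod_div by auto. unfold y. rewrite Cmod_conj. field.
  intros E. apply Na, Cmod_eq_0, E. }
set (lam := icay zt u). assert (Hl : unit_disc lam) by now apply icay_disc.
destruct (complex_sqrt lam) as [w Hw].
assert (Hw2 : w ^ 2 = lam) by (rewrite <- Hw; simpl; ring).
rewrite (Hf lam Hl w Hw2).
assert (Uw : unit_disc w).
{ unfold unit_disc in *. rewrite <- Hw, Cmod_mult in Hl. generalize (Cmod_ge_0 w). nra. }
assert (D1 := mobius_den alpha w Ha Uw).
assert (D2 := mobius_den alpha (- w) Ha (unit_disc_opp w Uw)). fold y in D1, D2.
set (h := half_to_disc Ci u).
assert (Mh : (Cmod h < 1)%R) by (apply half_to_disc_lt; auto using UH_Ci).
assert (El : w * w = zt * h) by (rewrite Hw; reflexivity).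
assert (N := UH_plus_Ci u Hu).
assert (Eh : u - Ci = h * (u + Ci)).
{ unfold h, half_to_disc. rewrite Cconj_Ci. field.
  intros E; apply N; rewrite <- E; ring. }
assert (Ec : RtoC (Cmod alpha ^ 2) = alpha * y) by apply Cmod2_conj.
assert (Eh2 : h = w * w * y / alpha) by (rewrite El; unfold zt; field; auto).
assert (D3 : 1 - y * y * w * w <> 0).
{ replace (1 - y * y * w * w) with ((1 - y * w) * (1 - y * - w)) by ring.
  now apply Cmult_neq_0. }
set (s := u + Ci) in *.
assert (E1 : u * u + 1 = h * (s * s)).
{ replace (u * u + 1) with ((u - Ci) * s) by
    (unfold s; replace ((u - Ci) * (u + Ci)) with (u * u - Ci * Ci) by ring; rewrite Ci_sq; ring).
  rewrite Eh. ring. }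
unfold Psi, sympi, Blaschke. fold y s. rewrite E1, Eh, Ec, Eh2. simpl fst. simpl snd.
assert (D4 : 1 + y * w <> 0) by (replace (1 + y * w) with (1 - y * - w) by ring; auto).
assert (E5 : s * s - alpha * y * (w * w * y / alpha * (s * s)) = s * s * (1 - y * y * w * w))
  by (field; auto).
rewrite E5. unfold zt. f_equal.
- replace (1 - y * - w) with (1 + y * w) by ring. field. repeat split; assumption.
- replace (1 - y * - w) with (1 + y * w) by ring. field. repeat split; assumption.
Qed.

Lemma root_form_unique alpha f : complex_geodesic f -> root_form alpha f ->
  unit_disc alpha -> alpha <> 0 -> has_unique_left_inverse f.
Proof.
intros (_ & _ & Ex) Hr Ha Na. set (zt := alpha / Cconj alpha).
assert (Pa : (0 < Cmod alpha)%R) by now apply Cmod_gt_0.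
assert (zt_1 : Cmod zt = 1%R).
{ unfold zt. rewrite Cmod_div.
  - rewrite Cmod_conj. field. lra.
  - apply Cmod_gt_0. now rewrite Cmod_conj. }
apply (unique_of_model zt zt_1 f (fun u _ => u)); auto.
intros F (HF & FU & Ff). unfold unit_disc in Ha.
apply (parabola_rigidity (model zt F) (model_diff zt zt_1 F HF FU) (model_UH zt zt_1 F FU)
  (Cmod alpha ^ 2)).
- split; [now apply pow_lt|]. nra.
- intros u Hu. unfold model.
  assert (E := root_form_model alpha f u Ha Na Hr Hu). fold zt in E. cbv zeta in E.
  rewrite <- E, Ff by now apply icay_disc. now apply cay_icay.
Qed.

Lemma minus_one_mod : Cmod (- (1)) = 1%R.
Proof. rewrite Cmod_opp. apply Cmod_1. Qed.

(** Here [f z = (2 z, z^2)] is the graph of the identity, so every boundary point [zt] yields an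
    arithmetic inverse. Those for 1 and -1 take opposite nonzero values at [(0, 1/4)], where both
    Cayley means are [3 i / 5]. *)
Lemma root_form_0_not_unique f : root_form 0 f -> ~ has_unique_left_inverse f.
Proof.
intros [_ Hf] [_ Uq].
assert (Fg : forall z, unit_disc z -> f z = sympi (z, z)).
{ intros z Hz. destruct (complex_sqrt z) as [w Hw].
  rewrite (Hf z Hz w) by (rewrite <- Hw; simpl; ring).
  unfold Blaschke, sympi; simpl fst; simpl snd.
  replace (Cconj 0) with (RtoC 0) by (unfold Cconj, RtoC; simpl; f_equal; ring).
  rewrite <- Hw. f_equal; field; auto using C1_nz. }
assert (LI : forall zt, Cmod zt = 1%R -> is_left_inverse f (arithmetic_inverse zt 1 0)).
{ intros zt Z. apply (arithmetic_left_inverse zt Z f (fun z => z)); auto; [lra|].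
  intros z _. ring. }
set (z := RtoC (/ 2) * Ci).
assert (Hz : unit_disc z).
{ unfold unit_disc, z. rewrite Cmod_mult, Cmod_Ci, Cmod_R, Rabs_pos_eq; lra. }
assert (E := Uq _ _ (LI 1 Cmod_1) (LI (- (1)) minus_one_mod) (sympi (z, - z))
  (ex_intro _ (z, - z) (conj Hz (conj (unit_disc_opp z Hz) eq_refl)))).
assert (Pz : sympi (z, - z) = (RtoC 0, RtoC (/ 4))).
{ unfold sympi; simpl fst; simpl snd. f_equal; [ring|].
  unfold z. replace (RtoC (/ 2) * Ci * - (RtoC (/ 2) * Ci)) with
    (- (Ci * Ci) * (RtoC (/ 2) * RtoC (/ 2))) by ring.
  rewrite Ci_sq, <- RtoC_mult. replace (/ 2 * / 2)%R with (/ 4)%R by field. ring. }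
rewrite Pz in E. unfold arithmetic_inverse, icay, cay_mean in E. simpl fst in E; simpl snd in E.
set (X := (2 * _ - _) / _) in E at 1.
replace (- (1) * - (1)) with (1 * 1 : C) in E by ring.
replace (1 * 1 - - (1) * 0 + RtoC (/ 4)) with (1 * 1 - 1 * 0 + RtoC (/ 4)) in E by ring.
fold X in E.
assert (X0 : X = (0%R, (3 / 5)%R)).
{ unfold X. rewrite RtoC_inv by lra.
  replace ((2 * (Ci * (1 * 1 - / RtoC 4) / (1 * 1 - 1 * 0 + / RtoC 4)) - RtoC 0) / RtoC (1 + 1)) with
    (RtoC (3 / 5) * Ci).
  - unfold RtoC, Ci, Cmult; simpl. f_equal; ring.
  - rewrite RtoC_div, RtoC_plus by lra. field. }
assert (H0 : half_to_disc Ci X = 0).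
{ assert (T : 2 * half_to_disc Ci X = 0).
  { replace (2 * half_to_disc Ci X) with (1 * half_to_disc Ci X - - (1) * half_to_disc Ci X) by ring.
    rewrite <- E. ring. }
  replace (half_to_disc Ci X) with (/ 2 * (2 * half_to_disc Ci X)) by (field; apply two_nz).
  rewrite T. ring. }
assert (UX : UH X) by (rewrite X0; unfold UH; simpl; lra).
assert (K := disc_to_half_inv Ci X UH_Ci UX). rewrite H0, disc_to_half_0, X0 in K.
apply (f_equal snd) in K. simpl in K. lra.
Qed.

(** Here [f z = (0, - z)]. Minus the product and the Cayley mean at 1 are both left inverses; at
    [sympi (1/2, 1/2)] they give [-1/4] and [1/2]. *)
Lemma root_form_1_not_unique f : root_form 1 f -> ~ has_unique_left_inverse f.
Proof.
intros [_ Hf] [_ Uq].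
assert (Fg : forall z, unit_disc z -> f z = (RtoC 0, - z)).
{ intros z Hz. destruct (complex_sqrt z) as [w Hw].
  rewrite (Hf z Hz w) by (rewrite <- Hw; simpl; ring).
  assert (Uw : unit_disc w).
  { unfold unit_disc in *. rewrite <- Hw, Cmod_mult in Hz. generalize (Cmod_ge_0 w). nra. }
  assert (N1 := disc_neq_1 w Uw). assert (N2 := disc_neq_1 (- w) (unit_disc_opp w Uw)).
  unfold Blaschke, sympi; simpl fst; simpl snd.
  replace (Cconj 1) with (RtoC 1) by (unfold Cconj, RtoC; simpl; f_equal; ring).
  replace (1 * w) with w by ring. replace (1 * - w) with (- w) by ring.
  rewrite <- Hw. f_equal; field; split; auto; intros K; apply N2; rewrite <- K; ring. }
assert (L1 : is_left_inverse f (fun p => - snd p)).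
{ repeat split.
  - intros p _. apply ex_filterdiff_cdiff2. apply ex_cdiff2_opp, ex_cdiff2_snd.
  - intros p ([z w] & Hz & Hw & ->). unfold unit_disc, sympi in *; simpl in *.
    rewrite Cmod_opp, Cmod_mult. generalize (Cmod_ge_0 z) (Cmod_ge_0 w). nra.
  - intros z Hz. rewrite Fg by auto. simpl. ring. }
assert (L2 : is_left_inverse f (fun p => icay 1 (cay_mean 1 p))).
{ apply (left_inverse_of_model 1 Cmod_1 f (cay_mean 1)).
  - intros z w Hz Hw. split; [now apply ex_cdiff2_cay_mean; [apply Cmod_1| |]|].
    rewrite cay_mean_sympi by (auto; apply Cmod_1).
    rewrite Cmult_comm, <- (RtoC_inv 2) by lra. apply UH_scal; [lra|].
    apply UH_plus; apply cay_UH; auto; apply Cmod_1.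
  - intros z Hz. rewrite Fg, cay_eq by (auto; apply Cmod_1). unfold cay_mean; simpl.
    assert (N := disc_neq_1 z Hz). field. auto. }
set (z := RtoC (/ 2)).
assert (Hz : unit_disc z) by (unfold unit_disc, z; rewrite Cmod_R, Rabs_pos_eq; lra).
assert (E := Uq _ _ L1 L2 (sympi (z, z)) (ex_intro _ (z, z) (conj Hz (conj Hz eq_refl)))).
cbv beta in E. rewrite cay_mean_sympi in E by (auto; apply Cmod_1).
replace ((cay 1 z + cay 1 z) * / 2) with (cay 1 z) in E by (field; apply two_nz).
rewrite icay_cay in E by (auto; apply Cmod_1).
apply (f_equal fst) in E. unfold z in E. simpl in E. lra.
Qed.

Lemma graph_form_unique_iff f a : complex_geodesic f -> graph_form a f ->
  (has_unique_left_inverse f <-> has_double_root_on_circle (fun z => a z - z)).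
Proof.
intros _ (Aut & Nf & Fg).
destruct (disc_automorphism_mobius a Aut) as (kap & b & K1 & Hb & Ha).
destruct (boundary_fixed_point kap b K1 Hb) as (Nb & zt & Z1 & Zf).
{ intros z Hz. rewrite <- Ha by auto. now apply Nf. }
assert (Ua : forall z, unit_disc z -> unit_disc (a z)) by apply Aut.
assert (Aff : forall z, unit_disc z ->
  cay zt (a z) = RtoC (dilation b zt) * cay zt z + RtoC (translation b zt)).
{ intros z Hz. rewrite Ha by auto. now apply cay_affine. }
assert (Dp := dilation_pos b zt Hb Nb Z1).
split.
- intros Un. apply (double_root_of_dilation a kap b zt); auto.
  destruct (Req_dec (dilation b zt) 1) as [E|N]; auto. exfalso.
  exact (graph_not_unique zt Z1 f a _ _ Dp Ua Aff Fg N Un).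
- intros Dr. assert (E := dilation_of_double_root a kap b zt Hb Nb Z1 Zf Ha Dr).
  apply (graph_unique zt Z1 f a _ _ Dp Ua Aff Fg E). now apply translation_nz.
Qed.

Lemma holomorphic1_C2 (f1 f2 : C -> C) (D : C -> Prop) :
  (forall z, D z -> exists l, cdiff f1 z l) -> (forall z, D z -> exists l, cdiff f2 z l) ->
  holomorphic1 (V := C2) D (fun z => (f1 z, f2 z)).
Proof.
intros H1 H2 z Hz. destruct (H1 z Hz) as [l1 L1]. destruct (H2 z Hz) as [l2 L2].
exists ((l1, l2) : C2). split; [apply is_linear_scal_l|].
intros y Hy eps.
assert (y = z) as -> by (symmetry; apply (is_filter_lim_locally_unique (V := AbsRing_NormedModule C_AbsRing) z y Hy)).
assert (Pe : (0 < eps / 2)%R) by (generalize (cond_pos eps); lra).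
destruct (L1 _ Pe) as [d1 [Pd1 Q1]]. destruct (L2 _ Pe) as [d2 [Pd2 Q2]].
assert (Pm : (0 < Rmin d1 d2)%R) by now apply Rmin_pos.
exists (mkposreal _ Pm). intros w Hw. apply Rmin_Rgt_l in Hw. destruct Hw as [W1 W2].
specialize (Q1 w W1). specialize (Q2 w W2).
eapply Rle_trans; [apply C2_norm_le|].
rewrite (Cmult_comm l1) in Q1. rewrite (Cmult_comm l2) in Q2.
change (Cmod (f1 w - f1 z - (w - z) * l1) + Cmod (f2 w - f2 z - (w - z) * l2)
  <= eps * Cmod (w - z))%R. lra.
Qed.

Definition affine_aut (k tau : R) (z : C) : C := icay 1 (RtoC k * cay 1 z + RtoC tau).

(** * Graph geodesics with prescribed dilation and translation *)

Section Example.

Variables k tau : R.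
Hypothesis k_pos : (0 < k)%R.
Hypothesis no_fixed : forall u, UH u -> RtoC k * u + RtoC tau <> u.

Lemma affine_UH (k0 tau0 : R) u : (0 < k0)%R -> UH u -> UH (RtoC k0 * u + RtoC tau0).
Proof. intros Hk Hu. now apply UH_plus_R, UH_scal. Qed.

Lemma affine_aut_disc (k0 tau0 : R) z : (0 < k0)%R -> unit_disc z -> unit_disc (affine_aut k0 tau0 z).
Proof. intros Hk Hz. apply icay_disc; [apply Cmod_1|]. apply affine_UH, cay_UH; auto. apply Cmod_1. Qed.

Lemma cay_affine_aut (k0 tau0 : R) z : (0 < k0)%R -> unit_disc z ->
  cay 1 (affine_aut k0 tau0 z) = RtoC k0 * cay 1 z + RtoC tau0.
Proof. intros Hk Hz. apply cay_icay; [apply Cmod_1|]. apply affine_UH, cay_UH; auto. apply Cmod_1. Qed.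

Lemma affine_aut_cdiff (k0 tau0 : R) z : (0 < k0)%R -> unit_disc z -> exists l, cdiff (affine_aut k0 tau0) z l.
Proof.
intros Hk Hz. destruct (cay_cdiff 1 Cmod_1 z Hz) as [l Hl].
destruct (icay_cdiff 1 (RtoC k0 * cay 1 z + RtoC tau0)) as [m Hm].
{ apply affine_UH, cay_UH; auto. apply Cmod_1. }
eexists. apply (cdiff_comp (fun z => RtoC k0 * cay 1 z + RtoC tau0) (icay 1)); [|exact Hm].
apply cdiff_plus; [|apply cdiff_const]. apply cdiff_mult; [apply cdiff_const|exact Hl].
Qed.

Lemma affine_aut_inverse (k0 tau0 : R) z : (0 < k0)%R -> unit_disc z ->
  affine_aut (/ k0) (- tau0 / k0) (affine_aut k0 tau0 z) = z.
Proof.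
intros Hk Hz. unfold affine_aut at 1. rewrite cay_affine_aut by auto.
assert (Nk : RtoC k0 <> 0) by (intros E; apply RtoC_inj in E; lra).
replace (RtoC (/ k0) * (RtoC k0 * cay 1 z + RtoC tau0) + RtoC (- tau0 / k0)) with (cay 1 z).
- apply icay_cay; auto. apply Cmod_1.
- rewrite RtoC_div, RtoC_inv, RtoC_opp by lra. field. auto.
Qed.

Lemma affine_aut_graph : graph_form (affine_aut k tau) (fun z => sympi (z, affine_aut k tau z)).
Proof.
assert (Pk : (0 < / k)%R) by now apply Rinv_0_lt_compat.
repeat split.
- intros z Hz. destruct (affine_aut_cdiff k tau z k_pos Hz) as [l Hl].
  exists l. now apply cdiff_is_derive.
- intros z Hz. now apply affine_aut_disc.
- exists (affine_aut (/ k) (- tau / k)). repeat split.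
  + intros z Hz. destruct (affine_aut_cdiff (/ k) (- tau / k) z Pk Hz) as [l Hl].
    exists l. now apply cdiff_is_derive.
  + intros z Hz. now apply affine_aut_disc.
  + intros z Hz. now apply affine_aut_inverse.
  + intros z Hz. assert (I := affine_aut_inverse (/ k) (- tau / k) z Pk Hz).
    rewrite Rinv_inv in I. replace (- (- tau / k) / / k)%R with tau in I by (field; lra). exact I.
- intros z Hz E. apply (f_equal (cay 1)) in E. rewrite cay_affine_aut in E by auto.
  revert E. apply no_fixed, cay_UH; auto. apply Cmod_1.
Qed.

Lemma affine_aut_left_inverse :
  is_left_inverse (fun z => sympi (z, affine_aut k tau z)) (arithmetic_inverse 1 k tau).
Proof.
apply (arithmetic_left_inverse 1 Cmod_1 _ (affine_aut k tau)); auto.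
- intros; now apply affine_aut_disc.
- intros; now apply cay_affine_aut.
Qed.

Lemma affine_aut_geodesic : complex_geodesic (fun z => sympi (z, affine_aut k tau z)).
Proof.
repeat split.
- apply (holomorphic1_C2 (fun z => z + affine_aut k tau z) (fun z => z * affine_aut k tau z)).
  + intros z Hz. destruct (affine_aut_cdiff k tau z k_pos Hz) as [l Hl]. eexists.
    apply cdiff_plus; [apply cdiff_id|exact Hl].
  + intros z Hz. destruct (affine_aut_cdiff k tau z k_pos Hz) as [l Hl]. eexists.
    apply cdiff_mult; [apply cdiff_id|exact Hl].
- intros z Hz. exists (z, affine_aut k tau z). simpl. auto using affine_aut_disc.
- eexists. apply affine_aut_left_inverse.
Qed.

End Example.

Theorem theorem5p4 :
  (forall (f : C -> C * C) (alpha : C),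
     complex_geodesic f -> root_form alpha f ->
     (has_unique_left_inverse f <-> unit_disc alpha /\ alpha <> 0)) /\
  (forall (f : C -> C * C) (a : C -> C),
     complex_geodesic f -> graph_form a f ->
     (has_unique_left_inverse f <->
      has_double_root_on_circle (fun z : C => a z - z))) /\
  (exists (f : C -> C * C) (a : C -> C),
     complex_geodesic f /\ graph_form a f /\ has_unique_left_inverse f) /\
  (exists (f : C -> C * C) (a : C -> C),
     complex_geodesic f /\ graph_form a f /\ ~ has_unique_left_inverse f).
Proof.
split; [|split; [exact graph_form_unique_iff|split]].
- intros f alpha Gf Hr. split.
  + intros Un. destruct (proj1 Hr) as [Ha | ->].
    * split; auto. intros ->. now apply (root_form_0_not_unique f).
    * exfalso. now apply (root_form_1_not_unique f).
  + intros [Ha Na]. now apply (root_form_unique alpha f).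
(* A translation of the half-plane, fixing only infinity. *)
- exists (fun z => sympi (z, affine_aut 1 1 z)), (affine_aut 1 1). split; [|split].
  + apply affine_aut_geodesic. lra.
  + apply affine_aut_graph; [lra|]. intros u _ E. apply (f_equal fst) in E. simpl in E. lra.
  + apply (graph_unique 1 Cmod_1 _ (affine_aut 1 1) 1 1); auto; try lra.
    * intros; apply affine_aut_disc; auto; lra.
    * intros; apply cay_affine_aut; auto; lra.
(* A dilation of the half-plane, fixing the two boundary points 0 and infinity. *)
- exists (fun z => sympi (z, affine_aut 2 0 z)), (affine_aut 2 0). split; [|split].
  + apply affine_aut_geodesic. lra.
  + apply affine_aut_graph; [lra|]. intros u Hu E. apply (f_equal snd) in E.
    unfold UH in Hu. simpl in E. lra.
  + apply (graph_not_unique 1 Cmod_1 _ (affine_aut 2 0) 2 0); auto; try lra.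
    * intros; apply affine_aut_disc; auto; lra.
    * intros; apply cay_affine_aut; auto; lra.
Qed.
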